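(* Let $f(z)=z+\sum_{n=2}^\infty a_nz^n\in\mathcal{A}$ and let $f_2(z)=z+a_2z^2$ denote its second partial sum. (1) If $f\in\mathcal{K}$, then $f_2(\rho z)/\rho\in\mathcal{S}^*_{car}$ for $0<\rho\le1/3$. (2) If $f\in\mathcal{S}$ (or $f\in\mathcal{S}^*$, or $f\in\mathcal{C}$), then $f_2(\rho z)/\rho\in\mathcal{S}^*_{car}$ for $0<\rho\le1/6$.
   Context: $\mathbb{D}=\{z:|z|<1\}$; $\mathcal{A}$ is the class of analytic $f$ on $\mathbb{D}$ with $f(0)=0$, $f'(0)=1$. $\mathcal{S}$, $\mathcal{S}^*$, $\mathcal{K}$ are the subclasses of univalent, starlike and convex functions in $\mathcal{A}$; $\mathcal{C}$ is the class of close-to-convex functions in $\mathcal{A}$ (those $f$ for which there is a convex univalent $g$, not necessarily normalized, with $\operatorname{Re}(f'(z)/g'(z))>0$ on $\mathbb{D}$). $F\prec G$ means $F=G\circ w$ for an analytic $w:\mathbb{D}\to\mathbb{D}$ with $w(0)=0$. $\mathcal{S}^*_{car}$ is the class of $f\in\mathcal{A}$ with $zf'(z)/f(z)\prec 1+z+z^2/2$ in $\mathbb{D}$. *)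

(* Defs.v *)
From Stdlib Require Import Reals.
From Coquelicot Require Import Coquelicot.
From Stdlib Require Import ClassicalEpsilon.
Open Scope C_scope.

Definition inD (z : C) : Prop := Cmod z < 1.

Definition analytic_on_D (f : C -> C) : Prop :=
  forall z, inD z -> exists l : C, is_derive f z l.

Definition classA (f : C -> C) : Prop :=
  analytic_on_D f /\ f (RtoC 0) = RtoC 0 /\ is_derive f (RtoC 0) (RtoC 1).

Definition univalent_on_D (f : C -> C) : Prop :=
  forall z1 z2, inD z1 -> inD z2 -> f z1 = f z2 -> z1 = z2.

Definition convex_image (f : C -> C) : Prop :=
  forall z1 z2 (t : R), inD z1 -> inD z2 -> (0 <= t <= 1)%R ->
    exists z3, inD z3 /\ f z3 = (RtoC 1 - RtoC t) * f z1 + RtoC t * f z2.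

Definition starlike_image (f : C -> C) : Prop :=
  forall z (t : R), inD z -> (0 <= t <= 1)%R ->
    exists w, inD w /\ f w = RtoC t * f z.

Definition classS (f : C -> C) : Prop := classA f /\ univalent_on_D f.
Definition classSstar (f : C -> C) : Prop := classS f /\ starlike_image f.
Definition classK (f : C -> C) : Prop := classS f /\ convex_image f.

Definition convex_univalent (g : C -> C) : Prop :=
  analytic_on_D g /\ univalent_on_D g /\ convex_image g.

Definition classCC (f : C -> C) : Prop :=
  classA f /\
  exists g, convex_univalent g /\
    forall z df dg, inD z -> is_derive f z df -> is_derive g z dg ->
      (0 < Re (df / dg))%R.

Definition subordinate (F G : C -> C) : Prop :=
  exists w : C -> C, analytic_on_D w /\ w (RtoC 0) = RtoC 0 /\
    (forall z, inD z -> inD (w z)) /\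
    (forall z, inD z -> F z = G (w z)).

Definition phi_car (z : C) : C := RtoC 1 + z + z ^ 2 / RtoC 2.

(* the complex derivative f'(z) (chosen classically; 0 if it does not exist) *)
Definition Cderiv (f : C -> C) (z : C) : C :=
  match excluded_middle_informative (exists l : C, is_derive f z l) with
  | left H => proj1_sig (constructive_indefinite_description _ H)
  | right _ => RtoC 0
  end.

(* z f'(z) / f(z), with its removable value f'(0)/f'(0) = 1 at z = 0 (f in A) *)
Definition zfprime_over_f (f : C -> C) (z : C) : C :=
  match excluded_middle_informative (z = RtoC 0) with
  | left _ => RtoC 1
  | right _ => z * Cderiv f z / f z
  end.

Definition classScar (f : C -> C) : Prop :=
  classA f /\ subordinate (zfprime_over_f f) phi_car.

Definition f2 (a : nat -> C) (z : C) : C := z + a 2%nat * z ^ 2.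
Definition f2rho (a : nat -> C) (rho : R) (z : C) : C :=
  f2 a (RtoC rho * z) / RtoC rho.

(* Main.v *)
Require Import Defs.
From Stdlib Require Import Reals.
From Coquelicot Require Import Coquelicot.
From Stdlib Require Import Lra Lia Psatz Classical ClassicalEpsilon FunctionalExtensionality.
Open Scope C_scope.

(* With b = a_2 rho, the polynomial f_2(rho z)/rho is z + b z^2, for which z F'/F = (1 + 2u)/(1 + u),
   u = b z.  If |b| <= 1/3 then (1 + 3u)/(1 + u) lies in the disc with diameter (0, 3/2), so
   w = sqrt ((1 + 3u)/(1 + u)) - 1 is a Schwarz function with 1 + w + w^2/2 = (1 + 2u)/(1 + u).
   It remains to bound a_2.

   Convex f: |a_2| <= 1, by the Schwarz lemma for f^-1((f(z) + f(-z))/2) = a_2 z^2 + ...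

   Univalent f: |a_2| <= 2.  Instead of the area theorem, we use that -log|w - w'| is positive
   definite on measures of total mass zero (on the Riemann sphere it is -log(1 - n.n') up to
   functions of one variable, and n.n' is a positive definite kernel).  Testing this with the
   weight cos(t + alpha) on the image of the circle |z| = s under
   h(z) = sqrt(f(z^2)) = z + (a_2/2) z^3 + ... gives s^2 Re(e^{-2 i alpha} a_2/2) <= 1.

   Close-to-convex f are univalent, because f o g^-1 has a derivative of positive real part on
   the convex domain g(D). *)

(** The energy cannot be evaluated directly on the circle |z| = s, because log|w - w'| is infinite
    on the diagonal, so two modified energies are compared. In the first, both points stay on |z| =
    s and the kernel is regularised by tau^4; carried to the sphere it becomes ln (1 - lambda n.n')
    with lambda < 1, whose power series converges uniformly and gives the sign. In the second, one
    of the points is moved to |z| = s - tau^2; there h(z) - h(z') has no zero, and the energy with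
    cosine weight is computed exactly from Fourier coefficients. Univalence makes h bi-Lipschitz on
    |z| <= s, and the two energies then differ by O(tau).

    The function theory rests on one tool, the constancy in r of circle means of holomorphic
    functions with continuous derivative. Higher derivatives of f come from its power series;
    nonvanishing of f' for injective f follows from circle means and compactness.

    The radii 1/3 and 1/6 are 1/3 divided by the bounds 1 and 2 for |a_2|. *)

(** * Continuity and complex derivatives in epsilon-delta form *)

Definition Ccont (f : C -> C) (z : C) : Prop :=
  forall e : R, (0 < e)%R -> exists d : R, (0 < d)%R /\
    forall y, (Cmod (y - z) < d)%R -> (Cmod (f y - f z) < e)%R.

Lemma Ccont_continuous (f : C -> C) (z : C) :
  Ccont f z <->
  @continuous (AbsRing_UniformSpace C_AbsRing) (AbsRing_UniformSpace C_AbsRing) f z.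
Proof.
split.
- intros H P [e HP]. destruct (H e (cond_pos e)) as [d [Hd H']].
  exists (mkposreal d Hd). intros y Hy. apply HP. exact (H' y Hy).
- intros H e He.
  destruct (H (fun y => Cmod (y - f z) < e)%R) as [d Hd].
  { exists (mkposreal e He). intros y Hy. exact Hy. }
  exists d. split. apply cond_pos. intros y Hy. exact (Hd y Hy).
Qed.

Lemma is_derive_C_eps (f : C -> C) (z l : C) :
  is_derive f z l <->
  forall e : R, (0 < e)%R -> exists d : R, (0 < d)%R /\
    forall y, (Cmod (y - z) < d)%R ->
      (Cmod (f y - f z - l * (y - z)) <= e * Cmod (y - z))%R.
Proof.
split.
- intros [_ H] e He.
  destruct (H z (fun P h => h) (mkposreal e He)) as [d Hd].
  exists d. split. apply cond_pos.
  intros y Hy. specialize (Hd y Hy).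
  rewrite (Cmult_comm l). exact Hd.
- intros H. split.
  + apply (is_linear_scal_l (K:=C_AbsRing) (V:=C_NormedModule)).
  + intros x Hx.
    assert (E := is_filter_lim_locally_unique (V:=AbsRing_NormedModule C_AbsRing) z x Hx). subst x.
    intros e. destruct (H e (cond_pos e)) as [d [Hd H']].
    exists (mkposreal d Hd). intros y Hy. specialize (H' y Hy).
    rewrite (Cmult_comm l) in H'. exact H'.
Qed.

(** The two normed module structures on [C] impose the same limit condition. The product and chain
    rules of the library speak of [AbsRing_NormedModule], whereas the theorem uses the default
    structure. *)
Lemma is_derive_C_abs (f : C -> C) (z l : C) :
  is_derive f z l <->
  is_derive (V := AbsRing_NormedModule C_AbsRing) f z l.
Proof.
split; intros [_ H]; split; try exact H; apply is_linear_scal_l.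
Qed.

Lemma is_derive_Ccont (f : C -> C) (z l : C) : is_derive f z l -> Ccont f z.
Proof.
intros H. apply is_derive_C_abs in H. apply Ccont_continuous.
apply (ex_derive_continuous (K:=C_AbsRing) (V:=AbsRing_NormedModule C_AbsRing)). exists l. exact H.
Qed.

Lemma Ccont_const (c z : C) : Ccont (fun _ => c) z.
Proof.
intros e He. exists 1%R. split. lra. intros y _.
replace (c - c) with (RtoC 0) by ring. now rewrite Cmod_0.
Qed.

Lemma Ccont_id (z : C) : Ccont (fun x => x) z.
Proof. intros e He. now exists e. Qed.

Lemma Ccont_plus (f g : C -> C) (z : C) :
  Ccont f z -> Ccont g z -> Ccont (fun x => f x + g x) z.
Proof.
rewrite !Ccont_continuous.
exact (@continuous_plus (AbsRing_UniformSpace C_AbsRing) C_AbsRing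
  (AbsRing_NormedModule C_AbsRing) f g z).
Qed.

Lemma Ccont_mult (f g : C -> C) (z : C) :
  Ccont f z -> Ccont g z -> Ccont (fun x => f x * g x) z.
Proof.
rewrite !Ccont_continuous.
exact (@continuous_mult (AbsRing_UniformSpace C_AbsRing) C_AbsRing f g z).
Qed.

Lemma Ccont_comp (f g : C -> C) (z : C) :
  Ccont g z -> Ccont f (g z) -> Ccont (fun x => f (g x)) z.
Proof.
rewrite !Ccont_continuous. intros H1 H2.
exact (@continuous_comp (AbsRing_UniformSpace C_AbsRing) (AbsRing_UniformSpace C_AbsRing)
  (AbsRing_UniformSpace C_AbsRing) g f z H1 H2).
Qed.

Lemma is_derive_C_const (c z : C) : is_derive (fun _ : C => c) z (RtoC 0).
Proof. apply is_derive_C_abs. exact (@is_derive_const C_AbsRing (AbsRing_NormedModule C_AbsRing) c z). Qed.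

Lemma is_derive_C_id (z : C) : is_derive (fun x : C => x) z (RtoC 1).
Proof. apply is_derive_C_abs. exact (@is_derive_id C_AbsRing z). Qed.

Lemma is_derive_C_plus (f g : C -> C) (z a b : C) :
  is_derive f z a -> is_derive g z b -> is_derive (fun x => f x + g x) z (a + b).
Proof.
rewrite !is_derive_C_abs.
exact (@is_derive_plus C_AbsRing (AbsRing_NormedModule C_AbsRing) f g z a b).
Qed.

Lemma is_derive_C_mult (f g : C -> C) (z a b : C) :
  is_derive f z a -> is_derive g z b ->
  is_derive (fun x => f x * g x) z (a * g z + f z * b).
Proof.
rewrite !is_derive_C_abs. intros Ha Hb.
exact (@is_derive_mult C_AbsRing f g z a b Ha Hb Cmult_comm).
Qed.

Lemma is_derive_C_comp (f g : C -> C) (z a b : C) :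
  is_derive f (g z) a -> is_derive g z b ->
  is_derive (fun x => f (g x)) z (a * b).
Proof.
rewrite !is_derive_C_abs. intros Ha Hb. rewrite Cmult_comm.
exact (@is_derive_comp C_AbsRing (AbsRing_NormedModule C_AbsRing) f g z a b Ha Hb).
Qed.

Lemma Cmod_sub_sym (x y : C) : Cmod (x - y) = Cmod (y - x).
Proof. rewrite <- Cmod_opp. f_equal. ring. Qed.

Lemma Cmod_triangle_rev (x y : C) : (Cmod x - Cmod y <= Cmod (x - y))%R.
Proof.
assert (H := Cmod_triangle (x - y) y).
replace (x - y + y) with x in H by ring. lra.
Qed.

Lemma is_derive_C_inv (z : C) : z <> RtoC 0 ->
  is_derive (fun x : C => / x) z (- / (z * z)).
Proof.
intros Hz. apply is_derive_C_eps. intros e He.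
assert (Pz : (0 < Cmod z)%R) by now apply Cmod_gt_0.
set (m := Cmod z) in *.
(* The first bound keeps |y| above m/2; the second then makes the relative error |y - z| / (m^2 |y|)
   at most e. *)
exists (Rmin (m / 2) (e * (m * m * m) / 2))%R. split.
{ apply Rmin_pos. lra. apply Rdiv_lt_0_compat; try lra.
  repeat apply Rmult_lt_0_compat; lra. }
intros y Hy.
assert (H1 : (Cmod (y - z) < m / 2)%R) by (eapply Rlt_le_trans; [exact Hy | apply Rmin_l]).
assert (H2 : (Cmod (y - z) < e * (m * m * m) / 2)%R) by (eapply Rlt_le_trans; [exact Hy | apply Rmin_r]).
assert (H3 : (m / 2 < Cmod y)%R).
{ assert (T := Cmod_triangle_rev z y). rewrite Cmod_sub_sym in T. fold m in T. lra. }
assert (Hy0 : y <> RtoC 0) by (apply Cmod_gt_0; lra).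
replace (/ y - / z - - / (z * z) * (y - z)) with ((y - z) * ((y - z) / (z * z * y))) by (field; auto).
rewrite Cmod_mult, Cmod_div.
2:{ repeat apply Cmult_neq_0; auto. }
rewrite !Cmod_mult. fold m. rewrite Rmult_comm. apply Rmult_le_compat_r. apply Cmod_ge_0.
apply Rle_div_l. { apply Rmult_lt_0_compat; nra. }
assert (0 < m * m)%R by nra.
assert (m * m * (m / 2) < m * m * Cmod y)%R by (apply Rmult_lt_compat_l; auto).
nra.
Qed.

Lemma is_derive_C_ext (f g : C -> C) (z l : C) (d : R) : (0 < d)%R ->
  (forall y, (Cmod (y - z) < d)%R -> f y = g y) ->
  is_derive f z l -> is_derive g z l.
Proof.
rewrite !is_derive_C_eps. intros Hd E H e He.
destruct (H e He) as [d' [Hd' H']].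
exists (Rmin d d'). split. now apply Rmin_pos.
intros y Hy. rewrite <- !E. apply H'.
eapply Rlt_le_trans; [exact Hy | apply Rmin_r].
replace (z - z) with (RtoC 0) by ring. rewrite Cmod_0; auto.
eapply Rlt_le_trans; [exact Hy | apply Rmin_l].
Qed.

Lemma is_derive_C_eq (f : C -> C) (z l l' : C) :
  is_derive f z l -> l = l' -> is_derive f z l'.
Proof. now intros H <-. Qed.

Lemma is_derive_C_unique (f : C -> C) (z l l' : C) :
  is_derive f z l -> is_derive f z l' -> l = l'.
Proof.
intros H H'. rewrite <- (is_C_derive_unique _ _ _ H). now apply is_C_derive_unique.
Qed.

(** * Iterated complex differentiability *)

(** Continuity of the last derivative is built in, so that circle means can be differentiated under
    the integral sign without Goursat's theorem. *)
Fixpoint hol (n : nat) (U : C -> Prop) (f : C -> C) : Prop :=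
  match n with
  | O => forall z, U z -> Ccont f z
  | S m => exists f' : C -> C, (forall z, U z -> is_derive f z (f' z)) /\ hol m U f'
  end.

Lemma hol_pred n U f : hol (S n) U f -> hol n U f.
Proof.
revert f. induction n as [|n IH]; intros f [f' [H1 H2]].
- intros z Hz. eapply is_derive_Ccont. now apply H1.
- exists f'. split; auto.
Qed.

Lemma hol_cont n U f : hol n U f -> forall z, U z -> Ccont f z.
Proof.
revert f. induction n as [|n IH]; intros f H; auto.
apply IH. now apply hol_pred.
Qed.

Lemma hol_const n U c : hol n U (fun _ => c).
Proof.
revert c; induction n as [|n IH]; intros c.
- intros z _. apply Ccont_const.
- exists (fun _ => RtoC 0). split; auto. intros z _. apply is_derive_C_const.
Qed.

Lemma hol_id n U : hol n U (fun x => x).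
Proof.
destruct n as [|n].
- intros z _. apply Ccont_id.
- exists (fun _ => RtoC 1). split. intros z _. apply is_derive_C_id. apply hol_const.
Qed.

Lemma hol_plus n U f g : hol n U f -> hol n U g -> hol n U (fun x => f x + g x).
Proof.
revert f g; induction n as [|n IH]; intros f g.
- intros H1 H2 z Hz. apply Ccont_plus; auto.
- intros [f' [H1 H2]] [g' [H3 H4]]. exists (fun x => f' x + g' x). split; auto.
  intros z Hz. apply is_derive_C_plus; auto.
Qed.

Lemma hol_mult n U f g : hol n U f -> hol n U g -> hol n U (fun x => f x * g x).
Proof.
revert f g; induction n as [|n IH]; intros f g.
- intros H1 H2 z Hz. apply Ccont_mult; auto.
- intros Hf Hg. assert (Hf' := hol_pred _ _ _ Hf). assert (Hg' := hol_pred _ _ _ Hg).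
  destruct Hf as [f' [H1 H2]], Hg as [g' [H3 H4]].
  exists (fun x => f' x * g x + f x * g' x). split.
  + intros z Hz. apply is_derive_C_mult; auto.
  + apply hol_plus; auto.
Qed.

Lemma hol_comp n (U V : C -> Prop) f g : (forall z, U z -> V (g z)) ->
  hol n V f -> hol n U g -> hol n U (fun x => f (g x)).
Proof.
intros HUV. revert f g HUV; induction n as [|n IH]; intros f g HUV.
- intros H1 H2 z Hz. apply Ccont_comp; auto.
- intros Hf Hg. assert (Hg' := hol_pred _ _ _ Hg).
  destruct Hf as [f' [H1 H2]], Hg as [g' [H3 H4]].
  exists (fun x => f' (g x) * g' x). split.
  + intros z Hz. apply is_derive_C_comp; auto.
  + apply hol_mult; auto.
Qed.

Lemma hol_inv_id n : hol n (fun z => z <> RtoC 0) Cinv.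
Proof.
induction n as [|n IH].
- intros z Hz. eapply is_derive_Ccont. now apply is_derive_C_inv.
- exists (fun z => (- (1)) * (/ z * / z)). split.
  + intros z Hz. eapply is_derive_C_eq. now apply is_derive_C_inv. now field.
  + apply hol_mult. apply hol_const. now apply hol_mult.
Qed.

Lemma hol_inv n U f : (forall z, U z -> f z <> RtoC 0) ->
  hol n U f -> hol n U (fun x => / f x).
Proof.
intros H0 H. apply (hol_comp n U (fun z => z <> RtoC 0) Cinv f); auto. apply hol_inv_id.
Qed.

Lemma hol_div n U f g : (forall z, U z -> g z <> RtoC 0) ->
  hol n U f -> hol n U g -> hol n U (fun x => f x / g x).
Proof. intros H0 H1 H2. apply hol_mult; auto. now apply hol_inv. Qed.

Lemma hol_opp n U f : hol n U f -> hol n U (fun x => - f x).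
Proof.
revert f; induction n as [|n IH]; intros f.
- intros H z Hz. intros e He. destruct (H z Hz e He) as [d [Hd H']].
  exists d; split; auto. intros y Hy.
  replace (- f y - - f z) with (- (f y - f z)) by ring. rewrite Cmod_opp. auto.
- intros [f' [H1 H2]]. exists (fun x => - f' x). split; auto.
  intros z Hz. apply is_derive_C_eps. intros e He.
  destruct (proj1 (is_derive_C_eps _ _ _) (H1 z Hz) e He) as [d [Hd H']].
  exists d; split; auto. intros y Hy.
  replace (- f y - - f z - - f' z * (y - z)) with (- (f y - f z - f' z * (y - z))) by ring.
  rewrite Cmod_opp. auto.
Qed.

Lemma hol_minus n U f g : hol n U f -> hol n U g -> hol n U (fun x => f x - g x).
Proof. intros H1 H2. apply hol_plus; auto. now apply hol_opp. Qed.

Lemma hol_sub n (U V : C -> Prop) f : (forall z, V z -> U z) -> hol n U f -> hol n V f.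
Proof.
intros HUV. revert f; induction n as [|n IH]; intros f; simpl; auto.
intros [f' [H1 H2]]. exists f'; auto.
Qed.

(** * The principal complex square root *)

(** Half-angle formula for the principal branch: [p] is the real part of the root, and the imaginary
    part q is found from 2 p q = Im v. *)
Definition csqrt (v : C) : C :=
  let p := sqrt ((Cmod v + Re v) / 2) in (p, (Im v / (2 * p))%R).

Lemma Re_opp_le_Cmod (z : C) : (- Re z <= Cmod z)%R.
Proof. assert (H := re_le_Cmod z). destruct (Rabs_def2 (Re z) (Cmod z + 1)) ; [lra|].
revert H. unfold Rabs. destruct Rcase_abs; lra. Qed.

Lemma csqrt_spec (v : C) : (0 < Re v)%R ->
  (0 < Re (csqrt v))%R /\ csqrt v * csqrt v = v.
Proof.
intros Hv. unfold csqrt.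
assert (Hr : (Re v <= Cmod v)%R) by (eapply Rle_trans; [apply Rle_abs | apply re_le_Cmod]).
assert (H2 := Cmod2_alt v).
set (r := Cmod v) in *. set (p := sqrt ((r + Re v) / 2)).
assert (Hp : (0 < p)%R) by (apply sqrt_lt_R0; lra).
assert (Hpp : (p * p = (r + Re v) / 2)%R) by (apply sqrt_sqrt; lra).
split. exact Hp.
destruct v as [x y]; simpl in *. unfold Cmult; simpl. f_equal.
- assert (E : ((y / (2 * p)) * (y / (2 * p)) = y * y / (4 * (p * p)))%R) by (field; lra).
  rewrite E, Hpp. apply Rminus_diag_uniq.
  replace ((r + x) / 2 - y * y / (4 * ((r + x) / 2)) - x)%R
    with ((r * r - x * x - y * y) / (2 * (r + x)))%R by (field; lra).
  replace (r * r - x * x - y * y)%R with 0%R by lra. unfold Rdiv; ring.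
- field; lra.
Qed.

Lemma Re_minus (x y : C) : Re (x - y) = (Re x - Re y)%R.
Proof. reflexivity. Qed.

Lemma Re_near (x y : C) : (Re x - Cmod (y - x) <= Re y)%R.
Proof. assert (H := Re_opp_le_Cmod (y - x)). rewrite Re_minus in H. lra. Qed.

Lemma Re_le_Cmod (z : C) : (Re z <= Cmod z)%R.
Proof. eapply Rle_trans; [apply Rle_abs | apply re_le_Cmod]. Qed.

Lemma is_derive_csqrt (v : C) : (0 < Re v)%R ->
  is_derive csqrt v (/ (RtoC 2 * csqrt v)).
Proof.
intros Hv. apply is_derive_C_eps. intros e He.
destruct (csqrt_spec v Hv) as [Hs Es]. set (s := csqrt v) in *.
set (m := Re s) in *.
(* The remainder has modulus |y - v|^2 / (2 |s| |t + s|^2), and both |s| and |t + s| are at least m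
   = Re s. Staying within Re v of v keeps y in the right half plane. *)
exists (Rmin (Re v) (2 * e * (m * m * m)))%R. split.
{ apply Rmin_pos; auto. repeat apply Rmult_lt_0_compat; lra. }
intros y Hy.
assert (H1 : (Cmod (y - v) < Re v)%R) by (eapply Rlt_le_trans; [exact Hy | apply Rmin_l]).
assert (H2 : (Cmod (y - v) < 2 * e * (m * m * m))%R) by (eapply Rlt_le_trans; [exact Hy | apply Rmin_r]).
assert (Hy0 : (0 < Re y)%R) by (assert (T := Re_near v y); lra).
destruct (csqrt_spec y Hy0) as [Ht Et]. set (t := csqrt y) in *.
assert (Hms : (m <= Cmod s)%R) by apply Re_le_Cmod.
assert (Hmt : (m <= Cmod (t + s))%R).
{ eapply Rle_trans; [|apply Re_le_Cmod]. change (m <= Re t + m)%R. lra. }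
assert (Hs0 : s <> RtoC 0) by (apply Cmod_gt_0; lra).
assert (Hts0 : t + s <> RtoC 0) by (apply Cmod_gt_0; lra).
assert (E1 : t - s = (y - v) / (t + s)) by (rewrite <- Et, <- Es; now field).
assert (E2 : t - s - / (RtoC 2 * s) * (y - v) = (y - v) * (- (y - v) / (RtoC 2 * s * (t + s) * (t + s)))).
{ rewrite E1.
  transitivity ((y - v) * (s - t) / (RtoC 2 * s * (t + s))).
  - field. split; auto.
  - replace (s - t) with (- (t - s)) by ring. rewrite E1. field. split; auto. }
rewrite E2, Cmod_mult, Rmult_comm. apply Rmult_le_compat_r. apply Cmod_ge_0.
assert (H20 : RtoC 2 <> RtoC 0) by (intros E; apply RtoC_inj in E; lra).
rewrite Cmod_div by (repeat apply Cmult_neq_0; auto).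
rewrite Cmod_opp, !Cmod_mult, Cmod_R, Rabs_pos_eq by lra.
apply Rle_div_l. { repeat apply Rmult_lt_0_compat; lra. }
assert (m * m <= Cmod s * Cmod (t + s))%R by (apply Rmult_le_compat; lra).
assert (m * m * m <= Cmod s * Cmod (t + s) * Cmod (t + s))%R by (apply Rmult_le_compat; nra).
nra.
Qed.

Lemma hol_csqrt n : hol n (fun v => 0 < Re v)%R csqrt.
Proof.
induction n as [|n IH].
- intros z Hz. eapply is_derive_Ccont. now apply is_derive_csqrt.
- eexists. split. intros z Hz. now apply is_derive_csqrt.
  apply hol_inv.
  + intros z Hz. destruct (csqrt_spec z Hz) as [H _]. apply Cmult_neq_0; intros E.
    apply RtoC_inj in E; lra. rewrite E in H. simpl in H; lra.
  + apply hol_mult; auto. apply hol_const.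
Qed.

Lemma csqrt_1 : csqrt (RtoC 1) = RtoC 1.
Proof.
unfold csqrt. rewrite Cmod_1. simpl.
replace ((1 + 1) / 2)%R with 1%R by lra. rewrite sqrt_1. unfold RtoC. f_equal. lra.
Qed.

(** * Real curves and integrals over a period *)

Lemma is_derive_R_eps (f : R -> R) (x l : R) :
  is_derive f x l <->
  forall e : R, (0 < e)%R -> exists d : R, (0 < d)%R /\
    forall y, (Rabs (y - x) < d)%R ->
      (Rabs (f y - f x - l * (y - x)) <= e * Rabs (y - x))%R.
Proof.
split.
- intros [_ H] e He.
  destruct (H x (fun P h => h) (mkposreal e He)) as [d Hd].
  exists d. split. apply cond_pos.
  intros y Hy. specialize (Hd y Hy).
  rewrite (Rmult_comm l). exact Hd.
- intros H. split.
  + apply (is_linear_scal_l (K:=R_AbsRing) (V:=R_NormedModule)).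
  + intros y Hy.
    assert (E := is_filter_lim_locally_unique (V:=R_NormedModule) x y Hy). subst y.
    intros e. destruct (H e (cond_pos e)) as [d [Hd H']].
    exists (mkposreal d Hd). intros y Hy'. specialize (H' y Hy').
    rewrite (Rmult_comm l) in H'. exact H'.
Qed.

(** Stated with [Cmod], so that it composes directly with the form of the complex derivative in
    [is_derive_C_eps]. *)
Definition curve_derive (g : R -> C) (t : R) (l : C) : Prop :=
  forall e : R, (0 < e)%R -> exists d : R, (0 < d)%R /\
    forall y, (Rabs (y - t) < d)%R ->
      (Cmod (g y - g t - l * RtoC (y - t)) <= e * Rabs (y - t))%R.

Lemma curve_derive_Re g t l :
  curve_derive g t l -> is_derive (fun u => Re (g u)) t (Re l).
Proof.
intros H. apply is_derive_R_eps. intros e He.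
destruct (H e He) as [d [Hd H']]. exists d; split; auto.
intros y Hy. eapply Rle_trans; [|exact (H' y Hy)].
eapply Rle_trans; [|apply re_le_Cmod]. right. f_equal.
destruct (g y), (g t), l; simpl; ring.
Qed.

Lemma Cmod_le_abs (z : C) : (Cmod z <= Rabs (Re z) + Rabs (Im z))%R.
Proof.
replace z with (RtoC (Re z) + Ci * RtoC (Im z)) at 1
  by (destruct z; unfold Ci, RtoC, Cplus, Cmult; simpl; f_equal; ring).
eapply Rle_trans; [apply Cmod_triangle|].
rewrite Cmod_mult, Cmod_Ci, !Cmod_R. lra.
Qed.

Lemma curve_derive_pair (x y : R -> R) t a b :
  is_derive x t a -> is_derive y t b ->
  curve_derive (fun u => (x u, y u)) t (a, b).
Proof.
rewrite !is_derive_R_eps. intros H1 H2 e He.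
destruct (H1 (e/2)%R) as [d1 [Hd1 H1']]; [lra|].
destruct (H2 (e/2)%R) as [d2 [Hd2 H2']]; [lra|].
exists (Rmin d1 d2); split. now apply Rmin_pos.
intros u Hu. eapply Rle_trans; [apply Cmod_le_abs|].
specialize (H1' u (Rlt_le_trans _ _ _ Hu (Rmin_l _ _))).
specialize (H2' u (Rlt_le_trans _ _ _ Hu (Rmin_r _ _))).
simpl.
replace (x u + - x t + - (a * (u - t) - b * 0))%R with (x u - x t - a * (u - t))%R by ring.
replace (y u + - y t + - (a * 0 + b * (u - t)))%R with (y u - y t - b * (u - t))%R by ring.
lra.
Qed.

Lemma curve_derive_comp (f : C -> C) (g : R -> C) t l m :
  is_derive f (g t) l -> curve_derive g t m ->
  curve_derive (fun u => f (g u)) t (l * m).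
Proof.
intros Hf Hg e He.
set (K := (Cmod m + 1)%R). assert (HK : (0 < K)%R) by (assert (T := Cmod_ge_0 m); unfold K; lra).
set (L := (Cmod l + 1)%R). assert (HL : (0 < L)%R) by (assert (T := Cmod_ge_0 l); unfold L; lra).
destruct (proj1 (is_derive_C_eps _ _ _) Hf (e / 2 / K)%R) as [d1 [Hd1 H1]].
{ repeat apply Rdiv_lt_0_compat; lra. }
(* The bound 1 gives |g y - g t| <= K |y - t|; the other one controls the error that gets multiplied
   by l. *)
destruct (Hg (Rmin 1 (e / 2 / L))) as [d2 [Hd2 H2]].
{ apply Rmin_pos. lra. repeat apply Rdiv_lt_0_compat; lra. }
exists (Rmin d2 (d1 / K)). split.
{ apply Rmin_pos; auto. now apply Rdiv_lt_0_compat. }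
intros y Hy.
assert (Hy1 := Rlt_le_trans _ _ _ Hy (Rmin_l _ _)).
assert (Hy2 := Rlt_le_trans _ _ _ Hy (Rmin_r _ _)).
specialize (H2 y Hy1).
assert (Pa := Rabs_pos (y - t)).
assert (H3 : (Cmod (g y - g t) <= K * Rabs (y - t))%R).
{ replace (g y - g t) with ((g y - g t - m * RtoC (y - t)) + m * RtoC (y - t)) by ring.
  eapply Rle_trans; [apply Cmod_triangle|]. rewrite (Cmod_mult m), Cmod_R.
  assert (T := Rmin_l 1 (e / 2 / L)). unfold K. nra. }
assert (H4 : (Cmod (g y - g t) < d1)%R).
{ eapply Rle_lt_trans; [exact H3|]. apply Rlt_div_r in Hy2; lra. }
specialize (H1 _ H4).
replace (f (g y) - f (g t) - l * m * RtoC (y - t)) with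
  ((f (g y) - f (g t) - l * (g y - g t)) + l * (g y - g t - m * RtoC (y - t))) by ring.
eapply Rle_trans; [apply Cmod_triangle|]. rewrite (Cmod_mult l).
assert (H5 : (e / 2 / K * Cmod (g y - g t) <= e / 2 * Rabs (y - t))%R).
{ apply Rle_trans with (e / 2 / K * (K * Rabs (y - t)))%R.
  apply Rmult_le_compat_l; auto. left; repeat apply Rdiv_lt_0_compat; lra.
  right; field; lra. }
assert (H6 : (Cmod l * Cmod (g y - g t - m * RtoC (y - t)) <= e / 2 * Rabs (y - t))%R).
{ apply Rle_trans with (L * (e / 2 / L * Rabs (y - t)))%R.
  2: right; field; lra.
  apply Rmult_le_compat; try apply Cmod_ge_0. unfold L; lra.
  eapply Rle_trans; [exact H2|]. apply Rmult_le_compat_r; auto. apply Rmin_r. }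
lra.
Qed.

Definition circ (r t : R) : C := (r * cos t, r * sin t)%R.

Lemma Cmod_circ r t : (0 <= r)%R -> Cmod (circ r t) = r.
Proof.
intros Hr. unfold Cmod, circ; simpl.
replace (r * cos t * (r * cos t * 1) + r * sin t * (r * sin t * 1))%R
  with (r * r * ((sin t)² + (cos t)²))%R by (unfold Rsqr; ring).
rewrite sin2_cos2, Rmult_1_r. now apply sqrt_square.
Qed.

Lemma circ_period r : circ r (2 * PI) = circ r 0.
Proof. unfold circ. now rewrite sin_2PI, cos_2PI, sin_0, cos_0. Qed.

Lemma circ_derive_angle r t : curve_derive (circ r) t (Ci * circ r t).
Proof.
replace (Ci * circ r t) with ((- (r * sin t))%R, (r * cos t)%R)
  by (unfold Ci, circ, Cmult; simpl; f_equal; ring).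
apply (curve_derive_pair (fun u => r * cos u)%R (fun u => r * sin u)%R);
  auto_derive; auto; ring.
Qed.

Lemma circ_derive_radius r t :
  curve_derive (fun u => circ u t) r (cos t, sin t).
Proof.
apply (curve_derive_pair (fun u => u * cos t)%R (fun u => u * sin t)%R);
  auto_derive; auto; ring.
Qed.

Lemma circ_1 r t : circ r t = RtoC r * (cos t, sin t).
Proof. unfold circ, RtoC, Cmult; simpl; f_equal; ring. Qed.

Definition period_int (F : R -> R) : R := RInt F 0 (2 * PI).

Lemma continuity_ex_RInt (F : R -> R) a b : continuity F -> ex_RInt F a b.
Proof.
intros H. apply (ex_RInt_continuous (V:=R_CompleteNormedModule)).
intros z _. apply continuity_pt_filterlim. apply H.
Qed.

Lemma TwoPI_pos : (0 < 2 * PI)%R.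
Proof. assert (T := PI_RGT_0); lra. Qed.

Lemma period_int_ext F G : (forall t, F t = G t) -> period_int F = period_int G.
Proof. intros H. apply RInt_ext. auto. Qed.

Lemma period_int_plus F G : continuity F -> continuity G ->
  period_int (fun t => F t + G t)%R = (period_int F + period_int G)%R.
Proof.
intros H1 H2. apply (RInt_plus (V:=R_CompleteNormedModule)); now apply continuity_ex_RInt.
Qed.

Lemma period_int_scal c F : continuity F -> period_int (fun t => c * F t)%R = (c * period_int F)%R.
Proof.
intros H1. apply (RInt_scal (V:=R_CompleteNormedModule)); now apply continuity_ex_RInt.
Qed.

Lemma continuity_cst (c : R) : continuity (fun _ => c).
Proof. apply continuity_const. intros x y; reflexivity. Qed.

Lemma period_int_minus F G : continuity F -> continuity G ->
  period_int (fun t => F t - G t)%R = (period_int F - period_int G)%R.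
Proof.
intros H1 H2. apply (RInt_minus (V:=R_CompleteNormedModule)); now apply continuity_ex_RInt.
Qed.

Lemma period_int_const c : period_int (fun _ => c) = (2 * PI * c)%R.
Proof. unfold period_int. rewrite RInt_const. unfold scal; simpl; unfold mult; simpl. ring. Qed.

Lemma period_int_le F G : continuity F -> continuity G -> (forall t, (F t <= G t)%R) ->
  (period_int F <= period_int G)%R.
Proof.
intros H1 H2 H. apply RInt_le; auto using continuity_ex_RInt.
assert (T := TwoPI_pos); lra.
Qed.

Lemma period_int_abs F M : continuity F -> (forall t, (Rabs (F t) <= M)%R) ->
  (Rabs (period_int F) <= 2 * PI * M)%R.
Proof.
intros H1 H. replace (2 * PI * M)%R with ((2 * PI - 0) * M)%R by ring.
apply abs_RInt_le_const; auto using continuity_ex_RInt.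
assert (T := TwoPI_pos); lra.
Qed.

Lemma period_int_abs_le F : continuity F -> (Rabs (period_int F) <= period_int (fun t => Rabs (F t)))%R.
Proof.
intros H. apply abs_RInt_le; auto using continuity_ex_RInt.
assert (T := TwoPI_pos); lra.
Qed.

Lemma period_int_derive (F f : R -> R) : (forall t, is_derive F t (f t)) -> continuity f ->
  F (2 * PI)%R = F 0%R -> period_int f = 0%R.
Proof.
intros H1 H2 H3.
assert (H : is_RInt f 0 (2 * PI) (minus (F (2 * PI)%R) (F 0%R))).
{ apply (is_RInt_derive (V:=R_CompleteNormedModule)); intros x _; auto.
  apply continuity_pt_filterlim. apply H2. }
rewrite H3, minus_eq_zero in H. exact (is_RInt_unique _ _ _ _ H).
Qed.

(** Uniform continuity on the compact rectangle [x - 1, x + 1] x [0, 2 PI] makes the integrand move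
    by less than e / (4 PI) at all angles simultaneously. *)
Lemma period_int_param_continuity (F : R -> R -> R) :
  (forall x y, continuity_2d_pt F x y) -> continuity (fun x => period_int (F x)).
Proof.
intros H x.
assert (Hc : forall u, continuity (F u)).
{ intros u y e He. destruct (H u y (mkposreal e He)) as [d Hd].
  exists d. split. apply cond_pos. intros v [_ Hv]. apply Hd; auto.
  replace (u - u)%R with 0%R by ring. rewrite Rabs_R0. apply cond_pos. }
intros e He. assert (T := TwoPI_pos).
assert (He' : (0 < e / (4 * PI))%R) by (apply Rdiv_lt_0_compat; lra).
destruct (uniform_continuity_2d F (x - 1) (x + 1) 0 (2 * PI) (fun a b _ _ => H a b)
  (mkposreal _ He')) as [d Hd].
exists (Rmin 1 d). split. apply Rmin_pos. lra. apply cond_pos.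
intros u [_ Hu]. simpl in Hu. unfold R_dist in *. simpl. unfold Rdist in *.
assert (Hu1 := Rlt_le_trans _ _ _ Hu (Rmin_l _ _)).
assert (Hu2 := Rlt_le_trans _ _ _ Hu (Rmin_r _ _)).
rewrite <- period_int_minus by auto.
apply Rle_lt_trans with ((2 * PI - 0) * (e / (4 * PI)))%R.
apply abs_RInt_le_const. lra. apply continuity_ex_RInt.
apply continuity_minus; auto.
intros t Ht. left. apply Hd; try lra. apply Rabs_def2 in Hu1. lra.
replace (t - t)%R with 0%R by ring. rewrite Rabs_R0. apply cond_pos.
replace ((2 * PI - 0) * (e / (4 * PI)))%R with (e / 2)%R by (field; lra). lra.
Qed.

Lemma Ccont_continuity_2d_Re (G : C -> C) (r t : R) :
  Ccont G (circ r t) -> continuity_2d_pt (fun u v => Re (G (circ u v))) r t.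
Proof.
intros H e. destruct (H e (cond_pos e)) as [d [Hd H']].
assert (C1 : continuity_2d_pt (fun u v => u * cos v)%R r t).
{ apply continuity_2d_pt_mult. apply continuity_2d_pt_id1.
  apply (continuity_1d_2d_pt_comp cos). apply continuity_cos. apply continuity_2d_pt_id2. }
assert (C2 : continuity_2d_pt (fun u v => u * sin v)%R r t).
{ apply continuity_2d_pt_mult. apply continuity_2d_pt_id1.
  apply (continuity_1d_2d_pt_comp sin). apply continuity_sin. apply continuity_2d_pt_id2. }
assert (Hd2 : (0 < d / 2)%R) by lra.
destruct (C1 (mkposreal _ Hd2)) as [d1 H1], (C2 (mkposreal _ Hd2)) as [d2 H2].
simpl in H1, H2.
assert (Hm : (0 < Rmin d1 d2)%R) by (apply Rmin_pos; apply cond_pos).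
exists (mkposreal _ Hm). simpl. intros u v Hu Hv.
eapply Rle_lt_trans; [|apply (H' (circ u v))].
{ rewrite <- Re_minus. apply re_le_Cmod. }
eapply Rle_lt_trans; [apply Cmod_le_abs|].
specialize (H1 u v (Rlt_le_trans _ _ _ Hu (Rmin_l _ _)) (Rlt_le_trans _ _ _ Hv (Rmin_l _ _))).
specialize (H2 u v (Rlt_le_trans _ _ _ Hu (Rmin_r _ _)) (Rlt_le_trans _ _ _ Hv (Rmin_r _ _))).
unfold circ; simpl. fold (Rminus (u * cos v) (r * cos t)). fold (Rminus (u * sin v) (r * sin t)). lra.
Qed.

Lemma Ccont_circ_Re (G : C -> C) r : (forall t, Ccont G (circ r t)) ->
  continuity (fun t => Re (G (circ r t))).
Proof.
intros H t e He.
destruct (Ccont_continuity_2d_Re G r t (H t) (mkposreal e He)) as [d Hd].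
exists d. split. apply cond_pos. intros v [_ Hv]. apply Hd; auto.
replace (r - r)%R with 0%R by ring. rewrite Rabs_R0. apply cond_pos.
Qed.

(** * Circle means of holomorphic functions *)

Definition annulus (a b : R) (z : C) : Prop := (a < Cmod z < b)%R.

Lemma Im_Re (z : C) : Im z = Re (- Ci * z).
Proof. destruct z; unfold Ci; simpl; ring. Qed.

Definition circle_int (g : C -> C) (r : R) : R := period_int (fun t => Re (g (circ r t))).

(* Differentiating in r and in t produces the same integrand up to the factor i r. *)
Lemma circle_int_derive (g : C -> C) a b r : (0 <= a)%R ->
  hol 1 (annulus a b) g -> (a < r < b)%R -> is_derive (circle_int g) r 0%R.
Proof.
intros Ha [g' [Hg Hg']] Hr. simpl in Hg'.
assert (Hin : forall u t, (a < u < b)%R -> annulus a b (circ u t)).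
{ intros u t Hu. unfold annulus. rewrite Cmod_circ; lra. }
assert (Hloc : forall x, (a < x < b)%R -> exists d : posreal, forall u, (Rabs (u - x) < d)%R -> (a < u < b)%R).
{ intros x Hx. assert (Hd : (0 < Rmin (x - a) (b - x))%R) by (apply Rmin_pos; lra).
  exists (mkposreal _ Hd). simpl. intros u Hu.
  assert (T1 := Rlt_le_trans _ _ _ Hu (Rmin_l _ _)).
  assert (T2 := Rlt_le_trans _ _ _ Hu (Rmin_r _ _)).
  apply Rabs_def2 in T1. apply Rabs_def2 in T2. lra. }
assert (Hdr : forall u t, (a < u < b)%R ->
  is_derive (fun x => Re (g (circ x t))) u (Re (g' (circ u t) * (cos t, sin t)))).
{ intros u t Hu. apply curve_derive_Re. apply (curve_derive_comp g (fun u => circ u t)).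
  apply Hg, Hin, Hu. apply circ_derive_radius. }
assert (HD : forall u t, (a < u < b)%R ->
  Derive (fun x => Re (g (circ x t))) u = (/ u * Re (circ u t * g' (circ u t)))%R).
{ intros u t Hu. etransitivity; [exact (is_derive_unique _ _ _ (Hdr u t Hu))|]. rewrite (circ_1 u t) at 2.
  destruct (g' (circ u t)). simpl. field. lra. }
assert (Hgc : forall u, (a < u < b)%R -> continuity (fun t => Re (g (circ u t)))).
{ intros u Hu. apply Ccont_circ_Re. intros t. eapply is_derive_Ccont. now apply Hg, Hin. }
assert (Hh : forall z, annulus a b z -> Ccont (fun z => z * g' z) z).
{ intros z Hz. apply Ccont_mult. apply Ccont_id. auto. }
destruct (Hloc r Hr) as [d Hd].
replace 0%R with (RInt (fun t : R => Derive (fun u : R => Re (g (circ u t))) r) 0 (2 * PI)).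
- apply is_derive_RInt_param.
  + exists d. intros x Hx t _. eexists. apply Hdr. now apply Hd.
  + intros t _. eapply continuity_2d_pt_ext_loc.
    { exists d. intros u v Hu _. symmetry. now apply HD, Hd. }
    apply continuity_2d_pt_mult.
    * apply continuity_2d_pt_inv. apply continuity_2d_pt_id1. lra.
    * apply (Ccont_continuity_2d_Re (fun z => z * g' z)). apply Hh. auto.
  + exists d. intros x Hx. apply continuity_ex_RInt. now apply Hgc, Hd.
- rewrite (RInt_ext _ (fun t => / r * Re (circ r t * g' (circ r t)))%R).
  2:{ intros; auto. }
  assert (Hc : continuity (fun t => Re (circ r t * g' (circ r t)))).
  { apply (Ccont_circ_Re (fun z => z * g' z)). auto. }
  change (period_int (fun t => / r * Re (circ r t * g' (circ r t)))%R = 0%R).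
  rewrite period_int_scal by auto.
  rewrite (period_int_derive (fun t => Re (- Ci * g (circ r t)))). ring.
  + intros t. replace (Re (circ r t * g' (circ r t))) with
      (Re (- Ci * g' (circ r t) * (Ci * circ r t))).
    apply curve_derive_Re. apply (curve_derive_comp (fun z => - Ci * g z) (circ r)).
    { eapply is_derive_C_eq. apply is_derive_C_mult. apply is_derive_C_const.
      now apply Hg, Hin. cbv beta; ring. }
    apply circ_derive_angle.
    destruct (circ r t), (g' _); unfold Ci; simpl; ring.
  + exact Hc.
  + now rewrite circ_period.
Qed.

Lemma circle_int_const (g : C -> C) a b r s : (0 <= a)%R ->
  hol 1 (annulus a b) g -> (a < r < b)%R -> (a < s < b)%R ->
  circle_int g r = circle_int g s.
Proof.
intros Ha Hg. assert (W : forall r s, (a < r < b)%R -> (a < s < b)%R -> (r < s)%R ->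
  circle_int g r = circle_int g s).
{ intros x y Hx Hy Hxy. apply eq_is_derive; auto. intros t Ht.
  apply (circle_int_derive g a b); auto. lra. }
intros Hr Hs. destruct (Rtotal_order r s) as [H|[H|H]]; auto.
now rewrite H. symmetry. auto.
Qed.

(** The integral is independent of the radius, so it may be taken over a circle close to the
    puncture, where g is close to [g0]. This takes the place of a removable singularity theorem. *)
Lemma circle_int_removable (g : C -> C) (g0 : C) b r :
  hol 1 (annulus 0 b) g -> (0 < r < b)%R ->
  (forall e, (0 < e)%R -> exists d, (0 < d)%R /\
     forall z, (0 < Cmod z < d)%R -> (Cmod (g z - g0) < e)%R) ->
  circle_int g r = (2 * PI * Re g0)%R.
Proof.
intros Hg Hr Hlim.
assert (T := TwoPI_pos).
apply cond_eq. intros e He.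
destruct (Hlim (e / (4 * PI))%R) as [d [Hd H]]. { apply Rdiv_lt_0_compat; lra. }
set (s := (Rmin d b / 2)%R).
assert (Hm : (0 < Rmin d b)%R) by (apply Rmin_pos; lra).
assert (T1 := Rmin_l d b). assert (T2 := Rmin_r d b).
rewrite (circle_int_const g 0 b r s) by (auto; unfold s; lra).
rewrite <- period_int_const. unfold circle_int.
assert (Hc : continuity (fun t => Re (g (circ s t)))).
{ apply Ccont_circ_Re. intros t. apply (hol_cont _ _ _ Hg).
  unfold annulus. rewrite Cmod_circ; unfold s; lra. }
rewrite <- period_int_minus; auto using continuity_cst.
apply Rle_lt_trans with (2 * PI * (e / (4 * PI)))%R.
apply period_int_abs. apply continuity_minus; auto using continuity_cst.
intros t. left. rewrite <- Re_minus. eapply Rle_lt_trans; [apply re_le_Cmod|].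
apply H. rewrite Cmod_circ; unfold s; lra.
replace (2 * PI * (e / (4 * PI)))%R with (e / 2)%R by (field; lra). lra.
Qed.

Lemma circle_int_mean (g : C -> C) b r :
  hol 1 (fun z => Cmod z < b)%R g -> (0 < r < b)%R ->
  circle_int g r = (2 * PI * Re (g (RtoC 0)))%R.
Proof.
intros Hg Hr. apply circle_int_removable with b; auto.
- eapply hol_sub; [|exact Hg]. intros z Hz; apply Hz.
- intros e He. destruct (hol_cont _ _ _ Hg (RtoC 0)) with e as [d [Hd H]]; auto.
  rewrite Cmod_0. lra.
  exists d; split; auto. intros z Hz. apply H. replace (z - RtoC 0) with z by ring. lra.
Qed.

(** * Compactness and injective holomorphic functions *)

Lemma Cmod_near (x y : C) : (Cmod x <= Cmod y + Cmod (x - y))%R.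
Proof. assert (T := Cmod_triangle_rev x y). lra. Qed.

(** A property that holds locally with some tolerance d, and survives shrinking d, holds with one d
    on the whole closed bidisc. Pairs of complex numbers are treated as points of R^4, so that
    compactness of boxes applies. *)
Lemma closed_disc_compact (s : R) (P : R -> C -> C -> Prop) :
  (forall d d' z w, (0 < d' <= d)%R -> P d z w -> P d' z w) ->
  (forall z w, (Cmod z <= s)%R -> (Cmod w <= s)%R -> exists d, (0 < d)%R /\
     forall z' w', (Cmod z' <= s)%R -> (Cmod w' <= s)%R ->
       (Cmod (z' - z) < d)%R -> (Cmod (w' - w) < d)%R -> P d z' w') ->
  exists d, (0 < d)%R /\
    forall z w, (Cmod z <= s)%R -> (Cmod w <= s)%R -> P d z w.
Proof.
intros Hmono Hloc.
(* The gauge must be defined on the whole space; near a pair outside the bidisc the condition is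
   vacuous. *)
assert (Hall : forall z w, exists d : R, (0 < d)%R /\
     forall z' w', (Cmod z' <= s)%R -> (Cmod w' <= s)%R ->
       (Cmod (z' - z) < d)%R -> (Cmod (w' - w) < d)%R -> P d z' w').
{ intros z w. destruct (Rle_lt_dec (Cmod z) s) as [Hz|Hz].
  - destruct (Rle_lt_dec (Cmod w) s) as [Hw|Hw]. now apply Hloc.
    exists (Cmod w - s)%R. split. lra. intros z' w' _ H1 _ H2.
    rewrite Cmod_sub_sym in H2. assert (T := Cmod_near w w'). lra.
  - exists (Cmod z - s)%R. split. lra. intros z' w' H1 _ H2 _.
    rewrite Cmod_sub_sym in H2. assert (T := Cmod_near z z'). lra. }
set (zz := fun t : Compactness.Tn 4 R => (fst t, fst (snd t)) : C).
set (ww := fun t : Compactness.Tn 4 R => (fst (snd (snd t)), fst (snd (snd (snd t)))) : C).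
(* The factor 2 pays for passing from coordinatewise distance to [Cmod], through [Cmod_le_abs]. *)
assert (Hd : forall t, exists d : posreal,
  forall z' w', (Cmod z' <= s)%R -> (Cmod w' <= s)%R ->
       (Cmod (z' - zz t) < 2 * d)%R -> (Cmod (w' - ww t) < 2 * d)%R -> P d z' w').
{ intros t. destruct (Hall (zz t) (ww t)) as [d [Hd H]].
  assert (Hd2 : (0 < d / 2)%R) by lra. exists (mkposreal _ Hd2). simpl.
  intros z' w' h1 h2 h3 h4. apply (Hmono d); [lra|]. apply H; auto; lra. }
set (delta := fun t => proj1_sig (constructive_indefinite_description _ (Hd t))).
assert (Hdelta : forall t z' w', (Cmod z' <= s)%R -> (Cmod w' <= s)%R ->
       (Cmod (z' - zz t) < 2 * delta t)%R -> (Cmod (w' - ww t) < 2 * delta t)%R -> P (delta t) z' w').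
{ intros t. unfold delta. exact (proj2_sig (constructive_indefinite_description _ (Hd t))). }
destruct (compactness_value 4 (-s, (-s, (-s, (-s, tt))))%R (s, (s, (s, (s, tt)))) delta) as [d H].
exists d. split. apply cond_pos. intros z w Hz Hw.
assert (Bz1 := re_le_Cmod z). assert (Bw1 := re_le_Cmod w).
assert (Bz2 : (Rabs (Im z) <= Cmod z)%R) by (eapply Rle_trans; [apply Rmax_r | apply (Rmax_Cmod z)]).
assert (Bw2 : (Rabs (Im w) <= Cmod w)%R) by (eapply Rle_trans; [apply Rmax_r | apply (Rmax_Cmod w)]).
assert (Hin : bounded_n 4 (-s, (-s, (-s, (-s, tt))))%R (s, (s, (s, (s, tt))))
   (Re z, (Im z, (Re w, (Im w, tt))))).
{ assert (HH : forall x, (Rabs x <= s)%R -> (- s <= x <= s)%R) by (intros; now apply Rabs_le_between).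
  simpl. repeat (split; [apply HH; lra|]). exact I. }
(* [compactness_value] provides the covering cell only under a double negation. *)
apply NNPP. intros HP. apply (H _ Hin). intros [t [_ [Hc Hdt]]]. apply HP.
apply (Hmono (delta t)). split; [apply cond_pos | exact Hdt].
destruct t as [t1 [t2 [t3 [t4 t5]]]]. simpl in Hc.
apply Hdelta; auto; (eapply Rle_lt_trans; [apply Cmod_le_abs|]); unfold zz, ww; simpl;
 destruct z as [z1 z2], w as [w1 w2]; simpl in *; unfold Rminus in Hc; lra.
Qed.

Definition open_disc (r : R) (z : C) : Prop := (Cmod z < r)%R.

(** Compactness of the set of pairs at distance at least [rho]. Near a closer pair the implication
    is vacuous; near any other one |f z - f w| is positive by injectivity and stays away from 0 by
    continuity. *)
Lemma separation (f : C -> C) (s R1 rho : R) : (0 < rho)%R -> (s < R1)%R ->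
  (forall z, open_disc R1 z -> Ccont f z) ->
  (forall z w, open_disc R1 z -> open_disc R1 w -> f z = f w -> z = w) ->
  exists d, (0 < d)%R /\ forall z w, (Cmod z <= s)%R -> (Cmod w <= s)%R ->
    (rho <= Cmod (z - w))%R -> (d <= Cmod (f z - f w))%R.
Proof.
intros Hrho Hs Hc Hinj.
apply (closed_disc_compact s (fun d z w => rho <= Cmod (z - w) -> d <= Cmod (f z - f w))%R).
{ intros d d' z w Hd H1 H2. specialize (H1 H2). lra. }
intros z w Hz Hw.
destruct (Rlt_le_dec (Cmod (z - w)) rho) as [H|H].
- exists ((rho - Cmod (z - w)) / 2)%R. split. lra.
  intros z' w' _ _ H1 H2 H3. exfalso.
  assert (T := Cmod_triangle (z' - z) (z - w)).
  assert (T' := Cmod_triangle ((z' - z) + (z - w)) (w - w')).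
  replace (z' - z + (z - w) + (w - w')) with (z' - w') in T' by ring.
  rewrite (Cmod_sub_sym w w') in T'. lra.
- assert (Hne : f z - f w <> RtoC 0).
  { intros E0. assert (E1 : z = w).
    { apply Hinj; unfold open_disc; try lra. replace (f z) with (f z - f w + f w) by ring. rewrite E0. ring. }
    subst w. replace (z - z) with (RtoC 0) in H by ring. rewrite Cmod_0 in H. lra. }
  apply Cmod_gt_0 in Hne. set (m := Cmod (f z - f w)) in *.
  destruct (Hc z) with (m / 4)%R as [d1 [Hd1 H1]]; [unfold open_disc; lra | lra |].
  destruct (Hc w) with (m / 4)%R as [d2 [Hd2 H2]]; [unfold open_disc; lra | lra |].
  exists (Rmin (m / 4) (Rmin d1 d2)). split. { repeat apply Rmin_pos; lra. }
  assert (T1 := Rmin_l (m / 4) (Rmin d1 d2)).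
  assert (T2 := Rmin_r (m / 4) (Rmin d1 d2)).
  assert (T3 := Rmin_l d1 d2).
  assert (T4 := Rmin_r d1 d2).
  intros z' w' _ _ H3 H4 _.
  specialize (H1 z' ltac:(lra)). specialize (H2 w' ltac:(lra)).
  assert (T := Cmod_triangle (f z - f z') (f z' - f w')).
  assert (T' := Cmod_triangle ((f z - f z') + (f z' - f w')) (f w' - f w)).
  replace (f z - f z' + (f z' - f w') + (f w' - f w)) with (f z - f w) in T' by ring.
  rewrite (Cmod_sub_sym (f z)) in T. fold m in T'. lra.
Qed.

Lemma hol1_intro (U : C -> Prop) (f f' : C -> C) :
  (forall z, U z -> is_derive f z (f' z)) -> (forall z, U z -> Ccont f' z) -> hol 1 U f.
Proof. intros H1 H2. exists f'. now split. Qed.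

(** The quotient f'(zeta) x / (f(zeta + x) - f(zeta)) is holomorphic for x <> 0 by injectivity and
    tends to 1 at x = 0, so its mean over |x| = rho is 1. On that circle its modulus is at most
    |f'(zeta)| rho / d. *)
Lemma derive_lower_bound (f f' : C -> C) (R1 rho d : R) (zeta : C) :
  (forall z, open_disc R1 z -> is_derive f z (f' z)) ->
  (forall z, open_disc R1 z -> Ccont f' z) ->
  (forall z w, open_disc R1 z -> open_disc R1 w -> f z = f w -> z = w) ->
  (0 < rho)%R -> (Cmod zeta + rho < R1)%R -> (0 < d)%R ->
  (forall x, Cmod x = rho -> (d <= Cmod (f (zeta + x)%C - f zeta))%R) ->
  f' zeta <> RtoC 0 -> (d <= rho * Cmod (f' zeta))%R.
Proof.
intros Hd Hc Hinj Hrho HR Hdp Hsep Hne.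
set (b := (R1 - Cmod zeta)%R).
assert (Hz : open_disc R1 zeta) by (unfold open_disc; lra).
assert (Hin : forall x, (Cmod x < b)%R -> open_disc R1 (zeta + x)).
{ intros x Hx. unfold open_disc. assert (T := Cmod_triangle zeta x). unfold b in Hx. lra. }
assert (Hn0 : forall x, annulus 0 b x -> f (zeta + x) - f zeta <> RtoC 0).
{ intros x [Hx1 Hx2] E0. assert (E1 : zeta + x = zeta).
  { apply Hinj; auto. replace (f (zeta + x)) with (f (zeta + x) - f zeta + f zeta) by ring. rewrite E0. ring. }
  assert (x = RtoC 0) by (replace x with (zeta + x - zeta) by ring; rewrite E1; ring).
  subst x. rewrite Cmod_0 in Hx1. lra. }
set (g := fun x => f' zeta * x / (f (zeta + x) - f zeta)).
assert (Hg : hol 1 (annulus 0 b) g).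
{ apply hol_div; auto.
  - apply hol_mult. apply hol_const. apply hol_id.
  - apply hol_minus; [|apply hol_const].
    apply (hol_comp 1 _ (open_disc R1) f (fun x => zeta + x)).
    + intros x [_ Hx]; auto.
    + now apply hol1_intro with f'.
    + apply hol_plus. apply hol_const. apply hol_id. }
assert (P := proj1 (Cmod_gt_0 _) Hne). set (m := Cmod (f' zeta)) in *.
assert (Hci : circle_int g rho = (2 * PI * Re (RtoC 1))%R).
{ apply circle_int_removable with b; auto. unfold b; lra.
  intros e He.
  destruct (proj1 (is_derive_C_eps _ _ _) (Hd zeta Hz) (Rmin (m / 2) (e * m / 4))) as [dd [Hdd H]].
  { apply Rmin_pos. lra. apply Rdiv_lt_0_compat; try lra. now apply Rmult_lt_0_compat. }
  exists (Rmin dd b). split. { apply Rmin_pos; unfold b; lra. }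
  assert (T1 := Rmin_l dd b). assert (T2 := Rmin_r dd b).
  intros x Hx. specialize (H (zeta + x)).
  replace (zeta + x - zeta) with x in H by ring. specialize (H ltac:(lra)).
  assert (Hx0 : annulus 0 b x) by (unfold annulus; lra).
  specialize (Hn0 x Hx0). set (D := f (zeta + x) - f zeta) in *.
  assert (T3 := Rmin_l (m / 2) (e * m / 4)). assert (T4 := Rmin_r (m / 2) (e * m / 4)).
  assert (HD : (m / 2 * Cmod x <= Cmod D)%R).
  { assert (T := Cmod_triangle_rev (f' zeta * x) D). rewrite Cmod_mult, Cmod_sub_sym in T.
    fold m in T. nra. }
  unfold g. fold D.
  replace (f' zeta * x / D - RtoC 1) with (- (D - f' zeta * x) / D) by now field.
  rewrite Cmod_div, Cmod_opp by auto.
  assert (PD := proj1 (Cmod_gt_0 _) Hn0).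
  apply Rlt_div_l; auto.
  apply Rle_lt_trans with (e * m / 4 * Cmod x)%R. nra.
  apply Rlt_le_trans with (e * (m / 2 * Cmod x))%R; [|apply Rmult_le_compat_l; lra].
  assert (0 < e * m * Cmod x)%R by (repeat apply Rmult_lt_0_compat; lra). lra. }
assert (T := TwoPI_pos).
assert (Hle : (circle_int g rho <= 2 * PI * (m * rho / d))%R).
{ rewrite <- period_int_const. apply period_int_le.
  - apply Ccont_circ_Re. intros t. apply (hol_cont _ _ _ Hg).
    unfold annulus. rewrite Cmod_circ; unfold b; lra.
  - apply continuity_cst.
  - intros t. eapply Rle_trans; [apply Re_le_Cmod|].
    assert (Hcr : Cmod (circ rho t) = rho) by (apply Cmod_circ; lra).
    unfold g. rewrite Cmod_div. 2:{ apply Hn0. unfold annulus. rewrite Hcr. unfold b; lra. }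
    rewrite Cmod_mult, Hcr. fold m. specialize (Hsep _ Hcr).
    unfold Rdiv. apply Rmult_le_compat_l. nra. apply Rinv_le_contravar; auto. }
rewrite Hci in Hle. simpl in Hle.
assert (1 <= m * rho / d)%R by nra.
apply Rle_div_r in H; lra.
Qed.

(* If f' vanished somewhere, then along a ray it would take arbitrarily small nonzero
   values, against the uniform bound of [derive_lower_bound]. *)
Lemma injective_derive_neq_0 (f f' : C -> C) (R1 : R) :
  (forall z, open_disc R1 z -> is_derive f z (f' z)) ->
  (forall z, open_disc R1 z -> Ccont f' z) ->
  (forall z w, open_disc R1 z -> open_disc R1 w -> f z = f w -> z = w) ->
  f' (RtoC 0) <> RtoC 0 ->
  forall z, open_disc R1 z -> f' z <> RtoC 0.
Proof.
intros Hd Hc Hinj H0 z0 Hz0 E0. unfold open_disc in Hz0.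
set (rho := ((R1 - Cmod z0) / 2)%R).
assert (Hrho : (0 < rho)%R) by (unfold rho; lra).
destruct (separation f (Cmod z0 + rho) R1 rho) as [d [Hdp Hsep]]; auto.
{ unfold rho; lra. }
{ intros z Hz. eapply is_derive_Ccont. now apply Hd. }
assert (Hlow : forall z, (Cmod z <= Cmod z0)%R -> f' z <> RtoC 0 -> (d / rho <= Cmod (f' z))%R).
{ intros z Hz Hne. apply Rle_div_l; auto. rewrite Rmult_comm.
  apply (derive_lower_bound f f' R1 rho d z); auto. unfold rho; lra.
  intros x Hx. assert (T := Cmod_triangle z x).
  apply Hsep; try lra. replace (z + x - z) with x by ring. lra. }
assert (P0 := proj1 (Cmod_gt_0 _) H0).
(* The parameter sin^2 u runs over [0, 1] but is defined for every real u, so [phi] is continuous on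
   all of R, as [IVT_gen] demands, while the argument of f' never leaves the disc. *)
set (phi := fun u => Cmod (f' (RtoC (sin u * sin u) * z0))).
assert (Hs : forall u, (0 <= sin u * sin u <= 1)%R).
{ intros u. assert (T := sin2_cos2 u). unfold Rsqr in T. nra. }
assert (Hin : forall u, (Cmod (RtoC (sin u * sin u) * z0) <= Cmod z0)%R).
{ intros u. rewrite Cmod_mult, Cmod_R, Rabs_pos_eq by apply Hs.
  assert (T := Hs u). assert (T' := Cmod_ge_0 z0). nra. }
assert (Hphi : continuity phi).
{ intros u e He.
  destruct (Hc (RtoC (sin u * sin u) * z0)) with e as [d1 [Hd1 H1]]; auto.
  { unfold open_disc. eapply Rle_lt_trans; [apply Hin|lra]. }
  assert (Cs : continuity (fun u => sin u * sin u * Cmod z0)%R).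
  { apply continuity_mult; [|apply continuity_cst]. apply continuity_mult; apply continuity_sin. }
  destruct (Cs u d1 Hd1) as [d2 [Hd2 H2]].
  exists d2; split; auto. intros v Hv. specialize (H2 v Hv).
  simpl in *. unfold Rdist in *. unfold phi.
  eapply Rle_lt_trans; [|apply (H1 (RtoC (sin v * sin v) * z0))].
  - apply Rabs_le. split.
    + assert (T := Cmod_triangle_rev (f' (RtoC (sin u * sin u) * z0)) (f' (RtoC (sin v * sin v) * z0))).
      rewrite Cmod_sub_sym in T. lra.
    + apply Cmod_triangle_rev.
  - replace (RtoC (sin v * sin v) * z0 - RtoC (sin u * sin u) * z0) with
      (RtoC (sin v * sin v - sin u * sin u) * z0) by (rewrite RtoC_minus; ring).
    rewrite Cmod_mult, Cmod_R.
    replace (sin v * sin v * Cmod z0 - sin u * sin u * Cmod z0)%R with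
     ((sin v * sin v - sin u * sin u) * Cmod z0)%R in H2 by ring.
    rewrite Rabs_mult, (Rabs_pos_eq (Cmod z0)) in H2 by apply Cmod_ge_0. exact H2. }
(* A positive value below |f'(0)|, hence attained by [phi], and below d / rho, hence excluded by
   [Hlow]. *)
set (y := (Rmin (d / rho) (Cmod (f' (RtoC 0))) / 2)%R).
assert (Hdr : (0 < d / rho)%R) by now apply Rdiv_lt_0_compat.
assert (Hm : (0 < Rmin (d / rho) (Cmod (f' (RtoC 0))))%R) by now apply Rmin_pos.
assert (T1 := Rmin_l (d / rho) (Cmod (f' (RtoC 0)))).
assert (T2 := Rmin_r (d / rho) (Cmod (f' (RtoC 0)))).
destruct (IVT_gen phi 0 (PI / 2) y) as [u [_ Hu]].
- intros u. apply Hphi.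
- unfold phi. rewrite sin_0, sin_PI2, Rmult_0_l, Rmult_1_l.
  replace (RtoC 0 * z0) with (RtoC 0) by ring. replace (RtoC 1 * z0) with z0 by ring.
  rewrite E0, Cmod_0, Rmin_right, Rmax_left by lra. unfold y; lra.
- assert (Hyp : f' (RtoC (sin u * sin u) * z0) <> RtoC 0).
  { apply Cmod_gt_0. fold (phi u). rewrite Hu. unfold y; lra. }
  assert (T := Hlow _ (Hin u) Hyp). fold (phi u) in T. rewrite Hu in T. unfold y in T. lra.
Qed.

(** * The mean value inequality and bi-Lipschitz bounds *)

Lemma segment_derive (f : C -> C) (w z l : C) (t : R) :
  is_derive f (w + RtoC t * (z - w)) l ->
  curve_derive (fun u => f (w + RtoC u * (z - w))) t (l * (z - w)).
Proof.
intros H. apply (curve_derive_comp f (fun u => w + RtoC u * (z - w))); auto.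
intros e He. exists 1%R. split. lra. intros y _.
replace (w + RtoC y * (z - w) - (w + RtoC t * (z - w)) - (z - w) * RtoC (y - t)) with (RtoC 0)
  by (rewrite RtoC_minus; ring).
rewrite Cmod_0. apply Rmult_le_pos. lra. apply Rabs_pos.
Qed.

Lemma Re_conj_self (z : C) : Re (Cconj z * z) = (Cmod z * Cmod z)%R.
Proof.
replace (Cmod z * Cmod z)%R with (Cmod z ^ 2)%R by ring. rewrite Cmod2_alt.
destruct z; simpl; ring.
Qed.

(** Projecting on the direction of the increment D reduces the claim to a real function: Re (conj D
    g) grows by |D|^2 along the segment, with derivative at most |D| M |z - w|. The range |t| <= 1
    is the symmetric one that [bounded_variation] asks for. *)
Lemma complex_mean_value (g g' : C -> C) (w z : C) (M : R) :
  (forall t, (Rabs t <= 1)%R ->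
     is_derive g (w + RtoC t * (z - w)) (g' (w + RtoC t * (z - w))) /\
     (Cmod (g' (w + RtoC t * (z - w))%C) <= M)%R) ->
  (Cmod (g z - g w) <= M * Cmod (z - w))%R.
Proof.
intros H. set (D := g z - g w).
destruct (Req_dec (Cmod D) 0) as [E0|E0].
{ rewrite E0. apply Rmult_le_pos; [|apply Cmod_ge_0].
  destruct (H 0%R) as [_ H']. rewrite Rabs_R0; lra.
  eapply Rle_trans; [apply Cmod_ge_0|exact H']. }
assert (P := Cmod_ge_0 D).
set (phi := fun t => Re (Cconj D * g (w + RtoC t * (z - w)))).
assert (HB : (Rabs (phi 1 - phi 0) <= (Cmod D * (M * Cmod (z - w))) * Rabs (1 - 0))%R).
{ apply (bounded_variation phi (fun t => Re (Cconj D * g' (w + RtoC t * (z - w)) * (z - w)))).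
  intros t Ht. rewrite !Rminus_0_r, Rabs_R1 in Ht. destruct (H t Ht) as [H1 H2]. split.
  - apply curve_derive_Re. apply (segment_derive (fun x => Cconj D * g x)).
    eapply is_derive_C_eq. apply is_derive_C_mult. apply is_derive_C_const. exact H1.
    cbv beta; ring.
  - eapply Rle_trans; [apply re_le_Cmod|]. rewrite !Cmod_mult, Cmod_conj, Rmult_assoc.
    apply Rmult_le_compat_l; auto. apply Rmult_le_compat_r; auto. apply Cmod_ge_0. }
unfold phi in HB. rewrite Rminus_0_r, Rabs_R1, Rmult_1_r, <- Re_minus in HB.
replace (Cconj D * g (w + RtoC 1 * (z - w)) - Cconj D * g (w + RtoC 0 * (z - w))) with (Cconj D * D) in HB.
2:{ unfold D at 2. replace (w + RtoC 1 * (z - w)) with z by ring.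
    replace (w + RtoC 0 * (z - w)) with w by ring. ring. }
rewrite Re_conj_self, Rabs_pos_eq in HB by nra.
apply Rmult_le_reg_l with (Cmod D); auto. lra.
Qed.

(** The mean value inequality is applied to f(u) - f'(z) u, whose derivative is small near z by
    continuity of f'. *)
Lemma strict_derive (f f' : C -> C) (z : C) (r e : R) : (0 < r)%R ->
  (forall x, (Cmod (x - z) < r)%R -> is_derive f x (f' x)) -> Ccont f' z -> (0 < e)%R ->
  exists d, (0 < d)%R /\ forall x y, (Cmod (x - z) < d)%R -> (Cmod (y - z) < d)%R ->
    (Cmod (f x - f y - f' z * (x - y)) <= e * Cmod (x - y))%R.
Proof.
intros Hr Hd Hc He. destruct (Hc e He) as [d [Hdp H]].
(* The points y + t (x - y) with |t| <= 1 stay within three times this radius of z. *)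
exists (Rmin r d / 3)%R. assert (0 < Rmin r d)%R by now apply Rmin_pos.
assert (T1 := Rmin_l r d). assert (T2 := Rmin_r r d). split. lra.
intros x y Hx Hy.
replace (f x - f y - f' z * (x - y)) with ((f x - f' z * x) - (f y - f' z * y)) by ring.
apply (complex_mean_value (fun u => f u - f' z * u) (fun u => f' u - f' z)).
intros t Ht.
assert (HB : (Cmod (y + RtoC t * (x - y) - z) < Rmin r d)%R).
{ replace (y + RtoC t * (x - y) - z) with ((y - z) + RtoC t * ((x - z) - (y - z))) by ring.
  eapply Rle_lt_trans; [apply Cmod_triangle|]. rewrite Cmod_mult, Cmod_R.
  assert (T := Cmod_triangle (x - z) (- (y - z))). rewrite Cmod_opp in T.
  fold (Cminus (x - z) (y - z)) in T.
  assert (P := Cmod_ge_0 (x - z - (y - z))). assert (P' := Rabs_pos t).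
  assert (Rabs t * Cmod (x - z - (y - z)) <= 1 * Cmod (x - z - (y - z)))%R by (apply Rmult_le_compat_r; auto).
  lra. }
split.
- apply is_derive_C_eq with (f' (y + RtoC t * (x - y)) + (- f' z) * RtoC 1); [|ring].
  apply is_derive_C_ext with (f := fun u => f u + (- f' z) * u) (d := 1%R). lra.
  intros; ring.
  apply is_derive_C_plus. apply Hd; lra.
  eapply is_derive_C_eq. apply is_derive_C_mult. apply is_derive_C_const. apply is_derive_C_id.
  cbv beta; ring.
- left. apply H. lra.
Qed.

Lemma far_pairs (f : C -> C) (z w : C) (e : R) : (0 < e)%R ->
  Ccont f z -> Ccont f w ->
  exists d, (0 < d)%R /\ forall z' w', (Cmod (z' - z) < d)%R -> (Cmod (w' - w) < d)%R ->
    (Rabs (Cmod (f z' - f w') - Cmod (f z - f w)) < e)%R.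
Proof.
intros He H1 H2.
destruct (H1 (e/2)%R) as [d1 [Hd1 H1']]; [lra|].
destruct (H2 (e/2)%R) as [d2 [Hd2 H2']]; [lra|].
exists (Rmin d1 d2). split. now apply Rmin_pos. intros z' w' Hz Hw.
specialize (H1' z' (Rlt_le_trans _ _ _ Hz (Rmin_l _ _))).
specialize (H2' w' (Rlt_le_trans _ _ _ Hw (Rmin_r _ _))).
assert (T := Cmod_triangle_rev (f z' - f w') (f z - f w)).
assert (T' := Cmod_triangle_rev (f z - f w) (f z' - f w')).
assert (T'' := Cmod_triangle (f z' - f z) (- (f w' - f w))).
rewrite Cmod_opp in T''.
replace (f z' - f z + - (f w' - f w)) with (f z' - f w' - (f z - f w)) in T'' by ring.
rewrite (Cmod_sub_sym (f z - f w)) in T'. apply Rabs_def1; lra.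
Qed.

(** By compactness: near the diagonal strict differentiability with f' <> 0 gives both inequalities,
    and off the diagonal both distances are locally bounded above and away from 0. One constant m
    bounds the two ratios, which suits [closed_disc_compact]. *)
Lemma injective_bilipschitz (f f' : C -> C) (s R1 : R) : (0 < s < R1)%R ->
  (forall z, open_disc R1 z -> is_derive f z (f' z)) ->
  (forall z, open_disc R1 z -> Ccont f' z) ->
  (forall z w, open_disc R1 z -> open_disc R1 w -> f z = f w -> z = w) ->
  (forall z, open_disc R1 z -> f' z <> RtoC 0) ->
  exists m, (0 < m)%R /\ forall z w, (Cmod z <= s)%R -> (Cmod w <= s)%R ->
    (m * Cmod (z - w) <= Cmod (f z - f w))%R /\ (m * Cmod (f z - f w) <= Cmod (z - w))%R.
Proof.
intros Hs Hd Hc Hinj Hne.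
apply (closed_disc_compact s (fun m z w =>
  m * Cmod (z - w) <= Cmod (f z - f w) /\ m * Cmod (f z - f w) <= Cmod (z - w))%R).
{ intros d d' z w Hdd [H1 H2]. assert (T := Cmod_ge_0 (z - w)). assert (T' := Cmod_ge_0 (f z - f w)).
  split; nra. }
intros z w Hz Hw.
assert (Dz : open_disc R1 z) by (unfold open_disc; lra). assert (Dw : open_disc R1 w) by (unfold open_disc; lra).
destruct (classic (z = w)) as [E0|E0].
- subst w. assert (P := proj1 (Cmod_gt_0 _) (Hne z Dz)). set (m := Cmod (f' z)) in *.
  destruct (strict_derive f f' z (R1 - Cmod z) (m / 2)) as [d [Hdp H]]; auto; try (unfold open_disc in *; lra).
  { intros x Hx. apply Hd. unfold open_disc. assert (T := Cmod_near x z). lra. }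
  (* Near z the image distance |D| lies between m/2 and 3m/2 times |u|. *)
  set (K := (Rmin d (Rmin (m / 2) (/ (2 * m))))%R).
  exists K.
  assert (T1 := Rmin_l d (Rmin (m / 2) (/ (2 * m)))).
  assert (T2 := Rmin_r d (Rmin (m / 2) (/ (2 * m)))).
  assert (T3 := Rmin_l (m / 2) (/ (2 * m))).
  assert (T4 := Rmin_r (m / 2) (/ (2 * m))). fold K in T1, T2.
  assert (HK : (0 < K)%R). { repeat apply Rmin_pos; try lra. apply Rinv_0_lt_compat; lra. }
  split; auto. intros x y _ _ Hx Hy. specialize (H x y ltac:(lra) ltac:(lra)).
  set (D := f x - f y) in *. set (u := x - y) in *.
  assert (U1 := Cmod_triangle_rev (f' z * u) D). rewrite Cmod_mult, Cmod_sub_sym in U1.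
  assert (U2 := Cmod_triangle_rev D (f' z * u)). rewrite Cmod_mult in U2. fold m in U1, U2.
  assert (P1 := Cmod_ge_0 u). assert (P2 := Cmod_ge_0 D). split.
  + nra.
  + apply Rle_trans with (/ (2 * m) * (2 * m * Cmod u))%R.
    assert (Q := Rmult_le_pos m (Cmod u) (Rlt_le _ _ P) P1).
    apply Rmult_le_compat; lra. right; field; lra.
- assert (Hn : f z - f w <> RtoC 0).
  { intros E1. apply E0, Hinj; auto. replace (f z) with (f z - f w + f w) by ring. rewrite E1; ring. }
  assert (Hn' : z - w <> RtoC 0).
  { intros E1. apply E0. replace z with (z - w + w) by ring. rewrite E1; ring. }
  apply Cmod_gt_0 in Hn. apply Cmod_gt_0 in Hn'.
  set (a := Cmod (f z - f w)) in *. set (b := Cmod (z - w)) in *.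
  destruct (far_pairs f z w (a / 2)) as [d1 [Hd1 H1]]; [lra| | |];
    try (eapply is_derive_Ccont; apply Hd; auto).
  destruct (far_pairs (fun x => x) z w (b / 2)) as [d2 [Hd2 H2]]; [lra|apply Ccont_id|apply Ccont_id|].
  fold a in H1. fold b in H2.
  (* Within [d1] and [d2] the image distance stays between a/2 and 2a, and the distance of the
     points between b/2 and 2b. *)
  set (K := (Rmin (Rmin d1 d2) (Rmin (a / (4 * b)) (b / (4 * a))))%R).
  exists K.
  assert (HK : (0 < K)%R). { repeat apply Rmin_pos; try lra; apply Rdiv_lt_0_compat; lra. }
  split; auto.
  assert (T1 := Rmin_l (Rmin d1 d2) (Rmin (a / (4 * b)) (b / (4 * a)))).
  assert (T2 := Rmin_r (Rmin d1 d2) (Rmin (a / (4 * b)) (b / (4 * a)))).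
  assert (T3 := Rmin_l (a / (4 * b)) (b / (4 * a))).
  assert (T4 := Rmin_r (a / (4 * b)) (b / (4 * a))). fold K in T1, T2.
  assert (T5 := Rmin_l d1 d2). assert (T6 := Rmin_r d1 d2).
  intros x y _ _ Hx Hy.
  specialize (H1 x y ltac:(lra) ltac:(lra)). specialize (H2 x y ltac:(lra) ltac:(lra)).
  apply Rabs_def2 in H1. apply Rabs_def2 in H2. split.
  + apply Rle_trans with (a / (4 * b) * (2 * b))%R.
    apply Rmult_le_compat; try lra; apply Cmod_ge_0.
    replace (a / (4 * b) * (2 * b))%R with (a / 2)%R by (field; lra). lra.
  + apply Rle_trans with (b / (4 * a) * (2 * a))%R.
    apply Rmult_le_compat; try lra; apply Cmod_ge_0.
    replace (b / (4 * a) * (2 * a))%R with (b / 2)%R by (field; lra). lra.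
Qed.

(** * Open mapping and differentiability of the inverse *)

(** If the infimum - mu were not attained, F + mu would be positive on the disc, hence at least some
    d > 0 by compactness, and - mu would not be the infimum. *)
Lemma closed_disc_min (F : C -> R) (r : R) : (0 <= r)%R ->
  (forall x, (Cmod x <= r)%R -> forall e, (0 < e)%R -> exists d, (0 < d)%R /\
     forall y, (Cmod y <= r)%R -> (Cmod (y - x) < d)%R -> (Rabs (F y - F x) < e)%R) ->
  (forall x, (0 <= F x)%R) ->
  exists x, (Cmod x <= r)%R /\ forall y, (Cmod y <= r)%R -> (F x <= F y)%R.
Proof.
intros Hr Hc Hpos.
destruct (completeness (fun v => exists x, (Cmod x <= r)%R /\ v = (- F x)%R)) as [mu [Hub Hlub]].
{ exists 0%R. intros v [x [_ ->]]. specialize (Hpos x); lra. }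
{ exists (- F (RtoC 0))%R. exists (RtoC 0). rewrite Cmod_0. auto. }
apply NNPP. intros Hno.
assert (Hlt : forall x, (Cmod x <= r)%R -> (- mu < F x)%R).
{ intros x Hx. destruct (Rlt_le_dec (- mu) (F x)) as [H|H]; auto. exfalso. apply Hno.
  exists x. split; auto. intros y Hy.
  assert (T : (- F y <= mu)%R) by (apply Hub; exists y; auto). lra. }
destruct (closed_disc_compact r (fun d z _ => d <= F z + mu)%R) as [d [Hd H]].
{ intros; lra. }
{ intros z w Hz _. specialize (Hlt z Hz).
  destruct (Hc z Hz ((F z + mu) / 2)%R) as [d [Hd H]]; [lra|].
  exists (Rmin d ((F z + mu) / 2)). split. { apply Rmin_pos; lra. }
  intros y y' Hy _ H1 _.
  assert (T1 := Rmin_l d ((F z + mu) / 2)). assert (T2 := Rmin_r d ((F z + mu) / 2)).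
  specialize (H y Hy ltac:(lra)). apply Rabs_def2 in H. lra. }
assert (T : (mu <= mu - d)%R).
{ apply Hlub. intros v [x [Hx ->]]. specialize (H x (RtoC 0) Hx). rewrite Cmod_0 in H. specialize (H Hr). lra. }
lra.
Qed.

(* At a minimum of |g - y| with g <> y, moving in the direction -(g - y)/g' decreases it. *)
Lemma open_mapping (g g' : C -> C) (z0 : C) (R1 e : R) :
  (forall z, open_disc R1 z -> is_derive g z (g' z)) ->
  (forall z, open_disc R1 z -> g' z <> RtoC 0) -> open_disc R1 z0 -> (0 < e)%R ->
  exists eta, (0 < eta)%R /\ forall y, (Cmod (y - g z0) < eta)%R ->
    exists x, (Cmod (x - z0) < e)%R /\ open_disc R1 x /\ g x = y.
Proof.
intros Hd Hne Hz0 He. unfold open_disc in Hz0.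
assert (Pm := proj1 (Cmod_gt_0 _) (Hne z0 Hz0)). set (m := Cmod (g' z0)) in *.
destruct (proj1 (is_derive_C_eps _ _ _) (Hd z0 Hz0) (m / 2)%R) as [d [Hdp H]]; [lra|].
set (r := (Rmin (Rmin d e) (R1 - Cmod z0) / 2)%R).
assert (Hr0 : (0 < Rmin (Rmin d e) (R1 - Cmod z0))%R) by (repeat apply Rmin_pos; lra).
assert (T1 := Rmin_l (Rmin d e) (R1 - Cmod z0)).
assert (T2 := Rmin_r (Rmin d e) (R1 - Cmod z0)).
assert (T3 := Rmin_l d e). assert (T4 := Rmin_r d e).
assert (Hr : (0 < r)%R) by (unfold r; lra).
assert (Hin : forall x, (Cmod x <= r)%R -> open_disc R1 (z0 + x)).
{ intros x Hx. unfold open_disc. assert (T := Cmod_triangle z0 x). unfold r in Hx. lra. }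
(* On |x| = r the image is at distance at least m r / 2 from g(z0), hence farther from y than g(z0)
   is. The minimum of |g - y| is therefore interior. *)
exists (m * r / 4)%R. split. { assert (0 < m * r)%R by nra. lra. }
intros y Hy.
destruct (closed_disc_min (fun x => Cmod (g (z0 + x) - y)) r) as [x [Hx Hmin]].
{ lra. }
{ intros x Hx e' He'. destruct (is_derive_Ccont _ _ _ (Hd _ (Hin x Hx)) e' He') as [d' [Hd' H']].
  exists d'. split; auto. intros x' _ Hx'.
  specialize (H' (z0 + x')). replace (z0 + x' - (z0 + x)) with (x' - x) in H' by ring.
  specialize (H' Hx').
  assert (U1 := Cmod_triangle_rev (g (z0 + x') - y) (g (z0 + x) - y)).
  assert (U2 := Cmod_triangle_rev (g (z0 + x) - y) (g (z0 + x') - y)).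
  rewrite (Cmod_sub_sym (g (z0 + x) - y)) in U2.
  replace (g (z0 + x') - y - (g (z0 + x) - y)) with (g (z0 + x') - g (z0 + x)) in U1, U2 by ring.
  apply Rabs_def1; lra. }
{ intros; apply Cmod_ge_0. }
cbv beta in Hmin.
assert (Hxr : (Cmod x < r)%R).
{ destruct Hx as [Hx|Hx]; auto. exfalso.
  specialize (Hmin (RtoC 0)). rewrite Cmod_0 in Hmin. specialize (Hmin ltac:(lra)).
  replace (z0 + RtoC 0) with z0 in Hmin by ring.
  specialize (H (z0 + x)). replace (z0 + x - z0) with x in H by ring.
  specialize (H ltac:(unfold r in Hx; lra)). rewrite Hx in H.
  assert (U1 := Cmod_triangle_rev (g' z0 * x) (g (z0 + x) - g z0)).
  rewrite Cmod_mult, (Cmod_sub_sym (g' z0 * x)), Hx in U1. fold m in U1.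
  assert (U2 := Cmod_triangle (g (z0 + x) - y) (y - g z0)).
  replace (g (z0 + x) - y + (y - g z0)) with (g (z0 + x) - g z0) in U2 by ring.
  rewrite (Cmod_sub_sym (g z0)) in Hmin.
  assert (0 < m * r)%R by nra. lra. }
exists (z0 + x). split. { replace (z0 + x - z0) with x by ring. unfold r in Hxr; lra. }
split. now apply Hin.
apply NNPP. intros Hneq.
set (D := g (z0 + x) - y) in *.
assert (HD : D <> RtoC 0).
{ intros E0. apply Hneq. replace (g (z0 + x)) with (D + y) by (unfold D; ring). rewrite E0; ring. }
assert (PD := proj1 (Cmod_gt_0 _) HD).
assert (Hg0 := Hne _ (Hin x Hx)). set (b := g' (z0 + x)) in *.
set (v := - D / b). assert (Hbv : b * v = - D) by (unfold v; now field).
assert (Hv : v <> RtoC 0). { intros E0. rewrite E0 in Hbv. apply HD. replace D with (- (- D)) by ring. rewrite <- Hbv. ring. }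
assert (Pv := proj1 (Cmod_gt_0 _) Hv).
(* With this tolerance a step t v has linearisation error at most t |D| / 2, while the linear part
   shrinks |D| by t |D|. *)
destruct (proj1 (is_derive_C_eps _ _ _) (Hd _ (Hin x Hx)) (Cmod D / (2 * Cmod v))%R) as [d1 [Hd1 H1]].
{ apply Rdiv_lt_0_compat; lra. }
fold b in H1.
set (t := (Rmin 1 (Rmin (d1 / Cmod v) ((r - Cmod x) / Cmod v)) / 2)%R).
assert (Ht0 : (0 < Rmin 1 (Rmin (d1 / Cmod v) ((r - Cmod x) / Cmod v)))%R).
{ repeat apply Rmin_pos; try apply Rdiv_lt_0_compat; lra. }
assert (U1 := Rmin_l 1 (Rmin (d1 / Cmod v) ((r - Cmod x) / Cmod v))).
assert (U2 := Rmin_r 1 (Rmin (d1 / Cmod v) ((r - Cmod x) / Cmod v))).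
assert (U3 := Rmin_l (d1 / Cmod v) ((r - Cmod x) / Cmod v)).
assert (U4 := Rmin_r (d1 / Cmod v) ((r - Cmod x) / Cmod v)).
assert (Ht : (0 < t <= 1 / 2)%R) by (unfold t; lra).
assert (Htv : Cmod (RtoC t * v) = (t * Cmod v)%R) by (rewrite Cmod_mult, Cmod_R, Rabs_pos_eq; lra).
assert (Ht1 : (t * Cmod v < d1)%R) by (apply Rlt_div_r; unfold t; lra).
assert (Ht2 : (t * Cmod v < r - Cmod x)%R) by (apply Rlt_div_r; unfold t; lra).
specialize (Hmin (x + RtoC t * v)).
specialize (H1 (z0 + (x + RtoC t * v))).
replace (z0 + (x + RtoC t * v) - (z0 + x)) with (RtoC t * v) in H1 by ring.
rewrite Htv in H1. specialize (H1 Ht1).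
assert (T := Cmod_triangle x (RtoC t * v)). rewrite Htv in T.
specialize (Hmin ltac:(lra)). fold D in Hmin.
replace (g (z0 + (x + RtoC t * v)) - y) with
  ((g (z0 + (x + RtoC t * v)) - g (z0 + x) - b * (RtoC t * v)) + RtoC (1 - t) * D) in Hmin.
2:{ rewrite RtoC_minus. replace (b * (RtoC t * v)) with (RtoC t * (b * v)) by ring.
    rewrite Hbv. unfold D. ring. }
assert (T' := Cmod_triangle (g (z0 + (x + RtoC t * v)) - g (z0 + x) - b * (RtoC t * v)) (RtoC (1 - t) * D)).
rewrite (Cmod_mult (RtoC (1 - t))), Cmod_R, Rabs_pos_eq in T' by lra.
replace (Cmod D / (2 * Cmod v) * (t * Cmod v))%R with (t * Cmod D / 2)%R in H1 by (field; lra).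
assert (0 < t * Cmod D)%R by nra. lra.
Qed.

(** Made total by the dummy value 0 outside the image of the disc. *)
Definition inverse_on (R1 : R) (g : C -> C) (y : C) : C :=
  match excluded_middle_informative (exists x, open_disc R1 x /\ g x = y) with
  | left H => proj1_sig (constructive_indefinite_description _ H)
  | right _ => RtoC 0
  end.

Lemma inverse_on_spec R1 g y : (exists x, open_disc R1 x /\ g x = y) ->
  open_disc R1 (inverse_on R1 g y) /\ g (inverse_on R1 g y) = y.
Proof.
intros H. unfold inverse_on. destruct excluded_middle_informative as [H'|H']; [|contradiction].
exact (proj2_sig (constructive_indefinite_description _ H')).
Qed.

Lemma inverse_on_eq R1 g x :
  (forall z w, open_disc R1 z -> open_disc R1 w -> g z = g w -> z = w) ->
  open_disc R1 x -> inverse_on R1 g (g x) = x.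
Proof.
intros Hinj Hx. destruct (inverse_on_spec R1 g (g x)) as [H1 H2]. now exists x. now apply Hinj.
Qed.

(** Composing with f serves two uses at once: f o g^-1 for close-to-convex functions, and the
    inverse itself when f is the identity. [open_mapping] supplies the continuity of the inverse. *)
Lemma is_derive_inverse_on (f g g' : C -> C) (R1 : R) (x0 a : C) :
  (forall z, open_disc R1 z -> is_derive g z (g' z)) ->
  (forall z, open_disc R1 z -> g' z <> RtoC 0) ->
  (forall z w, open_disc R1 z -> open_disc R1 w -> g z = g w -> z = w) ->
  open_disc R1 x0 -> is_derive f x0 a ->
  is_derive (fun y => f (inverse_on R1 g y)) (g x0) (a / g' x0).
Proof.
intros Hd Hne Hinj Hx0 Hf. apply is_derive_C_eps. intros e He.
assert (Hb := Hne x0 Hx0). set (b := g' x0) in *.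
assert (Pb := proj1 (Cmod_gt_0 _) Hb). set (m := Cmod b) in *.
set (q := Cmod (a / b)). assert (Pq := Cmod_ge_0 (a / b)). fold q in Pq.
destruct (proj1 (is_derive_C_eps _ _ _) Hf (e * m / 4)%R) as [d1 [Hd1 H1]].
{ assert (0 < e * m)%R by nra. lra. }
destruct (proj1 (is_derive_C_eps _ _ _) (Hd x0 Hx0) (Rmin (m / 2) (e * m / (4 * (q + 1))))%R) as [d2 [Hd2 H2]].
{ apply Rmin_pos. lra. apply Rdiv_lt_0_compat; nra. }
fold b in H2.
assert (T1 := Rmin_l (m / 2) (e * m / (4 * (q + 1)))).
assert (T2 := Rmin_r (m / 2) (e * m / (4 * (q + 1)))).
destruct (open_mapping g g' x0 R1 (Rmin d1 d2)) as [eta [Heta Ho]]; auto. now apply Rmin_pos.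
exists eta. split; auto. intros y Hy. destruct (Ho y Hy) as [x [Hx1 [Hx2 <-]]].
rewrite !inverse_on_eq by auto.
specialize (H1 x (Rlt_le_trans _ _ _ Hx1 (Rmin_l _ _))).
specialize (H2 x (Rlt_le_trans _ _ _ Hx1 (Rmin_r _ _))).
set (h := x - x0) in *. set (D := g x - g x0) in *.
assert (P := Cmod_ge_0 h).
assert (HD : (m * Cmod h <= 2 * Cmod D)%R).
{ assert (T := Cmod_triangle_rev (b * h) D). rewrite Cmod_mult, Cmod_sub_sym in T. fold m in T. nra. }
replace (f x - f x0 - a / b * D) with ((f x - f x0 - a * h) + - (a / b * (D - b * h))) by now field.
eapply Rle_trans; [apply Cmod_triangle|]. rewrite Cmod_opp, Cmod_mult. fold q.
assert (q * Cmod (D - b * h) <= e * m / 4 * Cmod h)%R.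
{ apply Rle_trans with ((q + 1) * (e * m / (4 * (q + 1)) * Cmod h))%R.
  apply Rmult_le_compat; try lra. apply Cmod_ge_0.
  eapply Rle_trans; [exact H2|]. now apply Rmult_le_compat_r.
  right; field; lra. }
assert (e * (m * Cmod h) <= e * (2 * Cmod D))%R by (apply Rmult_le_compat_l; lra).
lra.
Qed.

(** * Complex power series *)

Definition Csum (u : nat -> C) : C :=
  (Series (fun n => Re (u n)), Series (fun n => Im (u n))).

Definition abs_summable (u : nat -> C) : Prop := ex_series (fun n => Cmod (u n)).

Lemma Im_le_Cmod (z : C) : (Rabs (Im z) <= Cmod z)%R.
Proof. eapply Rle_trans; [apply Rmax_r | apply (Rmax_Cmod z)]. Qed.

Lemma ex_series_dominated (u v : nat -> R) :
  (forall n, (Rabs (u n) <= v n)%R) -> ex_series v -> ex_series u.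
Proof. intros H. apply (ex_series_le (K:=R_AbsRing) (V:=R_CompleteNormedModule)). exact H. Qed.

Lemma abs_summable_Re u : abs_summable u -> ex_series (fun n => Re (u n)).
Proof. apply ex_series_dominated. intros; apply re_le_Cmod. Qed.

Lemma abs_summable_Im u : abs_summable u -> ex_series (fun n => Im (u n)).
Proof. apply ex_series_dominated. intros; apply Im_le_Cmod. Qed.

Lemma abs_summable_le u (v : nat -> R) :
  (forall n, (Cmod (u n) <= v n)%R) -> ex_series v -> abs_summable u.
Proof.
intros H. apply ex_series_dominated. intros n. rewrite Rabs_pos_eq; auto. apply Cmod_ge_0.
Qed.

Lemma abs_summable_minus u v : abs_summable u -> abs_summable v ->
  abs_summable (fun n => u n - v n).
Proof.
intros H1 H2. apply abs_summable_le with (fun n => Cmod (u n) + Cmod (v n))%R.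
- intros n. eapply Rle_trans; [apply Cmod_triangle|]. rewrite Cmod_opp. lra.
- now apply (ex_series_plus (K:=R_AbsRing) (V:=R_NormedModule)).
Qed.

Lemma abs_summable_scal c u : abs_summable u -> abs_summable (fun n => c * u n).
Proof.
intros H. unfold abs_summable. eapply ex_series_ext.
intros n; symmetry; apply Cmod_mult.
now apply (ex_series_scal (K:=R_AbsRing) (V:=R_NormedModule)).
Qed.

Lemma Csum_ext u v : (forall n, u n = v n) -> Csum u = Csum v.
Proof. intros H. unfold Csum. f_equal; apply Series_ext; intros n; now rewrite H. Qed.

Lemma Csum_minus u v : abs_summable u -> abs_summable v ->
  Csum (fun n => u n - v n) = Csum u - Csum v.
Proof.
intros H1 H2. unfold Csum, Cminus, Cplus, Copp; simpl. f_equal.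
- apply (Series_minus (fun n => Re (u n)) (fun n => Re (v n))); auto using abs_summable_Re.
- apply (Series_minus (fun n => Im (u n)) (fun n => Im (v n))); auto using abs_summable_Im.
Qed.

Lemma Csum_scal c u : abs_summable u -> Csum (fun n => c * u n) = c * Csum u.
Proof.
intros H. assert (H1 := abs_summable_Re u H). assert (H2 := abs_summable_Im u H).
assert (S : forall k v, ex_series v -> ex_series (fun n => k * v n)%R).
{ intros k v. apply (ex_series_scal (K:=R_AbsRing) (V:=R_NormedModule)). }
destruct c as [x y]. unfold Csum, Cmult; simpl. f_equal.
- rewrite <- !Series_scal_l, <- Series_minus; auto.
- rewrite <- !Series_scal_l, <- Series_plus; auto.
Qed.

Lemma Csum_incr u : abs_summable u -> Csum u = u 0%nat + Csum (fun n => u (S n)).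
Proof.
intros H. unfold Csum. rewrite (Series_incr_1 (fun n => Re (u n))), (Series_incr_1 (fun n => Im (u n)));
  auto using abs_summable_Re, abs_summable_Im.
Qed.

(** Each component is bounded by the dominating series; passing from the larger component to the
    modulus costs sqrt 2, rounded up to 2. *)
Lemma Cmod_Csum u (v : nat -> R) : (forall n, (Cmod (u n) <= v n)%R) -> ex_series v ->
  (Cmod (Csum u) <= 2 * Series v)%R.
Proof.
intros H Hv.
eapply Rle_trans.
{ assert (T := Cmod_2Rmax (Csum u)). exact T. }
assert (B : forall p : C -> R, (forall z, (Rabs (p z) <= Cmod z)%R) ->
  (Rabs (Series (fun n => p (u n))) <= Series v)%R).
{ intros p Hp. assert (He : ex_series (fun n => Rabs (p (u n)))).
  { apply ex_series_dominated with v; auto. intros n. rewrite Rabs_Rabsolu.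
    eapply Rle_trans; [apply Hp|apply H]. }
  eapply Rle_trans; [now apply Series_Rabs|]. apply Series_le; auto.
  intros n. split. apply Rabs_pos. eapply Rle_trans; [apply Hp|apply H]. }
assert (M : (Rmax (Rabs (fst (Csum u))) (Rabs (snd (Csum u))) <= Series v)%R).
{ apply Rmax_lub; simpl; apply B. apply re_le_Cmod. apply Im_le_Cmod. }
assert (P := Rle_trans _ _ _ (Rabs_pos _) (Rle_trans _ _ _ (Rmax_l _ _) M)).
assert (Q : (sqrt 2 <= 2)%R). { rewrite <- (sqrt_square 2) at 2 by lra. apply sqrt_le_1; lra. }
apply Rmult_le_compat; auto. apply sqrt_pos.
eapply Rle_trans; [apply Rabs_pos|apply Rmax_l].
Qed.

Lemma filterlim_Re (l : C) :
  filterlim Re (@locally C_UniformSpace l) (@locally R_UniformSpace (Re l)).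
Proof. destruct l as [x y]. exact (@continuous_fst R_UniformSpace R_UniformSpace x y). Qed.

Lemma filterlim_Im (l : C) :
  filterlim Im (@locally C_UniformSpace l) (@locally R_UniformSpace (Im l)).
Proof. destruct l as [x y]. exact (@continuous_snd R_UniformSpace R_UniformSpace x y). Qed.

Lemma is_series_Csum (u : nat -> C) (l : C) :
  is_series (V:=C_NormedModule) u l -> Csum u = l.
Proof.
intros H.
assert (E1 : forall n, fst (sum_n (G:=C_NormedModule) u n) = sum_n (fun k => Re (u k)) n).
{ induction n. now rewrite !sum_O. rewrite !sum_Sn. now rewrite <- IHn. }
assert (E2 : forall n, snd (sum_n (G:=C_NormedModule) u n) = sum_n (fun k => Im (u k)) n).
{ induction n. now rewrite !sum_O. rewrite !sum_Sn. now rewrite <- IHn. }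
unfold Csum. rewrite (surjective_pairing l). f_equal; apply is_series_unique.
- apply filterlim_ext with (fun n => fst (sum_n (G:=C_NormedModule) u n)); auto.
  eapply filterlim_comp. exact H.
  exact (filterlim_Re l).
- apply filterlim_ext with (fun n => snd (sum_n (G:=C_NormedModule) u n)); auto.
  eapply filterlim_comp. exact H.
  exact (filterlim_Im l).
Qed.

Definition power_sum (a : nat -> C) (z : C) : C := Csum (fun n => a n * z ^ n).

(** Radius of convergence at least 1, phrased as boundedness of the terms, a form that passes easily
    to shifted and differentiated series. *)
Definition disc_coeffs (a : nat -> C) : Prop :=
  forall r, (0 < r < 1)%R -> exists M, forall n, (Cmod (a n) * r ^ n <= M)%R.

Lemma is_pseries_power_sum (a : nat -> C) (z l : C) : is_pseries (V:=C_NormedModule) a z l -> power_sum a z = l.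
Proof.
intros H. rewrite <- (is_series_Csum _ _ H). apply Csum_ext. intros n.
exact (Cmult_comm (a n) (z ^ n)).
Qed.

(** At the real point r the real and imaginary parts of the terms form convergent series, so they
    tend to 0 and are bounded. *)
Lemma is_pseries_disc_coeffs (a : nat -> C) (f : C -> C) :
  (forall z, inD z -> is_pseries (V:=C_NormedModule) a z (f z)) -> disc_coeffs a.
Proof.
intros H r Hr.
assert (Hz : inD (RtoC r)) by (unfold inD; rewrite Cmod_R, Rabs_pos_eq; lra).
specialize (H _ Hz).
assert (L : forall p : C -> R, (forall n, p (sum_n (G:=C_NormedModule) (fun k => scal (pow_n (RtoC r) k) (a k)) n)
   = sum_n (fun k => p (scal (pow_n (RtoC r) k) (a k))) n) ->
   filterlim p (locally (f (RtoC r))) (locally (p (f (RtoC r)))) ->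
   exists M, forall n, (Rabs (p (RtoC r ^ n * a n)%C) <= M)%R).
{ intros p Hp Hf.
  assert (Hs : ex_series (fun k => p (scal (pow_n (RtoC r) k) (a k)))).
  { exists (p (f (RtoC r))). eapply filterlim_ext. exact Hp. eapply filterlim_comp. exact H. exact Hf. }
  apply ex_series_lim_0 in Hs.
  destruct (filterlim_bounded (K:=R_AbsRing) (V:=R_NormedModule) (fun k => p (scal (pow_n (RtoC r) k) (a k)))) as [M HM].
  { exists 0%R. exact Hs. }
  exists M. intros n. exact (HM n). }
destruct (L Re) as [M1 H1].
{ induction n. now rewrite !sum_O. rewrite !sum_Sn. now rewrite <- IHn. }
{ apply filterlim_Re. }
destruct (L Im) as [M2 H2].
{ induction n. now rewrite !sum_O. rewrite !sum_Sn. now rewrite <- IHn. }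
{ apply filterlim_Im. }
exists (2 * Rmax M1 M2)%R. intros n.
replace (Cmod (a n) * r ^ n)%R with (Cmod (RtoC r ^ n * a n)).
2:{ rewrite Cmod_mult, Cmod_pow, Cmod_R, Rabs_pos_eq by lra. ring. }
eapply Rle_trans; [apply Cmod_2Rmax|].
assert (Q : (sqrt 2 <= 2)%R). { rewrite <- (sqrt_square 2) at 2 by lra. apply sqrt_le_1; lra. }
apply Rmult_le_compat; auto. apply sqrt_pos. eapply Rle_trans; [apply Rabs_pos|apply Rmax_l].
specialize (H1 n). specialize (H2 n).
apply Rmax_lub; [eapply Rle_trans; [exact H1|apply Rmax_l] | eapply Rle_trans; [exact H2|apply Rmax_r]].
Qed.

Lemma disc_coeffs_shift a : disc_coeffs a -> disc_coeffs (fun n => a (S n)).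
Proof.
intros H r Hr. destruct (H r Hr) as [M HM]. exists (M / r)%R. intros n.
apply (Rle_div_r _ _ r ltac:(lra)). eapply Rle_trans; [|exact (HM (S n))]. right; simpl; ring.
Qed.

(** Bernoulli's inequality for 1/q = 1 + x gives n x q^n <= 1. *)
Lemma linear_geometric_bound q : (0 < q < 1)%R -> exists K, forall n, (INR n * q ^ n <= K)%R.
Proof.
intros Hq. set (x := (/ q - 1)%R).
assert (Hx : (0 < x)%R). { unfold x. assert (1 < / q)%R; [|lra]. rewrite <- Rinv_1. apply Rinv_lt_contravar; lra. }
exists (/ x)%R. intros n.
assert (T : (1 + INR n * x <= (1 + x) ^ n)%R) by (now apply poly).
replace (1 + x)%R with (/ q)%R in T by (unfold x; ring). rewrite pow_inv in T.
assert (P : (0 < q ^ n)%R) by (apply pow_lt; lra).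
assert (T2 : ((1 + INR n * x) * q ^ n <= 1)%R).
{ apply Rle_trans with (/ q ^ n * q ^ n)%R. apply Rmult_le_compat_r; lra. right; field; lra. }
apply Rmult_le_reg_l with x; auto. rewrite Rinv_r by lra. nra.
Qed.

Lemma pow_ratio (r s : R) n : (0 < s)%R -> ((r / s) ^ n * s ^ n = r ^ n)%R.
Proof. intros Hs. rewrite <- Rpow_mult_distr. f_equal. field. lra. Qed.

Lemma disc_coeffs_INR a : disc_coeffs a -> disc_coeffs (fun n => RtoC (INR n) * a n).
Proof.
intros H r Hr. set (r' := ((r + 1) / 2)%R).
destruct (H r') as [M HM]. unfold r'; lra.
assert (Hq : (0 < r / r' < 1)%R).
{ split. apply Rdiv_lt_0_compat; unfold r'; lra. apply Rlt_div_l; unfold r'; lra. }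
destruct (linear_geometric_bound (r / r') Hq) as [K HK].
exists (K * M)%R. intros n. rewrite Cmod_mult, Cmod_R, Rabs_pos_eq by apply pos_INR.
replace (INR n * Cmod (a n) * r ^ n)%R with ((INR n * (r / r') ^ n) * (Cmod (a n) * r' ^ n))%R.
- apply Rmult_le_compat; auto.
  apply Rmult_le_pos. apply pos_INR. apply pow_le. lra.
  apply Rmult_le_pos. apply Cmod_ge_0. apply pow_le. unfold r'; lra.
- rewrite <- (pow_ratio r r' n) by (unfold r'; lra). ring.
Qed.

Lemma disc_coeffs_summable a r : disc_coeffs a -> (0 <= r < 1)%R ->
  ex_series (fun n => Cmod (a n) * r ^ n)%R.
Proof.
intros H Hr. set (r' := ((r + 1) / 2)%R).
destruct (H r') as [M HM]. unfold r'; lra.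
assert (Hq : (0 <= r / r' < 1)%R).
{ split. apply Rdiv_le_0_compat; unfold r'; lra. apply Rlt_div_l; unfold r'; lra. }
apply ex_series_dominated with (fun n => M * (r / r') ^ n)%R.
- intros n. rewrite Rabs_pos_eq.
  2:{ apply Rmult_le_pos. apply Cmod_ge_0. apply pow_le; lra. }
  replace (Cmod (a n) * r ^ n)%R with ((Cmod (a n) * r' ^ n) * (r / r') ^ n)%R.
  + apply Rmult_le_compat_r; auto. apply pow_le; lra.
  + rewrite <- (pow_ratio r r' n) by (unfold r'; lra). ring.
- apply (ex_series_scal (K:=R_AbsRing) (V:=R_NormedModule)). apply ex_series_geom.
  rewrite Rabs_pos_eq; lra.
Qed.

Lemma power_summable a z : disc_coeffs a -> inD z -> abs_summable (fun n => a n * z ^ n).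
Proof.
intros H Hz. unfold abs_summable. eapply ex_series_ext.
2: apply (disc_coeffs_summable a (Cmod z) H). 2: split; [apply Cmod_ge_0|exact Hz].
intros n. simpl. rewrite Cmod_mult, Cmod_pow. reflexivity.
Qed.

Definition derive_coeffs (a : nat -> C) (n : nat) : C := RtoC (INR (S n)) * a (S n).

Lemma disc_coeffs_derive a : disc_coeffs a -> disc_coeffs (derive_coeffs a).
Proof.
intros H. apply (disc_coeffs_shift (fun n => RtoC (INR n) * a n)). now apply disc_coeffs_INR.
Qed.

(** The factor r^2 on the left avoids the exponent n - 2 in natural numbers. The remainders E_n
    satisfy E_{n+1} = y E_n + n z^(n-1) (y - z)^2, which drives the induction. *)
Lemma power_remainder (y z : C) (r : R) n : (0 < r)%R -> (Cmod y <= r)%R -> (Cmod z <= r)%R ->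
  (r * r * Cmod (y ^ n - z ^ n - RtoC (INR n) * z ^ (pred n) * (y - z)) <=
   INR n * INR n * r ^ n * (Cmod (y - z) * Cmod (y - z)))%R.
Proof.
intros Hr Hy Hz. induction n as [|n IH].
- simpl. replace (1 - 1 - RtoC 0 * 1 * (y - z)) with (RtoC 0) by ring. rewrite Cmod_0. lra.
- set (d := (Cmod (y - z) * Cmod (y - z))%R) in *.
  assert (Hd : (0 <= d)%R) by (apply Rmult_le_pos; apply Cmod_ge_0).
  set (E := y ^ n - z ^ n - RtoC (INR n) * z ^ pred n * (y - z)) in *.
  assert (EE : y ^ S n - z ^ S n - RtoC (INR (S n)) * z ^ pred (S n) * (y - z) =
     y * E + RtoC (INR n) * z ^ pred n * ((y - z) * (y - z))).
  { rewrite S_INR, RtoC_plus, !Cpow_S. unfold E. simpl pred. destruct n as [|n].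
    - simpl. ring.
    - simpl pred. rewrite !Cpow_S. ring. }
  rewrite EE.
  assert (H1 : (Cmod (y * E) <= r * Cmod E)%R).
  { rewrite Cmod_mult. apply Rmult_le_compat_r; auto. apply Cmod_ge_0. }
  assert (H2 : (r * Cmod (RtoC (INR n) * z ^ pred n * ((y - z) * (y - z))) <= INR n * r ^ n * d)%R).
  { rewrite !Cmod_mult, Cmod_pow, Cmod_R, Rabs_pos_eq by apply pos_INR. fold d.
    destruct n as [|n]. simpl; lra. simpl pred.
    replace (r * (INR (S n) * Cmod z ^ n * d))%R with (INR (S n) * (r * Cmod z ^ n) * d)%R by ring.
    simpl (r ^ S n)%R. apply Rmult_le_compat_r; auto. apply Rmult_le_compat_l. apply pos_INR.
    apply Rmult_le_compat_l. lra. apply pow_incr. split; auto. apply Cmod_ge_0. }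
  assert (T := Cmod_triangle (y * E) (RtoC (INR n) * z ^ pred n * ((y - z) * (y - z)))).
  set (X := Cmod (y * E + RtoC (INR n) * z ^ pred n * ((y - z) * (y - z)))) in *.
  set (Y := Cmod (RtoC (INR n) * z ^ pred n * ((y - z) * (y - z)))) in *.
  assert (Q : (0 <= INR n * r ^ n * d)%R).
  { apply Rmult_le_pos; auto. apply Rmult_le_pos. apply pos_INR. apply pow_le; lra. }
  rewrite S_INR. simpl (r ^ S n)%R.
  apply Rle_trans with (r * (r * r * Cmod E) + r * (r * Y))%R.
  { replace (r * (r * r * Cmod E) + r * (r * Y))%R with (r * r * (r * Cmod E + Y))%R by ring.
    apply Rmult_le_compat_l. nra. lra. }
  apply Rle_trans with (r * (INR n * INR n * r ^ n * d) + r * (INR n * r ^ n * d))%R.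
  { apply Rplus_le_compat; apply Rmult_le_compat_l; lra. }
  assert (P := pos_INR n). assert (Q' : (0 <= r ^ n * d)%R) by (apply Rmult_le_pos; auto; apply pow_le; lra).
  assert (0 <= r * (r ^ n * d))%R by (apply Rmult_le_pos; lra). nra.
Qed.

(** Termwise: the remainder of the n-th monomial is at most n^2 r^n |y - z|^2 / r^2, and the series
    of n^2 |a n| r^n converges, with sum [K]. *)
Lemma is_derive_power_sum a z : disc_coeffs a -> inD z ->
  is_derive (power_sum a) z (power_sum (derive_coeffs a) z).
Proof.
intros Ha Hz. unfold inD in Hz. apply is_derive_C_eps. intros e He.
set (r := ((1 + Cmod z) / 2)%R). assert (P := Cmod_ge_0 z).
assert (Hr : (0 < r < 1)%R) by (unfold r; lra).
set (b := fun n => RtoC (INR n) * (RtoC (INR n) * a n)).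
assert (Hb : disc_coeffs b) by (apply disc_coeffs_INR; now apply disc_coeffs_INR).
assert (Sb := disc_coeffs_summable b r Hb ltac:(lra)).
set (K := Series (fun n => Cmod (b n) * r ^ n)%R) in *.
(* Read off from [Cmod_Csum] applied to the zero sequence. *)
assert (HK : (0 <= K)%R).
{ assert (T := Cmod_Csum (fun _ => RtoC 0) _ (fun n => eq_ind_r (fun x => (x <= Cmod (b n) * r ^ n)%R)
    (Rmult_le_pos _ _ (Cmod_ge_0 _) (pow_le r n (Rlt_le _ _ (proj1 Hr)))) Cmod_0) Sb).
  fold K in T. assert (T' := Cmod_ge_0 (Csum (fun _ => RtoC 0))). lra. }
set (d := (Rmin (r - Cmod z) (e * (r * r) / (2 * (K + 1))))%R).
exists d.
assert (T1 := Rmin_l (r - Cmod z) (e * (r * r) / (2 * (K + 1)))).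
assert (T2 := Rmin_r (r - Cmod z) (e * (r * r) / (2 * (K + 1)))). fold d in T1, T2.
split. { apply Rmin_pos. unfold r; lra. apply Rdiv_lt_0_compat. repeat apply Rmult_lt_0_compat; lra. lra. }
intros y Hy.
assert (Hyr : (Cmod y <= r)%R) by (assert (T := Cmod_triangle_rev y z); lra).
assert (Hyd : inD y) by (unfold inD; lra).
(* The derivative series with its vanishing term at n = 0 kept, so that it lines up index by index
   with the series at y and z. *)
set (c := fun n => a n * (RtoC (INR n) * z ^ pred n)).
assert (Ec : forall n, c (S n) = derive_coeffs a n * z ^ n).
{ intros n. unfold c, derive_coeffs. simpl pred. ring. }
assert (Sc : abs_summable c).
{ apply ex_series_incr_1. eapply ex_series_ext.
  2: apply (power_summable (derive_coeffs a) z); auto; now apply disc_coeffs_derive.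
  intros n. simpl. now rewrite Ec. }
assert (E1 : power_sum (derive_coeffs a) z = Csum c).
{ rewrite (Csum_incr c) by auto. unfold power_sum.
  rewrite (Csum_ext (fun n => c (S n)) (fun n => derive_coeffs a n * z ^ n)) by auto.
  unfold c at 1. simpl. ring. }
assert (E2 : power_sum a y - power_sum a z - power_sum (derive_coeffs a) z * (y - z) =
  Csum (fun n => (a n * y ^ n - a n * z ^ n) - (y - z) * c n)).
{ rewrite E1. rewrite Csum_minus, Csum_minus, Csum_scal; auto using power_summable, abs_summable_minus, abs_summable_scal.
  unfold power_sum. ring. }
rewrite E2.
set (D := Cmod (y - z)) in *. assert (HD := Cmod_ge_0 (y - z)). fold D in HD.
apply Rle_trans with (2 * Series (fun n => (D * D / (r * r)) * (Cmod (b n) * r ^ n)))%R.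
- apply Cmod_Csum.
  + intros n.
    replace (a n * y ^ n - a n * z ^ n - (y - z) * c n) with
      (a n * (y ^ n - z ^ n - RtoC (INR n) * z ^ pred n * (y - z))) by (unfold c; ring).
    unfold b. rewrite !Cmod_mult, !Cmod_R, !Rabs_pos_eq by apply pos_INR.
    assert (Q := power_remainder y z r n ltac:(lra) Hyr ltac:(unfold r; lra)). fold D in Q.
    set (X := Cmod (y ^ n - z ^ n - RtoC (INR n) * z ^ pred n * (y - z))) in *.
    replace (D * D / (r * r) * (INR n * (INR n * Cmod (a n)) * r ^ n))%R
      with (Cmod (a n) * ((INR n * INR n * r ^ n * (D * D)) / (r * r)))%R by (field; lra).
    apply Rmult_le_compat_l. apply Cmod_ge_0. apply Rle_div_r. nra. lra.
  + now apply (ex_series_scal (K:=R_AbsRing) (V:=R_NormedModule)).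
- rewrite Series_scal_l. fold K.
  apply Rle_trans with (2 * (D * (e * (r * r) / (2 * (K + 1))) / (r * r) * K))%R.
  { apply Rmult_le_compat_l. lra. apply Rmult_le_compat_r; auto. unfold Rdiv at 1 3.
    apply Rmult_le_compat_r. left; apply Rinv_0_lt_compat; nra. apply Rmult_le_compat_l; lra. }
  replace (2 * (D * (e * (r * r) / (2 * (K + 1))) / (r * r) * K))%R with (e * D * (K / (K + 1)))%R by (field; lra).
  rewrite <- (Rmult_1_r (e * D)) at 2. apply Rmult_le_compat_l. nra.
  apply Rle_div_l; lra.
Qed.

Lemma hol_power_sum n a : disc_coeffs a -> hol n inD (power_sum a).
Proof.
revert a; induction n as [|n IH]; intros a Ha.
- intros z Hz. eapply is_derive_Ccont. now apply is_derive_power_sum.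
- exists (power_sum (derive_coeffs a)). split.
  + intros z Hz. now apply is_derive_power_sum.
  + apply IH. now apply disc_coeffs_derive.
Qed.

Lemma power_sum_shift a z : disc_coeffs a -> inD z ->
  power_sum a z = a 0%nat + z * power_sum (fun n => a (S n)) z.
Proof.
intros Ha Hz. unfold power_sum. rewrite Csum_incr by now apply power_summable.
rewrite <- Csum_scal. 2: now apply (power_summable (fun n => a (S n)) z), Hz; apply disc_coeffs_shift.
f_equal. simpl; ring. apply Csum_ext. intros n. rewrite Cpow_S. ring.
Qed.

Lemma power_sum_0 a : disc_coeffs a -> power_sum a (RtoC 0) = a 0%nat.
Proof.
intros Ha. rewrite power_sum_shift; auto. ring. unfold inD. rewrite Cmod_0. lra.
Qed.

(** * Close-to-convex and convex functions *)

Lemma analytic_on_D_derivative (f : C -> C) : analytic_on_D f ->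
  exists f' : C -> C, forall z, inD z -> is_derive f z (f' z).
Proof.
intros H. exists (Cderiv f). intros z Hz. unfold Cderiv.
destruct excluded_middle_informative as [E|E].
- exact (proj2_sig (constructive_indefinite_description _ E)).
- exfalso. exact (E (H z Hz)).
Qed.

(* Noshiro-Warschawski: f o g^-1 has derivative f'/g' of positive real part on the convex domain g(D). *)
Lemma close_to_convex_univalent (f : C -> C) : classCC f -> univalent_on_D f.
Proof.
intros [[Hf _] [g [[Hg [Hinj Hconv]] Hre]]] z1 z2 Hz1 Hz2 Ef.
destruct (analytic_on_D_derivative f Hf) as [f' Hf'].
destruct (analytic_on_D_derivative g Hg) as [g' Hg'].
apply Hinj; auto. apply NNPP. intros Hne.
set (D := g z2 - g z1).
assert (HD : D <> RtoC 0).
{ intros E. apply Hne. replace (g z2) with (D + g z1) by (unfold D; ring). rewrite E; ring. }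
(* [Cinv] sends 0 to 0, so a zero of g' would give the quotient real part 0, against [Hre]. *)
assert (Hne0 : forall z, inD z -> g' z <> RtoC 0).
{ intros z Hz E. specialize (Hre z _ _ Hz (Hf' z Hz) (Hg' z Hz)). rewrite E in Hre.
  unfold Cdiv, Cinv in Hre. simpl in Hre.
  replace (0 / (0 * (0 * 1) + 0 * (0 * 1)))%R with 0%R in Hre by (unfold Rdiv; ring).
  replace (- 0 / (0 * (0 * 1) + 0 * (0 * 1)))%R with 0%R in Hre by (unfold Rdiv; ring). lra. }
set (x := fun t => inverse_on 1 g (g z1 + RtoC t * D)).
assert (Hx : forall t, (0 <= t <= 1)%R -> inD (x t) /\ g (x t) = g z1 + RtoC t * D).
{ intros t Ht. apply (inverse_on_spec 1 g).
  destruct (Hconv z1 z2 t Hz1 Hz2 Ht) as [z3 [H1 H2]]. exists z3. split. exact H1.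
  rewrite H2. unfold D. ring. }
(* Projection on the direction D makes the mean value theorem available: along the segment the
   derivative is |D|^2 Re (f'/g') > 0, so f z1 and f z2 differ. *)
set (phi := fun t => Re (Cconj D * f (x t))).
assert (Hphi : forall t, (0 <= t <= 1)%R ->
  is_derive phi t (Cmod D * Cmod D * Re (f' (x t) / g' (x t)))%R).
{ intros t Ht. destruct (Hx t Ht) as [H1 H2].
  replace (Cmod D * Cmod D * Re (f' (x t) / g' (x t)))%R with
    (Re (Cconj D * (f' (x t) / g' (x t)) * D)).
  - apply curve_derive_Re. unfold x.
    apply (segment_derive (fun y => Cconj D * f (inverse_on 1 g y)) (g z1) (g z2)). fold D.
    eapply is_derive_C_eq. apply is_derive_C_mult. apply is_derive_C_const.
    rewrite <- H2. apply (is_derive_inverse_on f g g' 1); auto.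
    cbv beta. fold (x t). ring.
  - rewrite <- Re_conj_self. destruct D as [d1 d2], (f' (x t) / g' (x t)); simpl; ring. }
destruct (MVT_gen phi 0 1 (fun t => Cmod D * Cmod D * Re (f' (x t) / g' (x t)))%R) as [c [Hc HM]].
- intros t Ht. rewrite Rmin_left, Rmax_right in Ht by lra. apply Hphi. lra.
- intros t Ht. rewrite Rmin_left, Rmax_right in Ht by lra.
  apply continuity_pt_filterlim. apply (ex_derive_continuous (K:=R_AbsRing) (V:=R_NormedModule)).
  eexists. apply Hphi. lra.
- rewrite Rmin_left, Rmax_right in Hc by lra.
  assert (E0 : x 0%R = z1).
  { unfold x. replace (g z1 + RtoC 0 * D) with (g z1) by ring. now apply inverse_on_eq. }
  assert (E1 : x 1%R = z2).
  { unfold x. replace (g z1 + RtoC 1 * D) with (g z2) by (unfold D; ring). now apply inverse_on_eq. }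
  unfold phi in HM. rewrite E0, E1, Ef in HM.
  destruct (Hx c Hc) as [Hc1 _].
  assert (Q := Hre _ _ _ Hc1 (Hf' _ Hc1) (Hg' _ Hc1)).
  assert (P := proj1 (Cmod_gt_0 _) HD).
  assert (0 < Cmod D * Cmod D * Re (f' (x c) / g' (x c)))%R by (repeat apply Rmult_lt_0_compat; auto).
  lra.
Qed.

Definition shift (a : nat -> C) (n : nat) : C := a (S n).

Lemma inD_0 : inD (RtoC 0).
Proof. unfold inD. rewrite Cmod_0. lra. Qed.

Lemma inD_opp z : inD z -> inD (- z).
Proof. unfold inD. now rewrite Cmod_opp. Qed.

Lemma is_derive_power_series (a : nat -> C) (f : C -> C) : disc_coeffs a ->
  (forall z, inD z -> f z = power_sum a z) ->
  forall z, inD z -> is_derive f z (power_sum (derive_coeffs a) z).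
Proof.
intros Ha Hf z Hz. apply is_derive_C_ext with (f := power_sum a) (d := (1 - Cmod z)%R).
- unfold inD in Hz. lra.
- intros y Hy. symmetry. apply Hf. unfold inD in *. assert (T := Cmod_near y z). lra.
- now apply is_derive_power_sum.
Qed.

(** The shifted series is f(z)/z. A zero of it at z would give f(z) = 0 = f(0), hence z = 0, where
    its value is a_1 = 1. *)
Lemma univalent_quotient_neq_0 (a : nat -> C) (f : C -> C) : disc_coeffs a ->
  a 0%nat = RtoC 0 -> a 1%nat = RtoC 1 -> (forall z, inD z -> f z = power_sum a z) ->
  univalent_on_D f -> forall z, inD z -> power_sum (shift a) z <> RtoC 0.
Proof.
intros Ha H0 H1 Hf Hu z Hz E.
assert (Hz0 : z = RtoC 0).
{ apply Hu; auto using inD_0. rewrite !Hf, power_sum_0, H0 by auto using inD_0.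
  rewrite power_sum_shift, H0 by auto. fold (shift a). rewrite E. ring. }
subst z. rewrite power_sum_0 in E by now apply disc_coeffs_shift.
unfold shift in E. rewrite H1 in E. apply RtoC_inj in E. lra.
Qed.

(* The midpoint of f(z) and f(-z) is f(w(z)) with w = a_2 z^2 + ... mapping D into D,
   so |a_2| <= 1 by the mean value property of w(z) / z^2. *)
Lemma convex_second_coeff (a : nat -> C) (f : C -> C) : disc_coeffs a ->
  a 0%nat = RtoC 0 -> a 1%nat = RtoC 1 -> (forall z, inD z -> f z = power_sum a z) ->
  univalent_on_D f -> convex_image f -> (Cmod (a 2%nat) <= 1)%R.
Proof.
intros Ha H0 H1 Hf Hu Hconv.
set (f' := power_sum (derive_coeffs a)).
assert (Hd : forall z, inD z -> is_derive f z (f' z)) by now apply is_derive_power_series.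
assert (Hc : forall z, inD z -> Ccont f' z).
{ apply (hol_power_sum 0). now apply disc_coeffs_derive. }
assert (Hne : forall z, inD z -> f' z <> RtoC 0).
{ apply (injective_derive_neq_0 f f' 1); auto. unfold f'.
  rewrite power_sum_0 by now apply disc_coeffs_derive.
  unfold derive_coeffs. rewrite H1. simpl. intros E.
  replace (RtoC 1 * RtoC 1) with (RtoC 1) in E by ring. apply RtoC_inj in E. lra. }
set (half := RtoC (1 / 2)).
assert (Eh : half + half = RtoC 1) by (unfold half; rewrite <- RtoC_plus; f_equal; lra).
set (mid := fun z => half * (f z + f (- z))).
set (w := fun z => inverse_on 1 f (mid z)).
assert (Hw : forall z, inD z -> inD (w z) /\ f (w z) = mid z).
{ intros z Hz. apply (inverse_on_spec 1 f).
  destruct (Hconv z (- z) (1 / 2)%R Hz (inD_opp z Hz) ltac:(lra)) as [x [Hx1 Hx2]].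
  exists x. split. exact Hx1. rewrite Hx2. fold half. rewrite <- Eh. unfold mid. ring. }
assert (Hopp : forall n g, hol n inD g -> hol n inD (fun z => g (- z))).
{ intros n g Hg. apply (hol_comp n inD inD g (fun z => - z)); auto using inD_opp.
  apply hol_opp, hol_id. }
assert (Hf1 : hol 1 inD f) by now apply hol1_intro with f'.
assert (Hmid : hol 1 inD mid).
{ apply hol_mult. apply hol_const. apply hol_plus; auto. }
(* Continuity of [w] comes first, because the continuity of its derivative m'/f'(w) depends on
   it. *)
assert (Hw0 : hol 0 inD w /\ hol 1 inD w).
{ destruct Hmid as [m' [Hm Hm']].
  assert (Hwd : forall z, inD z -> is_derive w z (RtoC 1 / f' (w z) * m' z)).
  { intros z Hz. unfold w. apply (is_derive_C_comp (inverse_on 1 f) mid); auto.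
    destruct (Hw z Hz) as [W1 W2]. fold (w z). rewrite <- W2.
    apply (is_derive_inverse_on (fun x => x) f f' 1); auto. apply is_derive_C_id. }
  assert (Hwc : hol 0 inD w) by (intros z Hz; eapply is_derive_Ccont; now apply Hwd).
  split; auto. exists (fun z => RtoC 1 / f' (w z) * m' z). split; auto.
  apply (hol_mult 0); auto. apply (hol_div 0).
  - intros z Hz. apply Hne. now apply Hw.
  - apply (hol_const 0).
  - apply (hol_comp 0 inD inD f' w); auto. intros z Hz. now apply Hw. }
destruct Hw0 as [_ Hw1].
assert (Ha1 : disc_coeffs (shift a)) by now apply disc_coeffs_shift.
assert (Ha2 : disc_coeffs (shift (shift a))) by now apply disc_coeffs_shift.
assert (Hk := univalent_quotient_neq_0 a f Ha H0 H1 Hf Hu).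
set (k1 := power_sum (shift a)) in *. set (k2 := power_sum (shift (shift a))).
assert (Ek1 : forall z, inD z -> f z = z * k1 z).
{ intros z Hz. rewrite Hf, power_sum_shift, H0 by auto. fold (shift a). fold k1. ring. }
assert (Ek2 : forall z, inD z -> k1 z = RtoC 1 + z * k2 z).
{ intros z Hz. unfold k1. rewrite power_sum_shift by auto. unfold shift at 1. rewrite H1. reflexivity. }
(* This is conj(a_2) w(z)/z^2 without division by z, from w k1(w) = z^2 (k2(z) + k2(-z))/2. The
   factor conj(a_2) makes the value at 0 equal to |a_2|^2, so that real parts of means suffice. *)
set (q := fun z => Cconj (a 2%nat) * (half * (k2 z + k2 (- z)) / k1 (w z))).
assert (Hq : hol 1 inD q).
{ apply hol_mult. apply hol_const. apply hol_div.
  - intros z Hz. apply Hk. now apply Hw.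
  - apply hol_mult. apply hol_const.
    apply hol_plus; [|apply Hopp]; now apply hol_power_sum.
  - apply (hol_comp 1 inD inD k1 w); auto. intros z Hz; now apply Hw. now apply hol_power_sum. }
assert (Eq : forall z, inD z -> q z * (z * z) = Cconj (a 2%nat) * w z).
{ intros z Hz. destruct (Hw z Hz) as [W1 W2]. assert (K := Hk _ W1).
  assert (W3 : w z * k1 (w z) = half * (z * (RtoC 1 + z * k2 z) + - z * (RtoC 1 + - z * k2 (- z)))).
  { rewrite <- Ek1, W2 by auto. unfold mid. rewrite (Ek1 z), (Ek1 (- z)), (Ek2 z), (Ek2 (- z)); auto using inD_opp. }
  transitivity (Cconj (a 2%nat) * ((w z * k1 (w z)) / k1 (w z))).
  - rewrite W3. unfold q. field. exact K.
  - field. exact K. }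
assert (Eq0 : q (RtoC 0) = Cconj (a 2%nat) * a 2%nat).
{ assert (W0 : w (RtoC 0) = RtoC 0).
  { destruct (Hw _ inD_0) as [W1 W2]. apply Hu; auto using inD_0. rewrite W2. unfold mid.
    replace (- RtoC 0) with (RtoC 0) by ring. rewrite Hf, power_sum_0, H0 by auto using inD_0. ring. }
  unfold q. rewrite W0. replace (- RtoC 0) with (RtoC 0) by ring.
  rewrite Ek2 by apply inD_0. unfold k2. rewrite power_sum_0 by auto. unfold shift.
  replace (half * (a 2%nat + a 2%nat)) with ((half + half) * a 2%nat) by ring. rewrite Eh.
  replace (RtoC 1 + RtoC 0 * a 2%nat) with (RtoC 1) by ring. field. }
set (A := Cmod (a 2%nat)). assert (PA := Cmod_ge_0 (a 2%nat)). fold A in PA.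
assert (HB : forall r, (0 < r < 1)%R -> (A * A <= A / (r * r))%R).
{ intros r Hr. assert (Hm := circle_int_mean q 1 r Hq Hr).
  rewrite Eq0, Re_conj_self in Hm. fold A in Hm.
  assert (T := TwoPI_pos).
  assert (Hle : (circle_int q r <= 2 * PI * (A / (r * r)))%R).
  { rewrite <- period_int_const. apply period_int_le.
    - apply Ccont_circ_Re. intros t. apply (hol_cont _ _ _ Hq). unfold inD. rewrite Cmod_circ; lra.
    - apply continuity_cst.
    - intros t. eapply Rle_trans; [apply Re_le_Cmod|].
      assert (Hcr : Cmod (circ r t) = r) by (apply Cmod_circ; lra).
      assert (Hin : inD (circ r t)) by (unfold inD; lra).
      apply (Rle_div_r _ _ (r * r)); [nra|].
      rewrite <- Hcr at 2 3. rewrite <- !Cmod_mult. rewrite Eq by auto.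
      rewrite Cmod_mult, Cmod_conj. fold A.
      rewrite <- (Rmult_1_r A) at 2. apply Rmult_le_compat_l; auto.
      destruct (Hw _ Hin) as [W _]. unfold inD in W. lra. }
  rewrite Hm in Hle. nra. }
apply Rnot_lt_le. intros Hgt.
(* For A > 1 this radius is below 1, yet A r^2 = (A + 2 + 1/A)/4 exceeds 1. *)
set (r := ((1 + / A) / 2)%R).
assert (Hi : (/ A < 1)%R) by (rewrite <- Rinv_1; apply Rinv_lt_contravar; lra).
assert (Pi : (0 < / A)%R) by (apply Rinv_0_lt_compat; lra).
assert (E : (A * / A = 1)%R) by (field; lra).
assert (Hr : (0 < r < 1)%R) by (unfold r; lra).
specialize (HB r Hr). apply (Rle_div_r _ _ (r * r)) in HB; [|nra].
assert (A * (r * r) <= 1)%R by nra.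
assert (E2 : (A * (r * r) = (A + 2 + / A) / 4)%R) by (unfold r; field; lra).
nra.
Qed.

(** * Fourier coefficients of log|q|^2 and positive definite kernels *)

Definition cis (x : R) : C := (cos x, sin x).

(** This is log|z|^2, free of square roots so that it can be differentiated along curves. *)
Definition lnsq (z : C) : R := ln (Re z ^ 2 + Im z ^ 2).

Lemma normsq_pos (z : C) : z <> RtoC 0 -> (0 < Re z ^ 2 + Im z ^ 2)%R.
Proof. intros H. rewrite <- Cmod2_alt. apply pow_lt. now apply Cmod_gt_0. Qed.

Lemma is_derive_ln_sum_squares (u w : R -> R) t du dw :
  is_derive u t du -> is_derive w t dw -> (0 < u t ^ 2 + w t ^ 2)%R ->
  is_derive (fun x => ln (u x ^ 2 + w x ^ 2)) t
    (2 * (u t * du + w t * dw) / (u t ^ 2 + w t ^ 2))%R.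
Proof.
intros H1 H2 P. auto_derive.
- repeat split; auto. eexists; exact H1. eexists; exact H2.
- change (fun x => u x) with u. change (fun x => w x) with w.
  rewrite (is_derive_unique _ _ _ H1), (is_derive_unique _ _ _ H2). field. lra.
Qed.

Lemma curve_derive_lnsq g t l : curve_derive g t l -> g t <> RtoC 0 ->
  is_derive (fun u => lnsq (g u)) t (2 * Re (l / g t))%R.
Proof.
intros Hg H0. assert (P := normsq_pos _ H0).
assert (H1 := curve_derive_Re _ _ _ Hg).
assert (H2 : is_derive (fun u => Im (g u)) t (Im l)).
{ assert (H := curve_derive_Re (fun u => - Ci * g u) t (- Ci * l)).
  rewrite <- Im_Re in H. eapply is_derive_ext; [|apply H].
  intros u. simpl. symmetry. apply Im_Re.
  apply (curve_derive_comp (fun z => - Ci * z) g); auto.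
  eapply is_derive_C_eq. apply is_derive_C_mult. apply is_derive_C_const. apply is_derive_C_id.
  cbv beta; ring. }
assert (HL := is_derive_ln_sum_squares _ _ _ _ _ H1 H2 P).
replace (2 * Re (l / g t))%R with
  (2 * (Re (g t) * Re l + Im (g t) * Im l) / (Re (g t) ^ 2 + Im (g t) ^ 2))%R.
exact HL. destruct (g t) as [a b], l as [x y]. simpl in *. field. lra.
Qed.

(** No branch of log q is chosen. Integration by parts moves the derivative onto [lnsq], giving 2 Re
    (i z q'/q); its product with sin (t + alpha) is a difference of real parts of holomorphic
    functions, whose means are read off at 0. *)
Lemma log_fourier_coeff (q q' : C -> C) (b r alpha : R) :
  (forall z, open_disc b z -> is_derive q z (q' z)) -> hol 1 (open_disc b) q' ->
  (forall z, open_disc b z -> q z <> RtoC 0) -> (0 < r < b)%R ->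
  period_int (fun t => cos (t + alpha) * lnsq (q (circ r t)))%R =
  (2 * PI * Re (RtoC r * cis (- alpha) * (q' (RtoC 0) / q (RtoC 0))))%R.
Proof.
intros Hd Hq' Hne Hr.
assert (Hq : hol 1 (open_disc b) q).
{ exists q'. split; auto. intros z Hz. now apply (hol_cont _ _ _ Hq'). }
set (m := fun z => q' z / q z).
assert (Hm : hol 1 (open_disc b) m) by now apply hol_div.
set (g1 := fun z => RtoC r * cis (- alpha) * m z).
set (g2 := fun z => cis alpha / RtoC r * (z * z * m z)).
assert (Hg1 : hol 1 (open_disc b) g1) by (apply hol_mult; auto; apply hol_const).
assert (Hg2 : hol 1 (open_disc b) g2).
{ apply hol_mult. apply hol_const. apply hol_mult; auto. apply hol_mult; apply hol_id. }
assert (Hin : forall t, open_disc b (circ r t)).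
{ intros t. unfold open_disc. rewrite Cmod_circ; lra. }
assert (E1 := circle_int_mean g1 b r Hg1 Hr).
assert (E2 := circle_int_mean g2 b r Hg2 Hr).
assert (C1 : continuity (fun t => Re (g1 (circ r t)))).
{ apply Ccont_circ_Re. intros t. now apply (hol_cont _ _ _ Hg1). }
assert (C2 : continuity (fun t => Re (g2 (circ r t)))).
{ apply Ccont_circ_Re. intros t. now apply (hol_cont _ _ _ Hg2). }
assert (Hv : forall t, is_derive (fun t => lnsq (q (circ r t))) t (2 * Re (Ci * (circ r t * m (circ r t))))%R).
{ intros t. replace (Ci * (circ r t * m (circ r t))) with (q' (circ r t) * (Ci * circ r t) / q (circ r t)).
  2:{ unfold m. field. auto. }
  apply (curve_derive_lnsq (fun t => q (circ r t))); auto.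
  apply (curve_derive_comp q (circ r)). auto. apply circ_derive_angle. }
assert (Cv : continuity (fun t => cos (t + alpha) * lnsq (q (circ r t)))%R).
{ apply continuity_mult.
  - intros t. apply (continuity_pt_comp (fun t => t + alpha)%R cos).
    apply continuity_pt_plus. apply continuity_pt_id. apply continuity_cst. apply continuity_cos.
  - intros t. apply continuity_pt_filterlim.
    apply (ex_derive_continuous (K:=R_AbsRing) (V:=R_NormedModule)). eexists. apply Hv. }
assert (Hr0 : RtoC r <> RtoC 0) by (intros E; apply RtoC_inj in E; lra).
(* On |z| = r one has e^(-i(t + alpha)) z = r e^(-i alpha) and e^(i(t + alpha)) = e^(i alpha) z / r,
   so both exponential parts of the sine turn into holomorphic factors. *)
assert (Key : forall t, (2 * (sin (t + alpha) * Re (Ci * (circ r t * m (circ r t)))) =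
    Re (g2 (circ r t)) - Re (g1 (circ r t)))%R).
{ intros t. unfold g1, g2.
  assert (K1 : RtoC r * cis (- alpha) * m (circ r t) = cis (- (t + alpha)) * (circ r t * m (circ r t))).
  { rewrite !Cmult_assoc. f_equal. unfold cis, circ, RtoC, Cmult; simpl.
    rewrite !cos_neg, !sin_neg, cos_plus, sin_plus. assert (T := sin2_cos2 t). unfold Rsqr in T.
    f_equal.
    - replace (r * cos alpha - 0 * - sin alpha)%R with ((sin t * sin t + cos t * cos t) * (r * cos alpha))%R by (rewrite T; ring). ring.
    - replace (r * - sin alpha + 0 * cos alpha)%R with ((sin t * sin t + cos t * cos t) * (r * - sin alpha))%R by (rewrite T; ring). ring. }
  assert (K2 : cis alpha / RtoC r * (circ r t * circ r t * m (circ r t)) = cis (t + alpha) * (circ r t * m (circ r t))).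
  { replace (cis (t + alpha)) with (cis alpha * (circ r t / RtoC r)). field; auto.
    rewrite circ_1. fold (cis t). replace (RtoC r * cis t / RtoC r) with (cis t) by (field; auto).
    unfold cis, Cmult; simpl. rewrite cos_plus, sin_plus. f_equal; ring. }
  rewrite K1, K2. unfold cis. rewrite cos_neg, sin_neg.
  destruct (circ r t * m (circ r t)) as [x y]. unfold Ci; simpl. ring. }
assert (HI : period_int (fun t => cos (t + alpha) * lnsq (q (circ r t)) + (Re (g2 (circ r t)) - Re (g1 (circ r t))))%R = 0%R).
{ apply (period_int_derive (fun t => sin (t + alpha) * lnsq (q (circ r t)))%R).
  - intros t. rewrite <- Key.
    assert (Hs : is_derive (fun t => sin (t + alpha)) t (cos (t + alpha))).
    { auto_derive; auto; ring. }
    assert (HH := is_derive_mult (K:=R_AbsRing) _ _ t _ _ Hs (Hv t) Rmult_comm).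
    replace (cos (t + alpha) * lnsq (q (circ r t)) + 2 * (sin (t + alpha) * Re (Ci * (circ r t * m (circ r t)))))%R
     with (plus (mult (cos (t + alpha)) (lnsq (q (circ r t)))) (mult (sin (t + alpha)) (2 * Re (Ci * (circ r t * m (circ r t)))))%R).
    exact HH. unfold plus, mult; simpl. ring.
  - apply continuity_plus; auto. apply continuity_minus; auto.
  - rewrite circ_period. f_equal. rewrite Rplus_comm, sin_plus, sin_2PI, cos_2PI. rewrite Rplus_0_l; ring. }
rewrite period_int_plus, period_int_minus in HI; auto. 2: now apply continuity_minus.
unfold circle_int in E1, E2. rewrite E1, E2 in HI.
replace (Re (g2 (RtoC 0))) with 0%R in HI.
2:{ unfold g2. replace (cis alpha / RtoC r * (RtoC 0 * RtoC 0 * m (RtoC 0))) with (RtoC 0) by ring. reflexivity. }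
unfold g1, m in HI. lra.
Qed.

(** On |z| = r the real part of (zeta + z)/(zeta - z) is (|zeta|^2 - r^2)/|z - zeta|^2, and its mean
    is its value 1 at z = 0. *)
Lemma poisson_integral (zeta : C) (r : R) : (0 < r < Cmod zeta)%R ->
  period_int (fun t => / (Cmod (circ r t - zeta) ^ 2))%R = (2 * PI / (Cmod zeta ^ 2 - r ^ 2))%R.
Proof.
intros Hr. set (s := Cmod zeta) in *.
assert (Hne : forall z, open_disc s z -> zeta - z <> RtoC 0).
{ intros z Hz E. unfold open_disc in Hz. replace z with (zeta - (zeta - z)) in Hz by ring. rewrite E in Hz.
  replace (zeta - RtoC 0) with zeta in Hz by ring. unfold s in Hz. lra. }
assert (Hg : hol 1 (open_disc s) (fun z => (zeta + z) / (zeta - z))).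
{ apply hol_div; auto. apply hol_plus. apply hol_const. apply hol_id.
  apply hol_minus. apply hol_const. apply hol_id. }
assert (E := circle_int_mean _ s r Hg Hr). cbv beta in E.
replace ((zeta + RtoC 0) / (zeta - RtoC 0)) with (RtoC 1) in E.
2:{ replace (zeta + RtoC 0) with zeta by ring. replace (zeta - RtoC 0) with zeta by ring. field. apply Cmod_gt_0. fold s; lra. }
simpl (Re (RtoC 1)) in E. unfold circle_int in E.
assert (Hin : forall t, open_disc s (circ r t)).
{ intros t. unfold open_disc. rewrite Cmod_circ; lra. }
assert (Hsr : (0 < s ^ 2 - r ^ 2)%R) by nra.
rewrite (period_int_ext _ (fun t => / (s ^ 2 - r ^ 2) * Re ((zeta + circ r t) / (zeta - circ r t)))%R).
- rewrite period_int_scal, E. field; lra.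
  apply (Ccont_circ_Re (fun z => (zeta + z) / (zeta - z))). intros t. now apply (hol_cont _ _ _ Hg).
- intros t. rewrite Cmod_sub_sym. specialize (Hne _ (Hin t)).
  assert (P := normsq_pos _ Hne).
  assert (Es : (s ^ 2 = Re zeta ^ 2 + Im zeta ^ 2)%R) by apply Cmod2_alt.
  assert (Er : (r ^ 2 = Re (circ r t) ^ 2 + Im (circ r t) ^ 2)%R).
  { rewrite <- Cmod2_alt, Cmod_circ; lra. }
  rewrite Es, Er in Hsr |- *. rewrite Cmod2_alt. destruct zeta as [a b], (circ r t) as [x y].
  simpl in *. field. split; lra.
Qed.

Definition pd_form (c : R -> R) (K : R -> R -> R) : R :=
  period_int (fun x => c x * period_int (fun y => c y * K x y))%R.

Definition cont2 (K : R -> R -> R) : Prop := forall x y, continuity_2d_pt K x y.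

Lemma cont2_slice K x : cont2 K -> continuity (K x).
Proof.
intros H y e He. destruct (H x y (mkposreal e He)) as [d Hd].
exists d. split. apply cond_pos. intros v [_ Hv]. apply Hd; auto.
replace (x - x)%R with 0%R by ring. rewrite Rabs_R0. apply cond_pos.
Qed.

Lemma cont2_snd c : continuity c -> cont2 (fun _ y => c y).
Proof. intros H x y. apply (continuity_1d_2d_pt_comp c (fun _ v => v)). apply H. apply continuity_2d_pt_id2. Qed.

Lemma cont2_fst c : continuity c -> cont2 (fun x _ => c x).
Proof. intros H x y. apply (continuity_1d_2d_pt_comp c (fun u _ => u)). apply H. apply continuity_2d_pt_id1. Qed.

Lemma cont2_mult F K : cont2 F -> cont2 K -> cont2 (fun x y => F x y * K x y)%R.
Proof. intros H1 H2 x y. now apply continuity_2d_pt_mult. Qed.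

Lemma cont2_plus F K : cont2 F -> cont2 K -> cont2 (fun x y => F x y + K x y)%R.
Proof. intros H1 H2 x y. now apply continuity_2d_pt_plus. Qed.

Lemma cont2_comp (h : R -> R) K : (forall x y, continuity_pt h (K x y)) -> cont2 K -> cont2 (fun x y => h (K x y)).
Proof. intros H1 H2 x y. now apply continuity_1d_2d_pt_comp. Qed.

Lemma cont2_inner c K : continuity c -> cont2 K -> continuity (fun x => period_int (fun y => c y * K x y)%R).
Proof.
intros H1 H2. apply (period_int_param_continuity (fun x y => c y * K x y)%R).
apply cont2_mult; auto. now apply cont2_snd.
Qed.

Lemma pd_form_plus c F K : continuity c -> cont2 F -> cont2 K ->
  pd_form c (fun x y => F x y + K x y)%R = (pd_form c F + pd_form c K)%R.
Proof.
intros Hc HF HK. unfold pd_form. rewrite <- period_int_plus.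
2,3: apply continuity_mult; auto; now apply cont2_inner.
apply period_int_ext. intros x. rewrite <- Rmult_plus_distr_l. f_equal.
rewrite <- period_int_plus. 2,3: apply continuity_mult; auto; now apply cont2_slice.
apply period_int_ext. intros y. ring.
Qed.

Lemma pd_form_scal c k K : continuity c -> cont2 K ->
  pd_form c (fun x y => k * K x y)%R = (k * pd_form c K)%R.
Proof.
intros Hc HK. unfold pd_form. rewrite <- period_int_scal.
2: apply continuity_mult; auto; now apply cont2_inner.
apply period_int_ext. intros x.
rewrite (period_int_ext _ (fun y => k * (c y * K x y))%R) by (intros; ring).
rewrite period_int_scal. ring. apply continuity_mult; auto. now apply cont2_slice.
Qed.

Definition pd (K : R -> R -> R) : Prop :=
  cont2 K /\ forall c, continuity c -> (0 <= pd_form c K)%R.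

Lemma pd_one : pd (fun _ _ => 1%R).
Proof.
split. { intros x y. apply continuity_2d_pt_const. }
intros c Hc. unfold pd_form.
rewrite (period_int_ext _ (fun x => period_int c * c x)%R).
- rewrite period_int_scal by auto. nra.
- intros x. rewrite (period_int_ext (fun y => c y * 1)%R c) by (intros; ring). ring.
Qed.

Lemma pd_plus F K : pd F -> pd K -> pd (fun x y => F x y + K x y)%R.
Proof.
intros [H1 H2] [H3 H4]. split. now apply cont2_plus.
intros c Hc. rewrite pd_form_plus; auto. specialize (H2 c Hc). specialize (H4 c Hc). lra.
Qed.

Lemma pd_scal k K : (0 <= k)%R -> pd K -> pd (fun x y => k * K x y)%R.
Proof.
intros Hk [H1 H2]. split. apply cont2_mult; auto. intros x y; apply continuity_2d_pt_const.
intros c Hc. rewrite pd_form_scal; auto. apply Rmult_le_pos; auto.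
Qed.

(** The rank one case of the Schur product theorem: the factor n is absorbed into the weight c. *)
Lemma pd_weight n K : continuity n -> pd K -> pd (fun x y => (n x * n y) * K x y)%R.
Proof.
intros Hn [H1 H2]. split.
{ apply cont2_mult; auto. apply cont2_mult. now apply cont2_fst. now apply cont2_snd. }
intros c Hc. assert (Hcn : continuity (fun x => c x * n x)%R) by now apply continuity_mult.
specialize (H2 _ Hcn). unfold pd_form in *.
erewrite period_int_ext. exact H2. intros x. simpl. rewrite Rmult_assoc. f_equal.
rewrite <- period_int_scal. apply period_int_ext; intros y; ring.
apply continuity_mult; auto. now apply cont2_slice.
Qed.

(** Taylor polynomial of - ln (1 - x). Its coefficients are nonnegative, so it preserves positive
    definiteness. *)
Fixpoint log_series (N : nat) (x : R) : R :=
  match N with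
  | O => 0
  | S M => log_series M x + / INR (S M) * x ^ S M
  end.

(** The error vanishes at 0 and has derivative t^N / (1 - t), at most lambda^N / (1 - lambda) in
    modulus for |t| <= lambda. *)
Lemma log_series_error (lambda x : R) N : (0 <= lambda < 1)%R -> (Rabs x <= lambda)%R ->
  (Rabs (- ln (1 - x) - log_series N x) <= lambda ^ N / (1 - lambda))%R.
Proof.
intros Hl Hx.
assert (Hd : forall u, (u < 1)%R -> is_derive (log_series N) u ((1 - u ^ N) / (1 - u))%R).
{ intros u Hu. induction N as [|N IH].
  - simpl. replace ((1 - 1) / (1 - u))%R with 0%R by (unfold Rdiv; ring). apply (is_derive_const (K:=R_AbsRing) (V:=R_NormedModule)).
  - assert (HP : is_derive (fun x => / INR (S N) * x ^ S N)%R u (u ^ N)%R).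
    { auto_derive; auto. rewrite Rmult_1_l. change (match N with 0%nat => 1%R | S _ => (INR N + 1)%R end) with (INR (S N)).
      assert (INR (S N) <> 0)%R by (apply not_0_INR; lia). field; auto. }
    assert (HH := is_derive_plus (K:=R_AbsRing) (V:=R_NormedModule) _ _ u _ _ IH HP).
    replace ((1 - u ^ S N) / (1 - u))%R with (plus ((1 - u ^ N) / (1 - u))%R (u ^ N)%R).
    exact HH. unfold plus; simpl. field; lra. }
assert (HD : forall t, (Rabs (t - 0) <= Rabs (x - 0))%R ->
   is_derive (fun u => - ln (1 - u) - log_series N u)%R t (t ^ N / (1 - t))%R /\
   (Rabs (t ^ N / (1 - t)) <= lambda ^ N / (1 - lambda))%R).
{ intros t Ht. rewrite !Rminus_0_r in Ht. assert (Ht1 : (Rabs t <= lambda)%R) by lra.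
  assert (T := Rle_abs t). split.
  - assert (HL : is_derive (fun u => - ln (1 - u))%R t (/ (1 - t))%R).
    { auto_derive. lra. field. lra. }
    assert (HH := is_derive_minus (K:=R_AbsRing) (V:=R_NormedModule) _ _ t _ _ HL (Hd t ltac:(lra))).
    replace (t ^ N / (1 - t))%R with (minus (/ (1 - t)) ((1 - t ^ N) / (1 - t)))%R.
    exact HH. unfold minus, plus, opp; simpl. field; lra.
  - unfold Rdiv. rewrite Rabs_mult, <- RPow_abs. rewrite (Rabs_pos_eq (/ (1 - t))).
    2:{ left; apply Rinv_0_lt_compat; lra. }
    apply Rmult_le_compat. apply pow_le, Rabs_pos. left; apply Rinv_0_lt_compat; lra.
    apply pow_incr. split; auto. apply Rabs_pos. apply Rinv_le_contravar; lra. }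
assert (B := bounded_variation _ _ _ 0%R x HD).
assert (E0 : log_series N 0 = 0%R).
{ clear. induction N; simpl; auto. rewrite IHN. ring. }
rewrite !Rminus_0_r, ln_1, E0 in B.
replace (- ln (1 - x) - log_series N x - (- 0 - 0))%R with (- ln (1 - x) - log_series N x)%R in B by ring.
eapply Rle_trans; [exact B|]. rewrite <- (Rmult_1_r (_ / _)) at 2.
apply Rmult_le_compat_l; [|lra]. apply Rdiv_le_0_compat. apply pow_le; lra. lra.
Qed.

Lemma pd_form_bound c K B : continuity c -> (forall x, (Rabs (c x) <= 1)%R) -> cont2 K ->
  (forall x y, (Rabs (K x y) <= B)%R) -> (Rabs (pd_form c K) <= 2 * PI * (2 * PI * B))%R.
Proof.
intros Hc Hc1 HK HB. assert (T := TwoPI_pos).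
apply period_int_abs. apply continuity_mult; auto. now apply cont2_inner.
intros x. rewrite Rabs_mult. rewrite <- (Rmult_1_l (2 * PI * B)).
apply Rmult_le_compat; auto; try apply Rabs_pos.
apply period_int_abs. apply continuity_mult; auto. now apply cont2_slice.
intros y. rewrite Rabs_mult. rewrite <- (Rmult_1_l B).
apply Rmult_le_compat; auto; try apply Rabs_pos.
Qed.

(** The kernel - ln (1 - X) is a uniform limit of positive definite polynomials in X, and |c| <= 1
    turns the uniform error into an error of the energy. *)
Lemma pd_log (lambda : R) (X : R -> R -> R) c : (0 <= lambda < 1)%R ->
  (forall N, pd (fun x y => X x y ^ N)%R) -> (forall x y, (Rabs (X x y) <= lambda)%R) ->
  continuity c -> (forall x, (Rabs (c x) <= 1)%R) ->
  (pd_form c (fun x y => ln (1 - X x y)) <= 0)%R.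
Proof.
intros Hl Hpd HX Hc Hc1.
assert (HX1 : forall x y, (0 < 1 - X x y)%R).
{ intros x y. specialize (HX x y). assert (T := Rle_abs (X x y)). lra. }
assert (HcX : cont2 X).
{ destruct (Hpd 1%nat) as [H _]. intros x y. eapply continuity_2d_pt_ext; [|apply H]. intros; simpl; ring. }
assert (HcL : cont2 (fun x y => ln (1 - X x y))).
{ apply (cont2_comp (fun u => ln (1 - u)) X); auto. intros x y.
  apply continuity_pt_filterlim. apply (ex_derive_continuous (K:=R_AbsRing) (V:=R_NormedModule) (fun u => ln (1 - u))).
  auto_derive. apply HX1. }
assert (HS : forall N, pd (fun x y => log_series N (X x y))).
{ induction N as [|N IH].
  - simpl. split. intros x y; apply continuity_2d_pt_const. intros c' Hc'.
    assert (E := pd_form_scal c' 0 (fun _ _ => 1%R) Hc' (proj1 pd_one)).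
    replace (pd_form c' (fun _ _ => 0%R)) with (pd_form c' (fun _ _ => (0 * 1)%R)); [lra|].
    unfold pd_form. apply period_int_ext. intros x. f_equal.
    apply period_int_ext. intros y. f_equal. ring.
  - apply (pd_plus (fun x y => log_series N (X x y)) (fun x y => / INR (S N) * X x y ^ S N)%R); auto.
    apply (pd_scal (/ INR (S N)) (fun x y => X x y ^ S N)%R); auto.
    left; apply Rinv_0_lt_compat, lt_0_INR; lia. }
assert (T := TwoPI_pos).
apply le_epsilon. intros e He.
assert (HN : exists N, (2 * PI * (2 * PI * (lambda ^ N / (1 - lambda))) < e)%R).
{ assert (L : is_lim_seq (fun n => lambda ^ n)%R 0).
  { apply is_lim_seq_geom. rewrite Rabs_pos_eq; lra. }
  apply is_lim_seq_spec in L.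
  assert (He' : (0 < e * (1 - lambda) / (2 * PI * (2 * PI)))%R).
  { apply Rdiv_lt_0_compat; nra. }
  destruct (L (mkposreal _ He')) as [N HN]. specialize (HN N (le_n _)). simpl in HN.
  rewrite Rminus_0_r, Rabs_pos_eq in HN by (apply pow_le; lra).
  exists N. apply Rlt_div_r in HN; [|nra].
  replace (2 * PI * (2 * PI * (lambda ^ N / (1 - lambda))))%R with
    ((lambda ^ N * (2 * PI * (2 * PI))) / (1 - lambda))%R by (field; lra).
  apply Rlt_div_l; lra. }
destruct HN as [N HN].
set (E := fun x y => (-1 * ln (1 - X x y) + -1 * log_series N (X x y))%R).
assert (CE : cont2 E).
{ apply cont2_plus; (apply cont2_mult; [intros x y; apply continuity_2d_pt_const|]); auto. apply HS. }
assert (HE : (Rabs (pd_form c E) <= 2 * PI * (2 * PI * (lambda ^ N / (1 - lambda))))%R).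
{ apply pd_form_bound; auto. intros x y. unfold E.
  replace (-1 * ln (1 - X x y) + -1 * log_series N (X x y))%R with (- ln (1 - X x y) - log_series N (X x y))%R by ring.
  apply log_series_error; auto. }
assert (EE : pd_form c E = (-1 * pd_form c (fun x y => ln (1 - X x y)) + -1 * pd_form c (fun x y => log_series N (X x y)))%R).
{ unfold E. rewrite pd_form_plus, !pd_form_scal; auto. apply HS.
  all: apply cont2_mult; [intros x y; apply continuity_2d_pt_const|]; auto. apply HS. }
assert (P := proj2 (HS N) c Hc).
apply Rabs_le_between in HE. lra.
Qed.

(** * The logarithmic energy inequality *)

Lemma ln_le_minus_1 x : (0 < x)%R -> (ln x <= x - 1)%R.
Proof.
intros Hx. rewrite <- (ln_exp (x - 1)).
apply Rnot_lt_le. intros H. apply ln_lt_inv in H; auto; [|apply exp_pos].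
assert (T := exp_ineq1_le (x - 1)). lra.
Qed.

Lemma ln_diff_le x y : (0 < x)%R -> (0 < y)%R -> (ln x - ln y <= (x - y) / y)%R.
Proof.
intros Hx Hy. rewrite <- ln_div by auto.
replace ((x - y) / y)%R with (x / y - 1)%R by (field; lra).
apply ln_le_minus_1. now apply Rdiv_lt_0_compat.
Qed.

(** Here A is the distance of two image points, B the same distance after moving one point by d, p
    the distance of their preimages, m and M are Lipschitz constants, and d^2 v is the
    regularisation. Since v >= 1, the regularised A^2 stays comparable with B^2 even when A = 0. *)
Lemma log_comparison (A B M m p d v U : R) : (0 < m)%R -> (0 <= M)%R -> (0 < d <= p)%R ->
  (0 <= A)%R -> (Rabs (A - B) <= M * d)%R -> (m * p <= B)%R -> (1 <= v <= U)%R ->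
  (Rabs (ln (A ^ 2 + d ^ 2 * v) - ln (B ^ 2)) <=
   (2 * (1 + M ^ 2) * (2 * M + M ^ 2 / m + U / m) / m) * (d / p))%R.
Proof.
intros Hm HM Hd HA HAB HB Hv.
assert (PB : (0 < B)%R) by nra.
assert (Pd2 : (0 < d ^ 2)%R) by nra.
set (X := (A ^ 2 + d ^ 2 * v)%R). set (Y := (B ^ 2)%R).
assert (PX : (0 < X)%R) by (unfold X; nra).
assert (PY : (0 < Y)%R) by (unfold Y; nra).
assert (HdB : (d <= B / m)%R). { apply (Rle_div_r _ _ m); auto. nra. }
set (C1 := (2 * M + M ^ 2 / m + U / m)%R).
assert (PM2 : (0 <= M ^ 2)%R) by nra.
assert (PMm : (0 <= M ^ 2 / m)%R) by (apply Rdiv_le_0_compat; auto).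
assert (PUm : (0 <= U / m)%R) by (apply Rdiv_le_0_compat; lra).
assert (PC1 : (0 <= C1)%R) by (unfold C1; lra).
apply Rabs_le_between in HAB.
assert (HXY : (Rabs (X - Y) <= C1 * (d * B))%R).
{ assert (H1 : (Rabs (A ^ 2 - B ^ 2) <= M * d * (2 * B + M * d))%R).
  { replace (A ^ 2 - B ^ 2)%R with ((A - B) * (A + B))%R by ring.
    rewrite Rabs_mult. apply Rmult_le_compat; try apply Rabs_pos.
    apply Rabs_le; lra. rewrite Rabs_pos_eq; lra. }
  assert (H2 : (d ^ 2 * v <= d * (B / m) * U)%R).
  { apply Rmult_le_compat; try nra. }
  assert (H3 : (M * d * (M * d) <= M * d * (M * (B / m)))%R).
  { apply Rmult_le_compat_l. nra. apply Rmult_le_compat_l; lra. }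
  replace (C1 * (d * B))%R with (2 * M * d * B + M * d * (M * (B / m)) + d * (B / m) * U)%R
    by (unfold C1; field; lra).
  unfold X, Y. replace (A ^ 2 + d ^ 2 * v - B ^ 2)%R with ((A ^ 2 - B ^ 2) + d ^ 2 * v)%R by ring.
  eapply Rle_trans; [apply Rabs_triang|]. rewrite (Rabs_pos_eq (d ^ 2 * v)) by nra. nra. }
assert (HYX : (Y <= 2 * (1 + M ^ 2) * X)%R).
{ assert (B <= A + M * d)%R by lra.
  assert (B ^ 2 <= (A + M * d) ^ 2)%R by (apply pow_incr; lra).
  assert (0 <= (A - M * d) ^ 2)%R by apply pow2_ge_0.
  assert (d ^ 2 <= d ^ 2 * v)%R by nra. assert (0 <= A ^ 2)%R by nra.
  assert (0 <= M ^ 2 * A ^ 2)%R by (apply Rmult_le_pos; auto).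
  assert (M ^ 2 * d ^ 2 <= M ^ 2 * (d ^ 2 * v))%R by (apply Rmult_le_compat_l; auto).
  unfold X, Y. lra. }
assert (HQ : (C1 * (d * B) / Y <= C1 / m * (d / p))%R).
{ replace (C1 * (d * B) / Y)%R with (C1 * d / B)%R by (unfold Y; field; lra).
  replace (C1 / m * (d / p))%R with (C1 * d / (m * p))%R by (field; lra).
  unfold Rdiv. apply Rmult_le_compat_l.
  apply Rmult_le_pos; lra. apply Rinv_le_contravar; auto. apply Rmult_lt_0_compat; lra. }
assert (PQ : (0 <= C1 * (d * B) / Y)%R).
{ apply Rdiv_le_0_compat; auto. repeat apply Rmult_le_pos; lra. }
apply Rabs_le_between in HXY.
assert (U1 := ln_diff_le X Y PX PY). assert (U2 := ln_diff_le Y X PY PX).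
assert (V1 : ((X - Y) / Y <= C1 * (d * B) / Y)%R).
{ unfold Rdiv. apply Rmult_le_compat_r. left; now apply Rinv_0_lt_compat. lra. }
assert (V2 : ((Y - X) / X <= 2 * (1 + M ^ 2) * (C1 * (d * B) / Y))%R).
{ apply Rle_trans with (C1 * (d * B) / X)%R.
  - unfold Rdiv. apply Rmult_le_compat_r. left; now apply Rinv_0_lt_compat. lra.
  - apply (Rle_div_l _ _ X); auto.
    replace (2 * (1 + M ^ 2) * (C1 * (d * B) / Y) * X)%R with
      ((C1 * (d * B) / Y) * (2 * (1 + M ^ 2) * X))%R by ring.
    apply Rle_trans with ((C1 * (d * B) / Y) * Y)%R. right; field; lra.
    apply Rmult_le_compat_l; auto. }
replace (2 * (1 + M ^ 2) * C1 / m * (d / p))%R with (2 * (1 + M ^ 2) * (C1 / m * (d / p)))%R by (field; lra).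
assert (V3 : (2 * (1 + M ^ 2) * (C1 * (d * B) / Y) <= 2 * (1 + M ^ 2) * (C1 / m * (d / p)))%R).
{ apply Rmult_le_compat_l; nra. }
assert (V4 : (C1 * (d * B) / Y <= 2 * (1 + M ^ 2) * (C1 * (d * B) / Y))%R) by nra.
apply Rabs_le. lra.
Qed.

Lemma continuity_cos_shift alpha : continuity (fun t => cos (t + alpha)).
Proof.
intros t. apply (continuity_pt_comp (fun t => t + alpha)%R cos).
apply continuity_pt_plus. apply continuity_pt_id. apply continuity_cst. apply continuity_cos.
Qed.

Lemma period_int_cos alpha : period_int (fun t => cos (t + alpha)) = 0%R.
Proof.
apply (period_int_derive (fun t => sin (t + alpha))).
- intros t. auto_derive; auto; ring.
- apply continuity_cos_shift.
- rewrite Rplus_comm, sin_plus, sin_2PI, cos_2PI, Rplus_0_l. ring.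
Qed.

Lemma Rabs_cos_le x : (Rabs (cos x) <= 1)%R.
Proof. assert (T := COS_bound x). apply Rabs_le; lra. Qed.

Lemma cis_plus x y : cis (x + y) = cis x * cis y.
Proof. unfold cis, Cmult; simpl. rewrite cos_plus, sin_plus. f_equal; ring. Qed.

Lemma cis_neq_0 x : cis x <> RtoC 0.
Proof.
intros E. assert (T := sin2_cos2 x). unfold cis, RtoC in E. injection E as E1 E2.
rewrite E1, E2 in T. unfold Rsqr in T. lra.
Qed.

Lemma cis_neg x : cis (- x) = / cis x.
Proof.
assert (E : cis x * cis (- x) = RtoC 1).
{ rewrite <- cis_plus. unfold cis, RtoC. rewrite Rplus_opp_r, cos_0, sin_0. reflexivity. }
assert (T := cis_neq_0 x).
replace (cis (- x)) with ((cis x * cis (- x)) / cis x) by (field; auto). rewrite E. field; auto.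
Qed.

Lemma circ_cis r t : circ r t = RtoC r * cis t.
Proof. apply circ_1. Qed.

Lemma circle_int_inv_sq (k : C) s : (0 < s)%R ->
  circle_int (fun z => k * / (z * z)) s = 0%R.
Proof.
intros Hs.
assert (Hne : forall z, annulus 0 (2 * s) z -> z * z <> RtoC 0).
{ intros z [Hz _]. assert (z <> RtoC 0) by now apply Cmod_gt_0. now apply Cmult_neq_0. }
assert (Hin : forall t, annulus 0 (2 * s) (circ s t)).
{ intros t. unfold annulus. rewrite Cmod_circ; lra. }
assert (Hg : hol 1 (annulus 0 (2 * s)) (fun z => / (z * z))).
{ apply hol_inv; auto. apply hol_mult; apply hol_id. }
destruct Hg as [g' [Hg Hg']].
assert (Eg : forall z, annulus 0 (2 * s) z -> g' z = - (RtoC 2) / (z * z * z)).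
{ intros z Hz. eapply is_derive_C_unique. apply Hg; auto.
  assert (Hz2 := Hne z Hz).
  assert (z <> RtoC 0) by (destruct Hz as [Hz _]; now apply Cmod_gt_0).
  eapply is_derive_C_eq. apply (is_derive_C_comp Cinv (fun z => z * z)).
  now apply is_derive_C_inv. apply is_derive_C_mult; apply is_derive_C_id.
  replace (RtoC 2) with (RtoC 1 + RtoC 1) by (rewrite <- RtoC_plus; f_equal; lra). field. auto. }
unfold circle_int.
(* On the circle the angular derivative of z^(-2) is - 2 i z^(-2), whence the factor i/2 of the
   primitive. *)
apply (period_int_derive (fun t => Re (k * (Ci * RtoC (1/2)) * / (circ s t * circ s t)))).
- intros t.
  replace (Re (k * / (circ s t * circ s t))) with (Re (k * (Ci * RtoC (1/2)) * g' (circ s t) * (Ci * circ s t))).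
  + apply curve_derive_Re.
    apply (curve_derive_comp (fun z => k * (Ci * RtoC (1/2)) * / (z * z)) (circ s)).
    * eapply is_derive_C_eq. apply is_derive_C_mult. apply is_derive_C_const. now apply Hg. cbv beta; ring.
    * apply circ_derive_angle.
  + f_equal. rewrite Eg by auto.
    assert (Hc : circ s t <> RtoC 0) by (apply Cmod_gt_0; rewrite Cmod_circ; lra).
    assert (ECi : Ci * Ci = - RtoC 1) by (unfold Ci, RtoC, Cmult, Copp; simpl; f_equal; ring).
    replace (k * (Ci * RtoC (1 / 2)) * (- RtoC 2 / (circ s t * circ s t * circ s t)) * (Ci * circ s t))
      with ((Ci * Ci) * (- (RtoC (1/2) * RtoC 2)) * (k * / (circ s t * circ s t))) by (field; auto).
    rewrite ECi, <- RtoC_mult. replace (1 / 2 * 2)%R with 1%R by lra. ring.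
- apply (Ccont_circ_Re (fun z => k * / (z * z))). intros t.
  apply Ccont_mult. apply Ccont_const. eapply is_derive_Ccont. now apply Hg.
- now rewrite circ_period.
Qed.

(** Splitting the cosine into exponentials leaves means of U(z) = 1/S(z^2) = 1 - beta z^2 + ... and
    of U(z)/z^2. The former contributes 1/s; in the latter 1/z^2 integrates to 0 and the removable
    part (U - 1)/z^2 contributes - beta. *)
Lemma outer_integral (S : C -> C) (beta : C) (b s alpha : R) : (0 < s < b)%R -> (b <= 1)%R ->
  hol 1 (open_disc b) S -> (forall z, open_disc b z -> S z <> RtoC 0) ->
  S (RtoC 0) = RtoC 1 -> is_derive S (RtoC 0) beta ->
  period_int (fun x => cos (x + alpha) * Re (cis (- alpha) / (circ s x * S (circ s x * circ s x)%C)))%R =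
  (PI * (/ s - s * Re (cis (- (2 * alpha)) * beta)))%R.
Proof.
intros Hs Hb HS HS0 S0 Sb.
assert (Hsq : forall z, open_disc b z -> open_disc b (z * z)).
{ intros z Hz. unfold open_disc in *. rewrite Cmod_mult. assert (T := Cmod_ge_0 z). nra. }
set (U := fun z => / S (z * z)).
assert (HU : hol 1 (open_disc b) U).
{ apply hol_inv. intros z Hz; auto. apply (hol_comp 1 (open_disc b) (open_disc b) S (fun z => z * z)); auto.
  apply hol_mult; apply hol_id. }
(* On |z| = s one has e^(-i(x + alpha)) e^(-i alpha) / z = s e^(-2 i alpha) / z^2. *)
set (k := RtoC s * cis (- (2 * alpha))).
set (V := fun z => k * ((U z - RtoC 1) / (z * z))).
assert (Hsub : forall z, annulus 0 b z -> open_disc b z) by (intros z [_ Hz]; exact Hz).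
assert (Hz0 : forall z, annulus 0 b z -> z <> RtoC 0) by (intros z [Hz _]; now apply Cmod_gt_0).
assert (HV : hol 1 (annulus 0 b) V).
{ apply hol_mult. apply hol_const. apply hol_div.
  - intros z Hz. apply Cmult_neq_0; auto.
  - apply hol_minus. apply (hol_sub 1 (open_disc b)); auto. apply hol_const.
  - apply hol_mult; apply hol_id. }
assert (I1 := circle_int_mean U b s HU Hs).
assert (I2 : circle_int V s = (2 * PI * Re (k * - beta))%R).
{ apply circle_int_removable with b; auto.
  intros e He.
  assert (HdU : is_derive (fun x => / S x) (RtoC 0) (- beta)).
  { eapply is_derive_C_eq. apply (is_derive_C_comp Cinv S). apply is_derive_C_inv.
    rewrite S0. intros E; apply RtoC_inj in E; lra. exact Sb. rewrite S0. field. }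
  assert (Pk := Cmod_ge_0 k).
  destruct (proj1 (is_derive_C_eps _ _ _) HdU (e / (2 * (Cmod k + 1)))%R) as [d [Hd HH]].
  { apply Rdiv_lt_0_compat; lra. }
  exists (Rmin d 1). split. apply Rmin_pos; lra.
  assert (T1 := Rmin_l d 1). assert (T2 := Rmin_r d 1).
  intros z Hz.
  assert (Hzn : z <> RtoC 0) by (apply Cmod_gt_0; lra).
  assert (Pz : (0 < Cmod z * Cmod z)%R) by nra.
  specialize (HH (z * z)). replace (z * z - RtoC 0) with (z * z) in HH by ring.
  rewrite Cmod_mult in HH. specialize (HH ltac:(nra)). rewrite S0 in HH. fold (U z) in HH.
  unfold V. replace (k * ((U z - RtoC 1) / (z * z)) - k * - beta) with
    (k * ((U z - / RtoC 1 - - beta * (z * z)) / (z * z))) by (field; auto).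
  rewrite Cmod_mult, Cmod_div, Cmod_mult by now apply Cmult_neq_0.
  apply Rle_lt_trans with ((Cmod k + 1) * (e / (2 * (Cmod k + 1))))%R.
  - apply Rmult_le_compat; try lra. apply Rdiv_le_0_compat; auto. apply Cmod_ge_0.
    apply (Rle_div_l _ _ (Cmod z * Cmod z)); auto.
  - replace ((Cmod k + 1) * (e / (2 * (Cmod k + 1))))%R with (e / 2)%R by (field; lra). lra. }
assert (I3 := circle_int_inv_sq k s ltac:(lra)).
assert (Hin : forall t, annulus 0 b (circ s t)).
{ intros t. unfold annulus. rewrite Cmod_circ; lra. }
assert (C1 : continuity (fun t => Re (U (circ s t)))).
{ apply Ccont_circ_Re. intros t. apply (hol_cont _ _ _ HU). auto. }
assert (C2 : continuity (fun t => Re (V (circ s t)))).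
{ apply Ccont_circ_Re. intros t. apply (hol_cont _ _ _ HV). auto. }
assert (C3 : continuity (fun t => Re (k * / (circ s t * circ s t)))).
{ apply (Ccont_circ_Re (fun z => k * / (z * z))). intros t.
  apply Ccont_mult. apply Ccont_const.
  apply (hol_cont 0 (annulus 0 b) (fun z => / (z * z))); auto. apply hol_inv.
  intros z Hz. apply Cmult_neq_0; auto. apply hol_mult; apply (hol_id 0). }
assert (Hs0 : RtoC s <> RtoC 0) by (intros E; apply RtoC_inj in E; lra).
rewrite (period_int_ext _ (fun t => / (2 * s) * Re (U (circ s t)) +
   (1 / 2 * Re (V (circ s t)) + 1 / 2 * Re (k * / (circ s t * circ s t))))%R).
- rewrite period_int_plus, period_int_plus, !period_int_scal; auto.
  2,3,4: apply continuity_mult; auto using continuity_cst.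
  2: apply continuity_plus; apply continuity_mult; auto using continuity_cst.
  unfold circle_int in I1, I2, I3. rewrite I1, I2, I3.
  unfold U. replace (RtoC 0 * RtoC 0) with (RtoC 0) by ring. rewrite S0.
  replace (Re (/ RtoC 1)) with 1%R by (simpl; field).
  replace (Re (k * - beta)) with (- (s * Re (cis (- (2 * alpha)) * beta)))%R.
  field; lra. unfold k. destruct (cis (- (2 * alpha))), beta; simpl; ring.
- intros t. set (y := cis (- alpha) / (circ s t * S (circ s t * circ s t))).
  assert (Hc := Hz0 _ (Hin t)). assert (HSc := HS0 _ (Hsq _ (Hsub _ (Hin t)))).
  assert (E1 : U (circ s t) = RtoC s * (cis (t + alpha) * y)).
  { unfold U, y. rewrite cis_plus, cis_neg, circ_cis in *. field.
    repeat split; auto using cis_neq_0. }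
  assert (E2 : V (circ s t) + k * / (circ s t * circ s t) = cis (- (t + alpha)) * y).
  { transitivity (k * U (circ s t) / (circ s t * circ s t)).
    unfold V. field; auto.
    unfold U, y, k. replace (2 * alpha)%R with (alpha + alpha)%R by ring.
    rewrite !cis_neg, !cis_plus. rewrite (circ_cis s t) at 2 3 4. field_simplify_eq.
    rewrite circ_cis. ring. repeat split; auto using cis_neq_0.
    all: try (rewrite <- circ_cis); auto using cis_neq_0. }
  assert (E3 : (Re (V (circ s t)) + Re (k * / (circ s t * circ s t)))%R = Re (cis (- (t + alpha)) * y)).
  { rewrite <- E2. reflexivity. }
  rewrite E1. replace (1 / 2 * Re (V (circ s t)) + 1 / 2 * Re (k * / (circ s t * circ s t)))%R
    with (1 / 2 * (Re (V (circ s t)) + Re (k * / (circ s t * circ s t))))%R by ring.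
  rewrite E3. unfold cis. rewrite cos_neg, sin_neg. destruct y as [y1 y2]. simpl. field. lra.
Qed.

(** * The logarithmic kernel on the sphere *)

(** Denominator of the inverse stereographic projection, w -> (2 Re w, 2 Im w, |w|^2 - 1) / (1 +
    |w|^2). *)
Definition height (w : C) : R := (1 + Cmod w ^ 2)%R.

Definition stereo_dot (w v : C) : R :=
  ((2 * Re w / height w) * (2 * Re v / height v) +
   (2 * Im w / height w) * (2 * Im v / height v) +
   ((Cmod w ^ 2 - 1) / height w) * ((Cmod v ^ 2 - 1) / height v))%R.

Lemma height_ge_1 w : (1 <= height w)%R.
Proof. unfold height. assert (T := pow2_ge_0 (Cmod w)). lra. Qed.

Lemma stereo_dot_dist w v :
  (1 - stereo_dot w v = 2 * Cmod (w - v) ^ 2 / (height w * height v))%R.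
Proof.
assert (H1 := height_ge_1 w). assert (H2 := height_ge_1 v). unfold height, stereo_dot in *.
unfold height. rewrite !Cmod2_alt in *. destruct w as [a b], v as [c d]. simpl in *. field. lra.
Qed.

Lemma stereo_dot_opp w v :
  (1 + stereo_dot w v = 2 * Cmod (RtoC 1 + Cconj w * v) ^ 2 / (height w * height v))%R.
Proof.
assert (H1 := height_ge_1 w). assert (H2 := height_ge_1 v). unfold height, stereo_dot in *.
unfold height. rewrite !Cmod2_alt in *. destruct w as [a b], v as [c d]. simpl in *. field. lra.
Qed.

(** Instead of the Cauchy-Schwarz inequality, 1 - n.n' and 1 + n.n' are both explicit nonnegative
    quotients. *)
Lemma stereo_dot_le_1 w v : (Rabs (stereo_dot w v) <= 1)%R.
Proof.
assert (E1 := stereo_dot_dist w v). assert (E2 := stereo_dot_opp w v).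
assert (H1 := height_ge_1 w). assert (H2 := height_ge_1 v).
assert (P : (0 < height w * height v)%R) by nra.
assert (P1 : (0 <= 2 * Cmod (w - v) ^ 2 / (height w * height v))%R).
{ apply Rdiv_le_0_compat; auto. assert (T := pow2_ge_0 (Cmod (w - v))). lra. }
assert (P2 : (0 <= 2 * Cmod (RtoC 1 + Cconj w * v) ^ 2 / (height w * height v))%R).
{ apply Rdiv_le_0_compat; auto. assert (T := pow2_ge_0 (Cmod (RtoC 1 + Cconj w * v))). lra. }
apply Rabs_le. lra.
Qed.

(* Up to terms depending on one variable only, the regularised logarithmic kernel is
   ln (1 - lambda n.n') with n, n' on the unit sphere, hence minus a positive definite kernel. *)
Lemma ln_stereo (eps : R) w v : (0 < eps)%R ->
  (ln (1 - / (1 + 2 * eps) * stereo_dot w v) =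
   ln (2 / (1 + 2 * eps)) + ln (Cmod (w - v) ^ 2 + eps * (height w * height v))
   - ln (height w) - ln (height v))%R.
Proof.
intros He.
assert (H1 := height_ge_1 w). assert (H2 := height_ge_1 v).
assert (P : (0 < Cmod (w - v) ^ 2 + eps * (height w * height v))%R).
{ assert (T := pow2_ge_0 (Cmod (w - v))). assert (0 < eps * (height w * height v))%R by (repeat apply Rmult_lt_0_compat; lra). lra. }
assert (P2 : (0 < 2 / (1 + 2 * eps))%R) by (apply Rdiv_lt_0_compat; lra).
replace (1 - / (1 + 2 * eps) * stereo_dot w v)%R with
  ((2 / (1 + 2 * eps)) * (Cmod (w - v) ^ 2 + eps * (height w * height v)) / (height w * height v))%R.
- rewrite ln_div, !ln_mult by (try apply Rmult_lt_0_compat; lra). ring.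
- replace (stereo_dot w v) with (1 - (1 - stereo_dot w v))%R by ring.
  rewrite stereo_dot_dist. field. repeat split; lra.
Qed.

(** The kernel n.n' is a sum of three rank one kernels, one per coordinate, so multiplication by it
    preserves positivity through [pd_weight]. *)
Lemma pd_stereo_pow (H : R -> C) (lambda : R) : (0 <= lambda)%R ->
  continuity (fun t => Re (H t)) -> continuity (fun t => Im (H t)) ->
  forall N, pd (fun x y => (lambda * stereo_dot (H x) (H y)) ^ N)%R.
Proof.
intros Hl C1 C2.
assert (Ch : continuity (fun t => height (H t))).
{ unfold height. intros t.
  apply (continuity_pt_ext (fun t => 1 + (Re (H t) * Re (H t) + Im (H t) * Im (H t)))%R).
  intros u; rewrite Cmod2_alt; ring.
  apply (continuity_plus (fun _ => 1%R) (fun t => Re (H t) * Re (H t) + Im (H t) * Im (H t))%R).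
  apply continuity_cst. apply (continuity_plus (fun t => Re (H t) * Re (H t))%R (fun t => Im (H t) * Im (H t))%R);
  apply continuity_mult; auto. }
assert (Cdiv : forall p, continuity p -> continuity (fun t => p t / height (H t))%R).
{ intros p Hp. apply continuity_div; auto. intros t. assert (T := height_ge_1 (H t)). lra. }
assert (N1 := Cdiv _ (continuity_mult _ _ (continuity_cst 2) C1)).
assert (N2 := Cdiv _ (continuity_mult _ _ (continuity_cst 2) C2)).
assert (N3 : continuity (fun t => (Cmod (H t) ^ 2 - 1) / height (H t))%R).
{ apply Cdiv. intros t. apply (continuity_pt_ext (fun t => height (H t) - 2)%R).
  intros u; unfold height; ring. apply (continuity_minus (fun t => height (H t)) (fun _ => 2%R)); auto using continuity_cst. }
induction N as [|N IH]. { exact pd_one. }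
assert (P1 := pd_weight _ _ N1 IH). assert (P2 := pd_weight _ _ N2 IH). assert (P3 := pd_weight _ _ N3 IH).
assert (P := pd_scal lambda _ Hl (pd_plus _ _ (pd_plus _ _ P1 P2) P3)).
replace (fun x y => (lambda * stereo_dot (H x) (H y)) ^ S N)%R with
 (fun x y => lambda * (
     ((2 * Re (H x) / height (H x)) * (2 * Re (H y) / height (H y)) * (lambda * stereo_dot (H x) (H y)) ^ N +
      (2 * Im (H x) / height (H x)) * (2 * Im (H y) / height (H y)) * (lambda * stereo_dot (H x) (H y)) ^ N) +
      ((Cmod (H x) ^ 2 - 1) / height (H x)) * ((Cmod (H y) ^ 2 - 1) / height (H y)) * (lambda * stereo_dot (H x) (H y)) ^ N))%R.
exact P.
apply FunctionalExtensionality.functional_extensionality; intros x.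
apply FunctionalExtensionality.functional_extensionality; intros y.
change ((lambda * stereo_dot (H x) (H y)) ^ S N)%R with
  ((lambda * stereo_dot (H x) (H y)) * (lambda * stereo_dot (H x) (H y)) ^ N)%R.
set (Q := ((lambda * stereo_dot (H x) (H y)) ^ N)%R). unfold stereo_dot. ring.
Qed.

(** The factor 1 / (1 + 2 eps) keeps the argument of the logarithm away from 0, even on the
    diagonal, where n.n' = 1. *)
Lemma stereo_energy (H : R -> C) (eps alpha : R) : (0 < eps)%R ->
  continuity (fun t => Re (H t)) -> continuity (fun t => Im (H t)) ->
  (pd_form (fun t => cos (t + alpha))
     (fun x y => ln (1 - / (1 + 2 * eps) * stereo_dot (H x) (H y))) <= 0)%R /\
  cont2 (fun x y => ln (1 - / (1 + 2 * eps) * stereo_dot (H x) (H y))).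
Proof.
intros He C1 C2.
set (lambda := (/ (1 + 2 * eps))%R).
assert (Hl : (0 < lambda < 1)%R).
{ unfold lambda. split. apply Rinv_0_lt_compat; lra. rewrite <- Rinv_1. apply Rinv_lt_contravar; lra. }
assert (HX : forall x y, (Rabs (lambda * stereo_dot (H x) (H y)) <= lambda)%R).
{ intros x y. rewrite Rabs_mult, (Rabs_pos_eq lambda) by lra.
  rewrite <- (Rmult_1_r lambda) at 2. apply Rmult_le_compat_l. lra. apply stereo_dot_le_1. }
assert (HP := pd_stereo_pow H lambda ltac:(lra) C1 C2).
split.
- apply (pd_log lambda (fun x y => lambda * stereo_dot (H x) (H y))%R); auto. lra.
  apply continuity_cos_shift. intros x; apply Rabs_cos_le.
- apply (cont2_comp (fun u => ln (1 - u)) (fun x y => lambda * stereo_dot (H x) (H y))%R).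
  + intros x y. apply continuity_pt_filterlim.
    apply (ex_derive_continuous (K:=R_AbsRing) (V:=R_NormedModule) (fun u => ln (1 - u))).
    auto_derive. specialize (HX x y). assert (T := Rle_abs (lambda * stereo_dot (H x) (H y))). lra.
  + destruct (HP 1%nat) as [HH _]. intros x y. eapply continuity_2d_pt_ext; [|apply HH]. intros; simpl; ring.
Qed.

Lemma lnsq_Cmod z : lnsq z = ln (Cmod z ^ 2).
Proof. unfold lnsq. now rewrite Cmod2_alt. Qed.

Lemma is_derive_continuity (f f' : R -> R) : (forall t, is_derive f t (f' t)) -> continuity f.
Proof.
intros H t. apply continuity_pt_filterlim.
apply (ex_derive_continuous (K:=R_AbsRing) (V:=R_NormedModule)). eexists. apply H.
Qed.

Lemma circ_sub r s t : (r <= s)%R -> Cmod (circ s t - circ r t) = (s - r)%R.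
Proof.
intros H. replace (circ s t - circ r t) with (circ (s - r) t).
apply Cmod_circ; lra. unfold circ, Cminus, Cplus, Copp; simpl. f_equal; ring.
Qed.

(* The bound is O(d / p) with d = tau^2 and p the distance of the points, split by AM-GM so that
   [poisson_integral] can integrate it. *)
Lemma kernel_comparison (h : C -> C) (m s tau : R) (x : R) :
  (0 < m)%R -> (0 < s)%R -> (0 < tau)%R -> (tau ^ 2 < s)%R -> h (RtoC 0) = RtoC 0 ->
  (forall z w, (Cmod z <= s)%R -> (Cmod w <= s)%R ->
    (m * Cmod (z - w) <= Cmod (h z - h w))%R /\ (m * Cmod (h z - h w) <= Cmod (z - w))%R) ->
  forall y, (Rabs (ln (Cmod (h (circ s x) - h (circ s y)) ^ 2 +
     (tau ^ 2) ^ 2 * (height (h (circ s x)) * height (h (circ s y)))) -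
    lnsq (h (circ (s - tau ^ 2) y) - h (circ s x))) <=
  2 * (1 + (/ m) ^ 2) * (2 * / m + (/ m) ^ 2 / m + (1 + (s / m) ^ 2) ^ 2 / m) / m *
   (/ 2 * (tau + tau ^ 3 * / (Cmod (circ (s - tau ^ 2) y - circ s x) ^ 2))))%R.
Proof.
intros Hm Hs Ht Hts h0 HL y.
set (d := (tau ^ 2)%R) in *. assert (Pd : (0 < d)%R) by (unfold d; nra).
set (zs := circ s y). set (zr := circ (s - d) y). set (ze := circ s x).
assert (Ms : Cmod zs = s) by (apply Cmod_circ; lra).
assert (Mr : Cmod zr = (s - d)%R) by (apply Cmod_circ; lra).
assert (Me : Cmod ze = s) by (apply Cmod_circ; lra).
set (p := Cmod (zr - ze)).
assert (Hp : (d <= p)%R).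
{ assert (T := Cmod_triangle_rev ze zr). rewrite Cmod_sub_sym in T. fold p in T. lra. }
assert (PMi : (0 < / m)%R) by now apply Rinv_0_lt_compat.
assert (Hht : forall z, Cmod z = s -> (1 <= height (h z) <= 1 + (s / m) ^ 2)%R).
{ intros z Hz. split. apply height_ge_1. unfold height.
  assert (B : (Cmod (h z) <= s / m)%R).
  { destruct (HL z (RtoC 0)) as [_ B]; try rewrite Cmod_0; try lra.
    rewrite h0 in B. replace (h z - RtoC 0) with (h z) in B by ring. replace (z - RtoC 0) with z in B by ring.
    apply (Rle_div_r _ _ m); auto. lra. }
  assert (T := Cmod_ge_0 (h z)). apply Rplus_le_compat_l. apply pow_incr. lra. }
assert (He := Hht ze Me). assert (Hz := Hht zs Ms).
rewrite lnsq_Cmod, (Cmod_sub_sym (h ze)).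
assert (HC := log_comparison (Cmod (h zs - h ze)) (Cmod (h zr - h ze)) (/ m) m p d
  (height (h ze) * height (h zs)) ((1 + (s / m) ^ 2) ^ 2) Hm ltac:(lra) ltac:(lra) (Cmod_ge_0 _)).
eapply Rle_trans; [apply HC|].
- apply Rle_trans with (Cmod (h zs - h zr)).
  + assert (T1 := Cmod_triangle_rev (h zs - h ze) (h zr - h ze)).
    assert (T2 := Cmod_triangle_rev (h zr - h ze) (h zs - h ze)).
    rewrite (Cmod_sub_sym (h zr - h ze)) in T2.
    replace (h zs - h ze - (h zr - h ze)) with (h zs - h zr) in T1, T2 by ring.
    apply Rabs_le; lra.
  + destruct (HL zs zr) as [_ B]; try lra.
    assert (E : Cmod (zs - zr) = d) by (unfold zs, zr; rewrite circ_sub; lra). rewrite E in B.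
    apply Rmult_le_reg_l with m; auto. rewrite <- Rmult_assoc, Rinv_r, Rmult_1_l; lra.
- destruct (HL zr ze) as [B _]; try lra. exact B.
- split. nra. simpl. rewrite Rmult_1_r. apply Rmult_le_compat; lra.
- apply Rmult_le_compat_l.
  + unfold Rdiv. assert (0 < (/ m) ^ 2)%R by (apply pow_lt; auto).
    assert (0 <= (1 + (s * / m) ^ 2) ^ 2)%R by apply pow2_ge_0.
    repeat apply Rmult_le_pos; try lra. repeat apply Rplus_le_le_0_compat; try lra; apply Rmult_le_pos; lra.
  + assert (Pp : (0 < p)%R) by lra.
    (* With denominators cleared, the inequality is tau (p - tau)^2 >= 0. *)
    apply Rmult_le_reg_l with (2 * p ^ 2)%R. nra.
    replace (2 * p ^ 2 * (/ 2 * (tau + tau ^ 3 * / p ^ 2)))%R with (tau * p ^ 2 + tau ^ 3)%R by (field; lra).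
    replace (2 * p ^ 2 * (d / p))%R with (2 * p * tau ^ 2)%R by (unfold d; field; lra).
    assert (0 <= tau * (p - tau) ^ 2)%R by (apply Rmult_le_pos; [lra|apply pow2_ge_0]). lra.
Qed.

(** With r = s - tau^2 and Q = Re (e^(-2 i alpha) beta), the energy with one point on |z| = r is
    exactly 2 PI^2 (r/s) (s^2 Q - 1). The regularised energy is at most 0 and differs from it by
    O(tau), so s^2 Q <= 1 as tau tends to 0. *)
Lemma log_energy_bound (S : C -> C) (beta : C) (b s alpha : R) : (0 < s < b)%R -> (b <= 1)%R ->
  hol 2 (open_disc b) S -> (forall z, open_disc b z -> S z <> RtoC 0) ->
  S (RtoC 0) = RtoC 1 -> is_derive S (RtoC 0) beta ->
  (forall z w, open_disc b z -> open_disc b w -> z * S (z * z) = w * S (w * w) -> z = w) ->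
  (s * s * Re (cis (- (2 * alpha)) * beta) <= 1)%R.
Proof.
intros Hs Hb HS HS0 S0 Sb Hinj.
assert (Hsq : forall z, open_disc b z -> open_disc b (z * z)).
{ intros z Hz. unfold open_disc in *. rewrite Cmod_mult. assert (T := Cmod_ge_0 z). nra. }
assert (O0 : open_disc b (RtoC 0)) by (unfold open_disc; rewrite Cmod_0; lra).
set (h := fun z => z * S (z * z)).
assert (Hh2 : hol 2 (open_disc b) h).
{ apply hol_mult. apply hol_id. apply (hol_comp 2 (open_disc b) (open_disc b) S (fun z => z * z)); auto.
  apply hol_mult; apply hol_id. }
assert (Hhc := hol_cont _ _ _ Hh2).
destruct Hh2 as [h' [Hd Hh']].
assert (Hc' := hol_cont _ _ _ Hh').
assert (h0 : h (RtoC 0) = RtoC 0) by (unfold h; ring).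
assert (h'0 : h' (RtoC 0) = RtoC 1).
{ apply (is_derive_C_unique h (RtoC 0)); auto. unfold h.
  eapply is_derive_C_eq. apply is_derive_C_mult. apply is_derive_C_id.
  apply (is_derive_C_comp S (fun z => z * z)).
  replace (RtoC 0 * RtoC 0) with (RtoC 0) by ring. exact Sb.
  apply is_derive_C_mult; apply is_derive_C_id.
  cbv beta. replace (RtoC 0 * RtoC 0) with (RtoC 0) by ring. rewrite S0. ring. }
assert (Hne : forall z, open_disc b z -> h' z <> RtoC 0).
{ apply (injective_derive_neq_0 h h' b); auto. rewrite h'0. intros E; apply RtoC_inj in E; lra. }
destruct (injective_bilipschitz h h' s b Hs Hd Hc' Hinj Hne) as [m [Pm HL]].
assert (Hin : forall t, open_disc b (circ s t)) by (intros t; unfold open_disc; rewrite Cmod_circ; lra).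
set (H := fun t => h (circ s t)).
assert (H0 : forall t, H t <> RtoC 0).
{ intros t E. assert (E1 : circ s t = RtoC 0) by (apply Hinj; auto; fold (h (circ s t)); fold (h (RtoC 0)); rewrite h0; exact E).
  assert (E2 : Cmod (circ s t) = s) by (apply Cmod_circ; lra). rewrite E1, Cmod_0 in E2. lra. }
assert (C1 : continuity (fun t => Re (H t))) by (apply Ccont_circ_Re; auto).
assert (C2 : continuity (fun t => Im (H t))).
{ intros t. apply (continuity_pt_ext (fun t => Re (- Ci * h (circ s t)))). intros u; symmetry; apply Im_Re.
  apply (Ccont_circ_Re (fun z => - Ci * h z)). intros u. apply Ccont_mult. apply Ccont_const. auto. }
set (c := fun t => cos (t + alpha)).
assert (Cc : continuity c) by apply continuity_cos_shift.
assert (Ic : period_int c = 0%R) by apply period_int_cos.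
set (Q := Re (cis (- (2 * alpha)) * beta)).
set (C0 := (2 * (1 + (/ m) ^ 2) * (2 * / m + (/ m) ^ 2 / m + (1 + (s / m) ^ 2) ^ 2 / m) / m)%R).
assert (PC0 : (0 <= C0)%R).
{ assert (0 < / m)%R by now apply Rinv_0_lt_compat. unfold C0, Rdiv.
  assert (0 < (/ m) ^ 2)%R by (apply pow_lt; auto).
  assert (0 <= (1 + (s * / m) ^ 2) ^ 2)%R by apply pow2_ge_0.
  repeat apply Rmult_le_pos; try lra. repeat apply Rplus_le_le_0_compat; try lra; apply Rmult_le_pos; lra. }
assert (TP := TwoPI_pos).
assert (Main : forall tau, (0 < tau)%R -> (tau ^ 2 < s)%R ->
  ((s - tau ^ 2) / s * (s * s * Q - 1) <= C0 * (1 + / s) * tau)%R).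
{ intros tau Ht Hts. set (d := (tau ^ 2)%R) in *. assert (Pd : (0 < d)%R) by (unfold d; nra).
  set (r := (s - d)%R). assert (Hr : (0 < r < s)%R) by (unfold r; lra).
  (* The regularisation is added to a squared distance, so it is matched with the square of the
     displacement d. *)
  set (eps := (d ^ 2)%R). assert (Pe : (0 < eps)%R) by (unfold eps; nra).
  destruct (stereo_energy H eps alpha Pe C1 C2) as [Hen Hcont].
  set (k := fun x y => ln (1 - / (1 + 2 * eps) * stereo_dot (H x) (H y))) in *.
  set (v := fun t => ln (height (H t))).
  assert (Cv : continuity v).
  { intros t. unfold v. apply (continuity_pt_comp (fun t => height (H t)) ln).
    - unfold height. apply (continuity_pt_ext (fun t => 1 + (Re (H t) * Re (H t) + Im (H t) * Im (H t)))%R).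
      intros u; rewrite Cmod2_alt; ring.
      apply (continuity_plus (fun _ => 1%R) (fun t => Re (H t) * Re (H t) + Im (H t) * Im (H t))%R).
      apply continuity_cst. apply (continuity_plus (fun t => Re (H t) * Re (H t))%R (fun t => Im (H t) * Im (H t))%R);
      apply continuity_mult; auto.
    - assert (T := height_ge_1 (H t)). apply derivable_continuous_pt. exists (/ height (H t))%R.
      apply derivable_pt_lim_ln. lra. }
  set (L := fun x y => lnsq (h (circ r y) - H x)).
  (* H x is the image of a boundary point of |z| < s, so injectivity keeps it off the image of the
     disc, and [log_fourier_coeff] applies. *)
  assert (Hq0 : forall x z, open_disc s z -> h z - H x <> RtoC 0).
  { intros x z Hz E. unfold open_disc in Hz. assert (E1 : z = circ s x).
    { apply Hinj; auto. unfold open_disc; lra. fold (h z). fold (h (circ s x)). fold (H x).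
      replace (h z) with (h z - H x + H x) by ring. rewrite E; ring. }
    rewrite E1, Cmod_circ in Hz; lra. }
  assert (Hqd : forall x z, open_disc s z -> is_derive (fun z => h z - H x) z (h' z)).
  { intros x z Hz. eapply is_derive_C_eq. apply is_derive_C_plus. apply Hd. unfold open_disc in *; lra.
    apply is_derive_C_const. ring. }
  assert (Hinr : forall t, open_disc s (circ r t)) by (intros t; unfold open_disc; rewrite Cmod_circ; lra).
  assert (CL : forall x, continuity (L x)).
  { intros x. unfold L. eapply is_derive_continuity. intros t.
    apply (curve_derive_lnsq (fun t => h (circ r t) - H x)); auto.
    apply (curve_derive_comp (fun z => h z - H x) (circ r)). apply Hqd; auto. apply circ_derive_angle. }
  set (G := fun x => period_int (fun y => c y * L x y)%R).
  assert (EG : forall x, G x = (- (2 * PI * r) * Re (cis (- alpha) / H x))%R).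
  { intros x. unfold G, L, c.
    rewrite (log_fourier_coeff (fun z => h z - H x) h' s r alpha); auto.
    2:{ apply (hol_sub 1 (open_disc b)); auto. intros z Hz; unfold open_disc in *; lra. }
    rewrite h0, h'0. replace (RtoC r * cis (- alpha) * (RtoC 1 / (RtoC 0 - H x))) with
      (RtoC (- r) * (cis (- alpha) / H x)).
    destruct (cis (- alpha) / H x); simpl; ring.
    rewrite RtoC_opp. field. apply H0. }
  assert (CG : continuity G).
  { intros x. apply (continuity_pt_ext (fun x => - (2 * PI * r) * Re (cis (- alpha) / H x))%R).
    intros t; symmetry; apply EG.
    apply (continuity_mult (fun _ => (- (2 * PI * r))%R) (fun x => Re (cis (- alpha) / H x))).
    apply continuity_cst. apply (Ccont_circ_Re (fun z => cis (- alpha) / h z)).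
    intros t. apply Ccont_mult. apply Ccont_const.
    apply (Ccont_comp Cinv h). auto. eapply is_derive_Ccont. apply is_derive_C_inv. apply H0. }
  assert (IG : period_int (fun x => c x * G x)%R = (2 * PI * PI * ((s - d) / s * (s * s * Q - 1)))%R).
  { rewrite (period_int_ext _ (fun x => - (2 * PI * r) * (cos (x + alpha) * Re (cis (- alpha) / (circ s x * S (circ s x * circ s x)%C))))%R).
    2:{ intros t. rewrite EG. unfold c, H, h. ring. }
    rewrite period_int_scal.
    - rewrite (outer_integral S beta b s alpha); auto. fold Q. unfold r. field; lra.
      now apply hol_pred.
    - apply continuity_mult. exact Cc. apply (Ccont_circ_Re (fun z => cis (- alpha) / h z)).
      intros t. apply Ccont_mult. apply Ccont_const.
      apply (Ccont_comp Cinv h). auto. eapply is_derive_Ccont. apply is_derive_C_inv. apply H0. }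
  set (K0 := period_int (fun y => c y * v y)%R).
  set (I := fun x => period_int (fun y => c y * k x y)%R).
  assert (CI : continuity I) by now apply cont2_inner.
  set (E := (C0 * PI * (1 + / s) * tau)%R).
  assert (HD : forall x, (Rabs (I x + K0 - G x) <= E)%R).
  (* Terms depending on one variable disappear because the cosine has mean zero: [kx] in the inner
     integral, and [K0], which collects the terms in y, in the outer one. *)
  { intros x. set (kx := (ln (2 / (1 + 2 * eps)) - v x)%R).
    assert (Ck : continuity (k x)) by now apply cont2_slice.
    assert (E1 : (I x + K0 - G x)%R = period_int (fun y => c y * (k x y + v y - L x y - kx))%R).
    { rewrite (period_int_ext _ (fun y => (c y * k x y + c y * v y) - c y * L x y - kx * c y)%R) by (intros; ring).
      assert (X1 : continuity (fun y => c y * k x y)%R) by now apply continuity_mult.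
      assert (X2 : continuity (fun y => c y * v y)%R) by now apply continuity_mult.
      assert (X3 : continuity (fun y => c y * L x y)%R) by (apply continuity_mult; auto).
      assert (X4 : continuity (fun y => kx * c y)%R) by (apply continuity_mult; auto using continuity_cst).
      assert (X5 : continuity (fun y => c y * k x y + c y * v y)%R) by exact (continuity_plus _ _ X1 X2).
      assert (X6 : continuity (fun y => c y * k x y + c y * v y - c y * L x y)%R) by exact (continuity_minus _ _ X5 X3).
      rewrite (period_int_minus _ _ X6 X4), (period_int_minus _ _ X5 X3), (period_int_plus _ _ X1 X2), period_int_scal, Ic; auto.
      unfold I, K0, G. ring. }
    rewrite E1.
    assert (Cz : continuity (fun y => c y * (k x y + v y - L x y - kx))%R).
    { apply continuity_mult; auto. apply (continuity_minus (fun y => k x y + v y - L x y)%R (fun _ => kx)); auto using continuity_cst.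
      apply (continuity_minus (fun y => k x y + v y)%R (L x)); auto. now apply (continuity_plus (k x) v). }
    assert (HP := poisson_integral (circ s x) r). rewrite Cmod_circ in HP by lra. specialize (HP ltac:(lra)).
    set (w := fun y => (/ (Cmod (circ r y - circ s x) ^ 2))%R) in *.
    assert (Cw : continuity w).
    { intros y. unfold w. apply (continuity_inv (fun y => Cmod (circ r y - circ s x) ^ 2)%R).
      2:{ intros t. apply pow_nonzero. assert (T := Cmod_triangle_rev (circ s x) (circ r t)).
          rewrite Cmod_sub_sym, !Cmod_circ in T by lra. lra. }
      intros t. apply (continuity_pt_ext (fun y => Re (circ r y - circ s x) * Re (circ r y - circ s x) +
         Re (- Ci * (circ r y - circ s x)) * Re (- Ci * (circ r y - circ s x)))%R).
      { intros u. rewrite Cmod2_alt, <- !Im_Re. ring. }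
      apply (continuity_plus (fun y => Re (circ r y - circ s x) * Re (circ r y - circ s x))%R
         (fun y => Re (- Ci * (circ r y - circ s x)) * Re (- Ci * (circ r y - circ s x)))%R).
      apply continuity_mult; apply (Ccont_circ_Re (fun z => z - circ s x)); intros u;
       (apply Ccont_plus; [apply Ccont_id|apply Ccont_const]).
      apply continuity_mult; apply (Ccont_circ_Re (fun z => - Ci * (z - circ s x))); intros u;
       (apply Ccont_mult; [apply Ccont_const|]; apply Ccont_plus; [apply Ccont_id|apply Ccont_const]). }
    assert (Cb : continuity (fun y => C0 * (/ 2 * (tau + tau ^ 3 * w y)))%R).
    { apply continuity_mult; [apply continuity_cst|]. apply continuity_mult; [apply continuity_cst|].
      apply (continuity_plus (fun _ => tau) (fun y => tau ^ 3 * w y)%R); [apply continuity_cst|].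
      apply continuity_mult; auto using continuity_cst. }
    eapply Rle_trans; [now apply period_int_abs_le|].
    eapply Rle_trans; [apply period_int_le with (G := (fun y => C0 * (/ 2 * (tau + tau ^ 3 * w y)))%R)|]; auto.
    - intros y. apply (continuity_pt_comp _ Rabs y (Cz y)). apply Rcontinuity_abs.
    - intros y. rewrite Rabs_mult.
      rewrite <- (Rmult_1_l (C0 * _)). apply Rmult_le_compat; try apply Rabs_pos. apply Rabs_cos_le.
      assert (T := kernel_comparison h m s tau x Pm ltac:(lra) Ht Hts h0 HL y).
      fold C0 in T. fold d in T. fold r in T. fold (H x) in T. fold (H y) in T. fold (w y) in T.
      replace (k x y + v y - L x y - kx)%R with
       (ln (Cmod (H x - H y) ^ 2 + d ^ 2 * (height (H x) * height (H y))) - lnsq (h (circ r y) - H x))%R.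
      exact T. unfold k, kx, v, L. rewrite ln_stereo by auto. fold eps. ring.
    - assert (Cw3 : continuity (fun y => tau ^ 3 * w y)%R) by (apply continuity_mult; auto using continuity_cst).
      assert (Cw4 : continuity (fun y => tau + tau ^ 3 * w y)%R).
      { apply (continuity_plus (fun _ => tau) (fun y => tau ^ 3 * w y)%R); auto using continuity_cst. }
      rewrite period_int_scal, period_int_scal; auto. 2: apply continuity_mult; auto using continuity_cst.
      rewrite (period_int_plus (fun _ => tau) (fun y => tau ^ 3 * w y)%R); auto using continuity_cst.
      rewrite period_int_const, period_int_scal by auto. rewrite HP.
      unfold E. rewrite !Rmult_assoc. apply Rmult_le_compat_l; auto.
      assert (PP : (0 < PI)%R) by lra.
      (* Poisson's integral is of size 1 / (s^2 - r^2), that is 1 / (tau^2 (s + r)), so the weight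
         tau^3 leaves O(tau). *)
      assert (B : (tau ^ 3 / (s ^ 2 - r ^ 2) <= tau * / s)%R).
      { assert (D1 : (s ^ 2 - r ^ 2 = tau ^ 2 * (s + r))%R) by (unfold r, d; ring).
        rewrite D1. replace (tau ^ 3 / (tau ^ 2 * (s + r)))%R with (tau * / (s + r))%R by (field; split; lra).
        apply Rmult_le_compat_l; [lra|]. apply Rinv_le_contravar; lra. }
      replace (/ 2 * (2 * (PI * tau) + tau ^ 3 * (2 * PI / (s ^ 2 - r ^ 2))))%R with
        (PI * (tau + tau ^ 3 / (s ^ 2 - r ^ 2)))%R by (field; nra).
      apply Rmult_le_compat_l; lra. }
  assert (CD : continuity (fun x => I x + K0 - G x)%R).
  { apply (continuity_minus (fun x => I x + K0)%R G); auto.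
    apply (continuity_plus I (fun _ => K0)); auto using continuity_cst. }
  assert (CcD : continuity (fun x => c x * (I x + K0 - G x))%R) by now apply continuity_mult.
  assert (HcD : (Rabs (period_int (fun x => c x * (I x + K0 - G x))%R) <= 2 * PI * E)%R).
  { apply period_int_abs; auto. intros x. rewrite Rabs_mult.
    rewrite <- (Rmult_1_l E). apply Rmult_le_compat; try apply Rabs_pos; auto. apply Rabs_cos_le. }
  assert (Esum : (pd_form c k = period_int (fun x => c x * (I x + K0 - G x)) + period_int (fun x => c x * G x))%R).
  { unfold pd_form. fold I.
    rewrite <- period_int_plus; auto. 2: now apply continuity_mult.
    rewrite (period_int_ext (fun x => c x * (I x + K0 - G x) + c x * G x)%R (fun x => c x * I x + K0 * c x)%R) by (intros; ring).
    rewrite period_int_plus, period_int_scal, Ic; auto. unfold I. ring.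
    now apply continuity_mult. apply continuity_mult; auto using continuity_cst. }
  apply Rabs_le_between in HcD.
  fold c in Hen. rewrite Esum, IG in Hen.
  apply Rmult_le_reg_l with (2 * PI * PI)%R. { assert (PP : (0 < PI)%R) by lra. nra. }
  unfold E in HcD. replace (2 * PI * PI * (C0 * (1 + / s) * tau))%R with (2 * PI * (C0 * PI * (1 + / s) * tau))%R by ring.
  fold r in Hen. lra. }
apply Rnot_lt_le. intros Hgt.
set (g := (s * s * Q - 1)%R) in *. assert (Pg : (0 < g)%R) by (unfold g; lra).
assert (Pis : (0 < / s)%R) by (apply Rinv_0_lt_compat; lra).
set (C3 := (C0 * (1 + / s))%R) in *.
assert (PC3 : (0 <= C3)%R) by (apply Rmult_le_pos; lra).
(* Small enough that the left side of [Main] is at least g/2 and the right side at most g/4. *)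
set (tau := (Rmin (s / 2) (g / (4 * (C3 + 1))))%R).
assert (Pt : (0 < tau)%R). { apply Rmin_pos. lra. apply Rdiv_lt_0_compat; lra. }
assert (T1 := Rmin_l (s / 2) (g / (4 * (C3 + 1)))). assert (T2 := Rmin_r (s / 2) (g / (4 * (C3 + 1)))).
fold tau in T1, T2.
assert (Ht2 : (tau ^ 2 <= s / 2)%R) by nra.
specialize (Main tau Pt ltac:(lra)).
assert (B1 : (1 / 2 * g <= (s - tau ^ 2) / s * g)%R).
{ apply Rmult_le_compat_r. lra. apply (Rle_div_r _ _ s); lra. }
assert (B2 : (C3 * tau <= (C3 + 1) * (g / (4 * (C3 + 1))))%R).
{ apply Rmult_le_compat; lra. }
replace ((C3 + 1) * (g / (4 * (C3 + 1))))%R with (g / 4)%R in B2 by (field; lra).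
lra.
Qed.

(** * Square roots and the second coefficient of a univalent function *)

Lemma Re_quotient_pos (x y : C) : y <> RtoC 0 -> (Cmod (x - y) < Cmod y)%R -> (0 < Re (x / y))%R.
Proof.
intros Hy H. assert (P := proj1 (Cmod_gt_0 _) Hy).
assert (Q : (Cmod (x / y - RtoC 1) < 1)%R).
{ replace (x / y - RtoC 1) with ((x - y) / y) by (field; auto).
  rewrite Cmod_div by auto. apply (Rlt_div_l _ _ (Cmod y)); lra. }
assert (T := Re_near (RtoC 1) (x / y)). simpl (Re (RtoC 1)) in T. lra.
Qed.

(** A uniform step below which k z / k w lies in the right half plane, the domain of [csqrt]. In the
    compactness argument, pairs near a point off the diagonal satisfy the implication vacuously. *)
Lemma small_ratio_step (k : C -> C) (s R1 : R) : (s < R1)%R ->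
  (forall z, open_disc R1 z -> Ccont k z) -> (forall z, open_disc R1 z -> k z <> RtoC 0) ->
  exists d, (0 < d)%R /\ forall z w, (Cmod z <= s)%R -> (Cmod w <= s)%R ->
    (Cmod (z - w) < d)%R -> (Cmod (k z - k w) < Cmod (k w))%R.
Proof.
intros Hs Hc Hk.
apply (closed_disc_compact s (fun d z w => Cmod (z - w) < d -> Cmod (k z - k w) < Cmod (k w))%R).
{ intros d d' z w Hd H1 H2. apply H1. lra. }
intros z w Hz Hw. destruct (classic (z = w)) as [->|E0].
- assert (Dw : open_disc R1 w) by (unfold open_disc; lra).
  assert (P := proj1 (Cmod_gt_0 _) (Hk w Dw)).
  destruct (Hc w Dw (Cmod (k w) / 4)%R) as [d [Hd H]]; [lra|].
  exists d. split; auto. intros x y _ _ Hx Hy _. specialize (H x Hx) as H1. specialize (H y Hy) as H2.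
  assert (T1 := Cmod_triangle (k x - k w) (k w - k y)).
  replace (k x - k w + (k w - k y)) with (k x - k y) in T1 by ring.
  assert (T2 := Cmod_triangle_rev (k w) (k y)). rewrite (Cmod_sub_sym (k w)) in T1, T2. lra.
- assert (Hn : z - w <> RtoC 0).
  { intros E1. apply E0. replace z with (z - w + w) by ring. rewrite E1; ring. }
  apply Cmod_gt_0 in Hn. exists (Cmod (z - w) / 4)%R. split. lra.
  intros x y _ _ Hx Hy Hxy. exfalso.
  assert (T1 := Cmod_triangle (z - x) (x - y)).
  assert (T2 := Cmod_triangle (z - x + (x - y)) (y - w)).
  replace (z - x + (x - y) + (y - w)) with (z - w) in T2 by ring.
  rewrite (Cmod_sub_sym z x) in T1. lra.
Qed.

Fixpoint sqrt_product (k : C -> C) (n N : nat) (z : C) : C :=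
  match N with
  | O => RtoC 1
  | S M => sqrt_product k n M z *
      csqrt (k (RtoC (INR (S M) / INR n) * z) / k (RtoC (INR M / INR n) * z))
  end.

(* The square root is continued along rays: k(z)/k(0) is a telescoping product of ratios
   close to 1, each of which has a principal square root. *)
Lemma holomorphic_sqrt (k : C -> C) (s R1 : R) m : (0 < s < R1)%R ->
  hol m (open_disc R1) k -> (forall z, open_disc R1 z -> k z <> RtoC 0) ->
  exists S, hol m (open_disc s) S /\ (forall z, open_disc s z -> S z * S z = k z / k (RtoC 0)) /\
    S (RtoC 0) = RtoC 1.
Proof.
intros Hs Hk Hk0.
destruct (small_ratio_step k s R1) as [d [Hd Hstep]]; [lra|apply (hol_cont _ _ _ Hk)|auto|].
destruct (nfloor_ex (s / d)) as [n0 [_ Hn0]]. { apply Rdiv_le_0_compat; lra. }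
(* More than s / d subdivisions, so that consecutive points of a ray inside |z| < s are closer than
   d. *)
set (n := S n0).
assert (Pn : (0 < INR n)%R) by (apply lt_0_INR; unfold n; lia).
assert (Hnd : (s / INR n < d)%R).
{ apply (Rlt_div_l _ _ (INR n)); auto. unfold n. rewrite S_INR. apply (Rlt_div_l _ _ d) in Hn0; lra. }
assert (Hscale : forall N z, (N <= n)%nat -> open_disc s z -> (Cmod (RtoC (INR N / INR n) * z) <= s)%R).
{ intros N z HN Hz. unfold open_disc in Hz.
  assert (T : (0 <= INR N / INR n <= 1)%R).
  { split. apply Rdiv_le_0_compat; auto. apply pos_INR. apply (Rle_div_l _ _ (INR n)); auto. rewrite Rmult_1_l. now apply le_INR. }
  rewrite Cmod_mult, Cmod_R, Rabs_pos_eq by lra. assert (T' := Cmod_ge_0 z). nra. }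
assert (Hin : forall N z, (N <= n)%nat -> open_disc s z -> open_disc R1 (RtoC (INR N / INR n) * z)).
{ intros N z HN Hz. unfold open_disc. eapply Rle_lt_trans; [now apply Hscale|lra]. }
assert (Hpos : forall N z, (S N <= n)%nat -> open_disc s z ->
  (0 < Re (k (RtoC (INR (S N) / INR n) * z)%C / k (RtoC (INR N / INR n) * z)%C))%R).
{ intros N z HN Hz. apply Re_quotient_pos. apply Hk0, Hin; auto; lia.
  apply Hstep; try (apply Hscale; auto; lia).
  replace (RtoC (INR (S N) / INR n) * z - RtoC (INR N / INR n) * z) with (RtoC (/ INR n) * z).
  - rewrite Cmod_mult, Cmod_R, Rabs_pos_eq by (left; now apply Rinv_0_lt_compat).
    eapply Rle_lt_trans; [|exact Hnd]. unfold Rdiv. rewrite Rmult_comm. apply Rmult_le_compat_r.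
    left; now apply Rinv_0_lt_compat. unfold open_disc in Hz; lra.
  - replace (/ INR n)%R with (INR (S N) / INR n - INR N / INR n)%R by (rewrite S_INR; field; lra).
    rewrite RtoC_minus. ring. }
assert (Hall : forall N, (N <= n)%nat ->
  hol m (open_disc s) (sqrt_product k n N) /\
  (forall z, open_disc s z -> sqrt_product k n N z * sqrt_product k n N z = k (RtoC (INR N / INR n) * z) / k (RtoC 0)) /\
  sqrt_product k n N (RtoC 0) = RtoC 1).
{ assert (H00 : k (RtoC 0) <> RtoC 0) by (apply Hk0; unfold open_disc; rewrite Cmod_0; lra).
  induction N as [|N IH]; intros HN.
  - split; [|split]; cbn [sqrt_product].
    + apply hol_const.
    + intros z Hz. replace (RtoC (INR 0 / INR n) * z) with (RtoC 0). field; auto.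
      replace (INR 0 / INR n)%R with 0%R by (unfold Rdiv; simpl; ring). ring.
    + reflexivity.
  - destruct IH as [I1 [I2 I3]]; [lia|].
    assert (Hks : forall N', (N' <= n)%nat -> hol m (open_disc s) (fun z => k (RtoC (INR N' / INR n) * z))).
    { intros N' HN'. apply (hol_comp m (open_disc s) (open_disc R1) k (fun z => RtoC (INR N' / INR n) * z)); auto.
      apply hol_mult. apply hol_const. apply hol_id. }
    split; [|split].
    + apply (hol_mult m (open_disc s) (sqrt_product k n N)); auto.
      apply (hol_comp m (open_disc s) (fun v => 0 < Re v)%R csqrt
        (fun z => k (RtoC (INR (S N) / INR n) * z) / k (RtoC (INR N / INR n) * z))); auto.
      apply hol_csqrt. apply hol_div; auto.
      intros z Hz. apply Hk0, Hin; auto; lia. apply Hks; lia.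
    + intros z Hz. cbn [sqrt_product].
      set (v := k (RtoC (INR (S N) / INR n) * z) / k (RtoC (INR N / INR n) * z)).
      destruct (csqrt_spec v (Hpos N z HN Hz)) as [_ E].
      transitivity ((sqrt_product k n N z * sqrt_product k n N z) * (csqrt v * csqrt v)). ring.
      rewrite E, I2 by auto. unfold v. field. split; auto. apply Hk0, Hin; auto; lia.
    + cbn [sqrt_product]. rewrite I3.
      replace (RtoC (INR (S N) / INR n) * RtoC 0) with (RtoC 0) by ring.
      replace (RtoC (INR N / INR n) * RtoC 0) with (RtoC 0) by ring.
      replace (k (RtoC 0) / k (RtoC 0)) with (RtoC 1) by (field; auto). rewrite csqrt_1. ring. }
destruct (Hall n (le_n _)) as [H1 [H2 H3]].
exists (sqrt_product k n n). split; [|split]; auto.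
intros z Hz. rewrite H2 by auto. replace (INR n / INR n)%R with 1%R by (field; lra).
replace (RtoC 1 * z) with z by ring. reflexivity.
Qed.

(** theta is minus an argument of z: up to sign it is acos (Re z / |z|), and the sign of Im z
    decides which. *)
Lemma rotate_to_positive (z : C) : exists theta, Re (cis theta * z) = Cmod z.
Proof.
destruct (classic (z = RtoC 0)) as [->|Hz].
- exists 0%R. rewrite Cmod_0. unfold cis; simpl. ring.
- assert (P := proj1 (Cmod_gt_0 _) Hz). set (m := Cmod z) in *.
  assert (E2 : (m ^ 2 = Re z ^ 2 + Im z ^ 2)%R) by apply Cmod2_alt.
  set (x := (Re z / m)%R).
  assert (Hx : (-1 <= x <= 1)%R).
  { assert (T := re_le_Cmod z). fold m in T. apply Rabs_le_between in T. unfold x. split.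
    apply (Rle_div_r _ _ m); lra. apply (Rle_div_l _ _ m); lra. }
  assert (Es : (sin (acos x) * m = Rabs (Im z))%R).
  { rewrite sin_acos by auto.
    replace (1 - x²)%R with ((Im z / m) * (Im z / m))%R.
    - fold (Rsqr (Im z / m)). rewrite sqrt_Rsqr_abs. unfold Rdiv. rewrite Rabs_mult, (Rabs_pos_eq (/ m)).
      field. lra. left; now apply Rinv_0_lt_compat.
    - unfold x, Rsqr. apply Rmult_eq_reg_r with (m ^ 2)%R. 2: nra.
      transitivity (Im z ^ 2)%R. field; lra. transitivity (m ^ 2 - Re z ^ 2)%R. lra. field; lra. }
  assert (Ec : (cos (acos x) * m = Re z)%R).
  { rewrite cos_acos by auto. unfold x. field. lra. }
  destruct (Rle_lt_dec 0 (Im z)) as [Hi|Hi].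
  + exists (- acos x)%R. rewrite Rabs_pos_eq in Es by auto. unfold cis. rewrite cos_neg, sin_neg.
    destruct z as [a b]. simpl in *.
    apply Rmult_eq_reg_r with m; [|lra]. rewrite <- Es at 1. rewrite <- Ec at 1.
    replace (m * m)%R with (m * (m * 1))%R by ring. rewrite E2. rewrite <- Ec, <- Es. ring.
  + exists (acos x). rewrite Rabs_left in Es by auto. unfold cis.
    destruct z as [a b]. simpl in *.
    assert (Eb : (b = - (sin (acos x) * m))%R) by lra.
    apply Rmult_eq_reg_r with m; [|lra].
    replace (m * m)%R with (m * (m * 1))%R by ring. rewrite E2. rewrite Eb, <- Ec. ring.
Qed.

(* Bieberbach's inequality, through the odd function h(z) = sqrt (f (z^2)) = z + (a_2 / 2) z^3 + ... *)
Lemma univalent_second_coeff (a : nat -> C) (f : C -> C) : disc_coeffs a ->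
  a 0%nat = RtoC 0 -> a 1%nat = RtoC 1 -> (forall z, inD z -> f z = power_sum a z) ->
  univalent_on_D f -> (Cmod (a 2%nat) <= 2)%R.
Proof.
intros Ha H0 H1 Hf Hu.
assert (Ha1 : disc_coeffs (shift a)) by now apply disc_coeffs_shift.
assert (Hk := univalent_quotient_neq_0 a f Ha H0 H1 Hf Hu).
set (k := power_sum (shift a)) in *.
assert (Ek : forall z, inD z -> f z = z * k z).
{ intros z Hz. rewrite Hf, power_sum_shift, H0 by auto. fold (shift a). fold k. ring. }
assert (k0 : k (RtoC 0) = RtoC 1).
{ unfold k. rewrite power_sum_0 by auto. exact H1. }
apply Rnot_lt_le. intros Hgt. set (A := Cmod (a 2%nat)) in *.
(* With s = (1 + x)/2 one gets s^2 > x, hence A s^2 > 2, whereas the energy bound yields A s^2 <=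
   2. *)
set (x := (2 / A)%R).
assert (Hx : (0 < x < 1)%R).
{ split. apply Rdiv_lt_0_compat; lra. apply (Rlt_div_l _ _ A); lra. }
set (s := ((1 + x) / 2)%R). set (b := ((1 + s) / 2)%R).
assert (Hs : (0 < s < b)%R) by (unfold b, s; lra). assert (Hb : (b < 1)%R) by (unfold b, s; lra).
assert (Hbsub : forall z, open_disc b z -> inD z) by (intros z Hz; unfold open_disc, inD in *; lra).
destruct (holomorphic_sqrt k b 1 2) as [S [HS [ES S0]]]; auto. lra.
{ now apply hol_power_sum. }
assert (HSne : forall z, open_disc b z -> S z <> RtoC 0).
{ intros z Hz E. apply (Hk z (Hbsub z Hz)). specialize (ES z Hz). rewrite E, k0 in ES.
  replace (k z) with (k z / RtoC 1) by field. rewrite <- ES. ring. }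
assert (O0 : open_disc b (RtoC 0)) by (unfold open_disc; rewrite Cmod_0; lra).
assert (Hbeta : exists beta : C, is_derive S (RtoC 0) beta).
{ destruct HS as [S' [HS' _]]. exists (S' (RtoC 0)). auto. }
destruct Hbeta as [beta Hbeta].
(* Both sides are the derivative at 0 of f(z)/z = S(z)^2. *)
assert (Ea : a 2%nat = beta + beta).
{ apply (is_derive_C_unique k (RtoC 0)).
  - eapply is_derive_C_eq. apply is_derive_power_sum; auto using inD_0.
    rewrite power_sum_0 by now apply disc_coeffs_derive. unfold derive_coeffs, shift. simpl. ring.
  - apply is_derive_C_ext with (f := fun z => S z * S z) (d := b). lra.
    + intros y Hy. replace (y - RtoC 0) with y in Hy by ring. rewrite ES by exact Hy. rewrite k0. field.
    + eapply is_derive_C_eq. apply is_derive_C_mult; exact Hbeta. rewrite S0. ring. }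
assert (Hinj : forall z w, open_disc b z -> open_disc b w -> z * S (z * z) = w * S (w * w) -> z = w).
{ assert (Hsq : forall z, open_disc b z -> open_disc b (z * z)).
  { intros z Hz. unfold open_disc in *. rewrite Cmod_mult. assert (T := Cmod_ge_0 z). nra. }
  assert (Hf2 : forall z, open_disc b z -> f (z * z) = (z * S (z * z)) * (z * S (z * z))).
  { intros z Hz. rewrite Ek by auto.
    transitivity (z * z * (S (z * z) * S (z * z))); [|ring]. rewrite ES by auto. rewrite k0. field. }
  intros z w Hz Hw E.
  assert (E2 : z * z = w * w).
  { apply Hu; auto. rewrite !Hf2 by auto. now rewrite E. }
  destruct (classic (z = w)) as [|Hne]; auto.
  (* From z^2 = w^2. Since h(z) = z S(z^2) is odd, w = - z then forces h(z) = 0, hence z = 0. *)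
  assert (Hzw : z + w = RtoC 0).
  { apply NNPP. intros Hn. apply (Cmult_neq_0 (z - w) (z + w)); auto.
    - intros E3. apply Hne. replace z with (z - w + w) by ring. rewrite E3; ring.
    - replace ((z - w) * (z + w)) with (z * z - w * w) by ring. rewrite E2. ring. }
  assert (Ew : w = - z) by (replace w with (z + w - z) by ring; rewrite Hzw; ring).
  assert (Ez : z = RtoC 0).
  { apply NNPP. intros Hn.
    apply (Cmult_neq_0 (RtoC 2) (z * S (z * z))).
    - intros E3. apply RtoC_inj in E3. lra.
    - apply Cmult_neq_0; auto.
    - replace (RtoC 2) with (RtoC 1 + RtoC 1) by (rewrite <- RtoC_plus; f_equal; lra).
      rewrite <- E2 in E. rewrite Ew in E.
      replace ((RtoC 1 + RtoC 1) * (z * S (z * z))) with (z * S (z * z) - (- z * S (z * z))) by ring.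
      rewrite <- E. ring. }
  rewrite Ew, Ez. ring. }
destruct (rotate_to_positive beta) as [theta Htheta].
(* This alpha makes - 2 alpha the rotation that turns beta into |beta|. *)
assert (HB := log_energy_bound S beta b s (- theta / 2) Hs ltac:(lra) HS HSne S0 Hbeta Hinj).
replace (- (2 * (- theta / 2)))%R with theta in HB by field. rewrite Htheta in HB.
assert (HA : (A <= 2 * Cmod beta)%R).
{ unfold A. rewrite Ea. assert (T := Cmod_triangle beta beta). lra. }
assert (E1 : (A * x = 2)%R) by (unfold x; field; lra).
assert (Hsx : (x < s * s)%R) by (unfold s; nra).
assert (A * x < A * (s * s))%R by (apply Rmult_lt_compat_l; lra).
assert (A * (s * s) <= 2 * Cmod beta * (s * s))%R by (apply Rmult_le_compat_r; nra).
nra.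
Qed.

(** * The quadratic polynomial z + b z^2 *)

(** The points u = -1/3 and u = 1/3 go to 0 and 3/2, the ends of the diameter. With denominators
    cleared, the terms linear in Re u cancel in the last inequality and |u|^2 < 1/9 is what
    remains. *)
Lemma quotient_in_disc (u : C) : (Cmod u < 1 / 3)%R ->
  RtoC 1 + u <> RtoC 0 /\ (0 < Re ((RtoC 1 + RtoC 3 * u) / (RtoC 1 + u)))%R /\
  (Cmod ((RtoC 1 + RtoC 3 * u) / (RtoC 1 + u)) ^ 2 <
   3 / 2 * Re ((RtoC 1 + RtoC 3 * u) / (RtoC 1 + u)))%R.
Proof.
intros Hu.
assert (E : (Cmod u ^ 2 = Re u ^ 2 + Im u ^ 2)%R) by apply Cmod2_alt.
assert (P := Cmod_ge_0 u).
assert (E9 : (Re u ^ 2 + Im u ^ 2 < 1 / 9)%R) by (rewrite <- E; nra).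
assert (Hx := re_le_Cmod u). apply Rabs_le_between in Hx.
assert (Hne : RtoC 1 + u <> RtoC 0).
{ intros E0. assert (E1 : (Re (RtoC 1 + u) = 0)%R) by now rewrite E0.
  change (1 + Re u = 0)%R in E1. lra. }
split; auto.
assert (Q := normsq_pos _ Hne).
assert (ER : Re ((RtoC 1 + RtoC 3 * u) / (RtoC 1 + u)) =
  ((1 + 4 * Re u + 3 * (Re u ^ 2 + Im u ^ 2)) / ((1 + Re u) ^ 2 + Im u ^ 2))%R).
{ destruct u as [x y]. simpl in *. field. nra. }
assert (EM : (Cmod ((RtoC 1 + RtoC 3 * u) / (RtoC 1 + u)) ^ 2 =
  ((1 + 3 * Re u) ^ 2 + 9 * Im u ^ 2) / ((1 + Re u) ^ 2 + Im u ^ 2))%R).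
{ rewrite Cmod_div by auto.
  replace ((Cmod (RtoC 1 + RtoC 3 * u) / Cmod (RtoC 1 + u)) ^ 2)%R with
   (Cmod (RtoC 1 + RtoC 3 * u) ^ 2 / Cmod (RtoC 1 + u) ^ 2)%R by (field; apply Rgt_not_eq, Cmod_gt_0, Hne).
  rewrite !Cmod2_alt. destruct u as [x y]. simpl in *. f_equal; [ring|f_equal; ring]. }
rewrite ER, EM.
assert (Q' : (0 < (1 + Re u) ^ 2 + Im u ^ 2)%R) by (destruct u; simpl in *; lra).
split.
- apply Rdiv_lt_0_compat; auto. nra.
- replace (3 / 2 * ((1 + 4 * Re u + 3 * (Re u ^ 2 + Im u ^ 2)) / ((1 + Re u) ^ 2 + Im u ^ 2)))%R
   with ((3 / 2 * (1 + 4 * Re u + 3 * (Re u ^ 2 + Im u ^ 2))) / ((1 + Re u) ^ 2 + Im u ^ 2))%R by (field; lra).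
  apply (Rmult_lt_compat_r (/ ((1 + Re u) ^ 2 + Im u ^ 2))). now apply Rinv_0_lt_compat. nra.
Qed.

(** For s = sqrt v the claim is |s|^2 < 2 Re s. Squared, it reads |v|^2 < 2 (|v| + Re v), the inside
    of a cardioid, which contains the disc |v|^2 < (3/2) Re v. *)
Lemma csqrt_minus_1_lt (v : C) : (0 < Re v)%R -> (Cmod v ^ 2 < 3 / 2 * Re v)%R ->
  (Cmod (csqrt v - RtoC 1) < 1)%R.
Proof.
intros Hv H. destruct (csqrt_spec v Hv) as [Hp E]. set (s := csqrt v) in *.
assert (EM : (Cmod v = Re s ^ 2 + Im s ^ 2)%R) by (rewrite <- E, Cmod_mult, <- Cmod2_alt; ring).
assert (ER : (Re v = Re s ^ 2 - Im s ^ 2)%R) by (rewrite <- E; destruct s; simpl; ring).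
rewrite EM, ER in H.
assert (K : (Re s ^ 2 + Im s ^ 2 < 2 * Re s)%R).
{ apply Rnot_le_lt. intros HH. assert ((2 * Re s) ^ 2 <= (Re s ^ 2 + Im s ^ 2) ^ 2)%R by (apply pow_incr; lra).
  assert (0 <= Im s ^ 2)%R by apply pow2_ge_0. nra. }
assert (E2 : (Cmod (s - RtoC 1) ^ 2 = Re s ^ 2 + Im s ^ 2 - 2 * Re s + 1)%R).
{ rewrite Cmod2_alt. destruct s; simpl; ring. }
assert (T := Cmod_ge_0 (s - RtoC 1)). nra.
Qed.

Lemma Cderiv_eq (f : C -> C) (z l : C) : is_derive f z l -> Cderiv f z = l.
Proof.
intros H. unfold Cderiv. destruct excluded_middle_informative as [E|E].
- destruct (constructive_indefinite_description _ E) as [l' H']. simpl. now apply (is_derive_C_unique f z).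
- exfalso. apply E. now exists l.
Qed.

Lemma quadratic_Scar (g : C -> C) (b : C) : (Cmod b <= 1 / 3)%R ->
  (forall z, g z = z + b * (z * z)) -> classScar g.
Proof.
intros Hb Hg.
assert (Hd : forall z, is_derive g z (RtoC 1 + RtoC 2 * (b * z))).
{ intros z. apply is_derive_C_ext with (f := fun z => z + b * (z * z)) (d := 1%R). lra.
  intros y _; now rewrite Hg.
  eapply is_derive_C_eq. apply is_derive_C_plus. apply is_derive_C_id.
  apply is_derive_C_mult. apply is_derive_C_const. apply is_derive_C_mult; apply is_derive_C_id.
  cbv beta. ring. }
assert (Hu : forall z, inD z -> (Cmod (b * z) < 1 / 3)%R).
{ intros z Hz. unfold inD in Hz. rewrite Cmod_mult. assert (T := Cmod_ge_0 z). assert (T' := Cmod_ge_0 b). nra. }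
split; [split; [|split]|].
- intros z _. eexists. apply Hd.
- rewrite Hg. ring.
- eapply is_derive_C_eq. apply Hd. ring.
- set (v := fun z => (RtoC 1 + RtoC 3 * (b * z)) / (RtoC 1 + b * z)).
  exists (fun z => csqrt (v z) - RtoC 1).
  assert (Hv : forall z, inD z -> _) by exact (fun z Hz => quotient_in_disc (b * z) (Hu z Hz)).
  assert (Hv1 : forall z, inD z -> (0 < Re (v z))%R) by (intros z Hz; apply (Hv z Hz)).
  assert (Hbz : hol 1 inD (fun z => b * z)).
  { apply hol_mult. apply hol_const. apply hol_id. }
  assert (Hw : hol 1 inD (fun z => csqrt (v z) - RtoC 1)).
  { apply hol_minus; [|apply hol_const].
    apply (hol_comp 1 inD (fun v => 0 < Re v)%R csqrt v); auto using hol_csqrt.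
    apply hol_div. intros z Hz; apply (Hv z Hz).
    apply hol_plus. apply hol_const. apply hol_mult; auto. apply hol_const.
    apply hol_plus; auto. apply hol_const. }
  split; [|split; [|split]].
  + destruct Hw as [w' [Hw' _]]. intros z Hz. exists (w' z). auto.
  + unfold v. replace (b * RtoC 0) with (RtoC 0) by ring.
    replace ((RtoC 1 + RtoC 3 * RtoC 0) / (RtoC 1 + RtoC 0)) with (RtoC 1).
    rewrite csqrt_1. ring. field.
  + intros z Hz. destruct (Hv z Hz) as [_ [V1 V2]]. now apply csqrt_minus_1_lt.
  + intros z Hz. destruct (Hv z Hz) as [V0 [V1 _]]. fold (v z) in V1.
    destruct (csqrt_spec (v z) V1) as [_ E].
    assert (Ephi : phi_car (csqrt (v z) - RtoC 1) = (RtoC 1 + RtoC 2 * (b * z)) / (RtoC 1 + b * z)).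
    (* Completing the square, 1 + w + w^2/2 = (1 + (1 + w)^2)/2, which is how the square root
       enters. *)
    { unfold phi_car. transitivity ((RtoC 1 + csqrt (v z) * csqrt (v z)) / RtoC 2).
      - field.
      - rewrite E. unfold v. field. exact V0. }
    rewrite Ephi. unfold zfprime_over_f. destruct excluded_middle_informative as [->|Hz0].
    * replace (b * RtoC 0) with (RtoC 0) by ring. field.
    * rewrite (Cderiv_eq g z _ (Hd z)), Hg. field. split; auto.
      replace (z + b * (z * z)) with (z * (RtoC 1 + b * z)) by ring. now apply Cmult_neq_0.
Qed.

Lemma f2rho_Scar (a : nat -> C) (rho : R) : (0 < rho)%R ->
  (Cmod (a 2%nat) * rho <= 1 / 3)%R -> classScar (f2rho a rho).
Proof.
intros Hr Ha. apply quadratic_Scar with (a 2%nat * RtoC rho).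
- rewrite Cmod_mult, Cmod_R, Rabs_pos_eq; lra.
- intros z. unfold f2rho, f2. simpl Cpow. field. intros E; apply RtoC_inj in E; lra.
Qed.

Theorem theorem3p5 (f : C -> C) (a : nat -> C) :
  classA f ->
  a 0%nat = RtoC 0 -> a 1%nat = RtoC 1 ->
  (forall z, inD z -> is_pseries a z (f z)) ->
  (forall rho : R, (0 < rho <= 1 / 3)%R ->
     classK f -> classScar (f2rho a rho)) /\
  (forall rho : R, (0 < rho <= 1 / 6)%R ->
     (classS f \/ classSstar f \/ classCC f) -> classScar (f2rho a rho)).
Proof.
intros HA H0 H1 Hps.
assert (Ha := is_pseries_disc_coeffs a f Hps).
assert (Hf : forall z, inD z -> f z = power_sum a z).
{ intros z Hz. symmetry. apply is_pseries_power_sum. now apply Hps. }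
split.
- intros rho Hr [[_ Hu] Hc].
  assert (B := convex_second_coeff a f Ha H0 H1 Hf Hu Hc).
  apply f2rho_Scar. lra. assert (T := Cmod_ge_0 (a 2%nat)). nra.
- intros rho Hr Hcl.
  assert (Hu : univalent_on_D f).
  { destruct Hcl as [[_ Hu]|[[[_ Hu] _]|Hcc]]; auto. now apply close_to_convex_univalent. }
  assert (B := univalent_second_coeff a f Ha H0 H1 Hf Hu).
  apply f2rho_Scar. lra. assert (T := Cmod_ge_0 (a 2%nat)). nra.
Qed.
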